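(* Let $n\geq 2$, let $\Omega\subset\mathbb{R}^n$ be a domain, and let $q>1$ and $a>0$ be real numbers with $\left(1-\frac{1}{q}\right)a\geq 1$. Assume that $f\in W^{2,q}(\Omega,\mathbb{R}^n)$ is a mapping with $|J_f|^{-a}\in L^1(\Omega)$, and let $\pi$ denote the projection of $\mathbb{R}^n$ to some (arbitrary) hyperplane. Then, with $Df$ taken to be its precise representative and $J_f$ the determinant of this representative, $$\mathcal{H}^{n-1}\bigl(\pi(\{x\in\Omega: J_f(x)=0\})\bigr)=0.$$ Moreover, it follows that either $J_f>0$ a.e. in $\Omega$ or $J_f<0$ a.e. in $\Omega$.
   Context: A domain is a connected open set. $W^{2,q}(\Omega,\mathbb{R}^n)$ is the Sobolev space of mappings $f:\Omega\to\mathbb{R}^n$ whose weak derivatives up to order two belong to $L^q(\Omega)$. $Df$ denotes the $n\times n$ matrix of weak first derivatives. The precise representative of $Df$ is defined at every $x\in\Omega$ (entrywise) by $$Df(x)=\limsup_{r\to 0+}\frac{1}{|B(x,r)|}\int_{B(x,r)} Df(y)\,dy,$$ and $J_f(x)$ is the determinant of the matrix $Df(x)$ given by this representative; points at which some entry is not finite are not counted in the set $\{J_f=0\}$. The condition $|J_f|^{-a}\in L^1(\Omega)$ means $\int_\Omega|J_f(x)|^{-a}\,dx<\infty$, with $0^{-a}=+\infty$. $\mathcal{H}^{n-1}$ is the $(n-1)$-dimensional Hausdorff measure, and projection to a hyperplane means orthogonal projection. *)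

(* Defs.v *)
From HB Require Import structures.
From mathcomp Require Import all_boot all_order all_algebra.
From mathcomp Require Import all_classical all_reals all_analysis.

Set Implicit Arguments.
Unset Strict Implicit.
Unset Printing Implicit Defensive.

Import Order.TTheory GRing.Theory Num.Theory.
Import numFieldNormedType.Exports.

Local Open Scope classical_set_scope.
Local Open Scope ring_scope.

(* Points of R^n are row vectors.  The library's norm on 'rV[R]_n is the sup
   norm: it gives the right topology, but Euclidean balls, diameters and
   orthogonality have to be introduced separately. *)
Section euclidean.
Context {R : realType} {n : nat}.
Implicit Types (x y : 'rV[R]_n) (A : set 'rV[R]_n).

Definition dot x y : R := \sum_(i < n) x ord0 i * y ord0 i.

Definition enorm x : R := Num.sqrt (dot x x).

Definition eball x (r : R) : set 'rV[R]_n := [set y | enorm (y - x) < r].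

Definition ediam A : \bar R :=
  ereal_sup [set (enorm (x - y))%:E | x in A & y in A].

(* A genuine hyperplane only for nu != 0. *)
Definition hyperplane (nu : 'rV[R]_n) (c : R) : set 'rV[R]_n :=
  [set y | dot nu y = c].

Definition orthogonal_projection A (p : 'rV[R]_n -> 'rV[R]_n) :=
  forall x, A (p x) /\ forall y, A y -> dot (x - p x) (y - p x) = 0.

End euclidean.

Definition rV_display : measure_display -> measure_display.
Proof. exact. Qed.

Section measurable_rV.
Context {d} {T : measurableType d} (n : nat).

Let coord (i : 'I_n) (x : 'rV[T]_n) : T := x ord0 i.

Let rV_set0 : g_sigma_preimage coord set0.
Proof. exact: sigma_algebra0. Qed.

Let rV_setC A : g_sigma_preimage coord A -> g_sigma_preimage coord (~` A).
Proof. exact: sigma_algebraC. Qed.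

Let rV_bigcup (F : (set 'rV[T]_n)^nat) :
  (forall i, g_sigma_preimage coord (F i)) ->
  g_sigma_preimage coord (\bigcup_i F i).
Proof. exact: sigma_algebra_bigcup. Qed.

HB.instance Definition _ := @isMeasurable.Build (rV_display d)
  'rV[T]_n (g_sigma_preimage coord) rV_set0 rV_setC rV_bigcup.

Lemma measurable_coord_rV i :
  measurable_fun [set: 'rV[T]_n] (fun x : 'rV[T]_n => x ord0 i).
Proof.
move=> _ B mB; rewrite setTI; apply: sub_sigma_algebra => /=.
rewrite -bigcup_seq/=; exists i => /=; first by rewrite mem_index_enum.
by exists B => //; rewrite setTI.
Qed.

Lemma measurable_fun_rV d' (S : measurableType d') (f : S -> 'rV[T]_n) :
  (forall i, measurable_fun [set: S] (fun s => f s ord0 i)) ->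
  measurable_fun [set: S] f.
Proof.
move=> mf.
have sub : g_sigma_preimage coord `<=` [set A | measurable (f @^-1` A)].
  apply: smallest_sub.
    split => /=.
    - by rewrite preimage_set0.
    - by move=> A mA; rewrite setTD preimage_setC; exact: measurableC.
    - by move=> F mF; rewrite preimage_bigcup; exact: bigcupT_measurable.
  rewrite -bigcup_seq/=; apply: bigcup_sub => i _ A [B mB <-] /=.
  have := mf i measurableT B mB.
  by rewrite !setTI.
by move=> _ A mA; rewrite setTI; exact: sub.
Qed.

End measurable_rV.

Section lebesgue.
Context {R : realType}.

Definition cons_rV n (p : 'rV[R]_n * measurableTypeR R) : 'rV[R]_n.+1 :=
  \row_(i < n.+1) if unlift ord0 i is Some j then p.1 ord0 j else p.2.

Lemma measurable_cons_rV n : measurable_fun setT (@cons_rV n).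
Proof.
apply: measurable_fun_rV => i.
case: (unliftP ord0 i) => [j ->|->].
- under eq_fun do rewrite mxE liftK.
  exact: (measurableT_comp (measurable_coord_rV _) measurable_fst).
- under eq_fun do rewrite mxE unlift_none.
  exact: measurable_snd.
Qed.

(* Lebesgue measure on the Borel sets, as an iterated product. *)
Fixpoint borel_lebesgue (n : nat) : set 'rV[R]_n -> \bar R :=
  match n with
  | 0 => \d_(0 : 'rV[R]_0)
  | m.+1 => pushforward (@borel_lebesgue m \x @lebesgue_measure R)%E (@cons_rV m)
  end.

Lemma borel_lebesgue_is_measure n :
  [/\ @borel_lebesgue n set0 = 0%E,
      forall A, (0 <= @borel_lebesgue n A)%E &
      semi_sigma_additive (@borel_lebesgue n)].
Proof.
elim: n => [|n [IH0 IHge0 IHsigma]].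
  by split; [exact: measure0 | exact: measure_ge0
            | exact: measure_semi_sigma_additive].
pose h := isMeasure.Build _ _ _ _ IH0 IHge0 IHsigma.
pose mu : {measure set 'rV[R]_n -> \bar R} := HB.pack (@borel_lebesgue n) h.
pose nu : {measure set ('rV[R]_n * measurableTypeR R) -> \bar R} :=
  (mu \x @lebesgue_measure R)%E.
rewrite /=; split.
- by rewrite /pushforward preimage_set0; exact: (measure0 nu).
- by move=> A; exact: (measure_ge0 nu).
- move=> F mF tF mUF; rewrite /pushforward preimage_bigcup.
  have mc A : measurable A -> measurable (@cons_rV n @^-1` A).
    by move=> mA; rewrite -[X in measurable X]setTI; exact: measurable_cons_rV.
  apply: (@measure_semi_sigma_additive _ _ _ nu).
  + by move=> k; exact: mc.
  + apply/trivIsetP => /= i j _ _ ij; rewrite -preimage_setI.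
    by move/trivIsetP : tF => /(_ _ _ _ _ ij) ->//; rewrite preimage_set0.
  + by rewrite -preimage_bigcup; exact: mc.
Qed.

HB.instance Definition _ n := isMeasure.Build _ _ _ (@borel_lebesgue n)
  (let: And3 h _ _ := borel_lebesgue_is_measure n in h)
  (let: And3 _ h _ := borel_lebesgue_is_measure n in h)
  (let: And3 _ _ h := borel_lebesgue_is_measure n in h).

(* [leb n] is Lebesgue measure on R^n with all Lebesgue measurable sets: the
   measurable type [Rn n] is 'rV[R]_n with the completed sigma-algebra. *)
Definition Rn n : measurableType _ := caratheodory_type ((@borel_lebesgue n)^*)%mu.

Definition leb n : set (Rn n) -> \bar R :=
  @completed_measure_extension _ 'rV[R]_n R (@borel_lebesgue n).

HB.instance Definition _ n := Measure.on (@leb n).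

End lebesgue.
Arguments leb {R} n.
Arguments Rn R n : clear implicits.

Section sobolev.
Context {R : realType} {n : nat}.
Implicit Types (Omega : set 'rV[R]_n) (u v phi : 'rV[R]_n -> R).
Implicit Types (s : seq 'I_n).

Definition partial (i : 'I_n) u : 'rV[R]_n -> R :=
  fun x => 'D_(delta_mx ord0 i) u x.

(* [:: i1; ...; ik] stands for the operator d_i1 ... d_ik. *)
Definition partials s u := foldr partial u s.

Definition smooth u := forall s,
  continuous (partials s u) /\
  forall i x, derivable (partials s u) x (delta_mx ord0 i).

Definition support u : set 'rV[R]_n := closure [set x | u x != 0].

Definition test_function Omega phi :=
  [/\ smooth phi, compact (support phi) & support phi `<=` Omega].

Definition loc_integrable Omega u := forall K : set 'rV[R]_n,
  compact K -> K `<=` Omega -> (leb n).-integrable K (EFin \o u).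

Definition weak_derivative Omega s u v :=
  [/\ loc_integrable Omega u, loc_integrable Omega v &
    forall phi, test_function Omega phi ->
      \int[leb n]_(x in Omega) (u x * partials s phi x) =
      (-1) ^+ size s * \int[leb n]_(x in Omega) (v x * phi x)].

Definition Lq Omega (q : R) u :=
  measurable_fun (Omega : set (Rn R n)) (u : Rn R n -> R) /\
  (\int[leb n]_(x in Omega) (`|u x| `^ q)%:E < +oo)%E.

Definition sobolev Omega (k : nat) (q : R) u :=
  Lq Omega q u /\
  forall s, (size s <= k)%N -> exists2 v, Lq Omega q v & weak_derivative Omega s u v.

Definition sobolev_map Omega k q (m : nat) (f : 'rV[R]_n -> 'rV[R]_m) :=
  forall i, sobolev Omega k q (fun x => f x ord0 i).

(* Df x i j is the weak derivative of the i-th component in direction j. *)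
Definition weak_jacobian Omega m (f : 'rV[R]_n -> 'rV[R]_m)
    (Df : 'rV[R]_n -> 'M[R]_(m, n)) :=
  forall i j, weak_derivative Omega [:: j] (fun x => f x ord0 i)
    (fun x => Df x i j).

Definition precise u (x : 'rV[R]_n) : \bar R :=
  limf_esup (fun r : R => ((fine (leb n (eball x r)))^-1)%:E *
                          \int[leb n]_(y in eball x r) (u y)%:E)%E 0^'+.

Definition precise_finite (M : 'rV[R]_n -> 'M[R]_n) (x : 'rV[R]_n) :=
  forall i j, precise (fun y => M y i j) x \is a fin_num.

(* Meaningful at the points where [precise_finite M] holds. *)
Definition precise_det (M : 'rV[R]_n -> 'M[R]_n) (x : 'rV[R]_n) : R :=
  \det (\matrix_(i, j) fine (precise (fun y => M y i j) x)).

End sobolev.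

(* The library has 0 `^ (- a) = 0 for a != 0, hence the case distinction. *)
Definition neg_power {R : realType} (t a : R) : \bar R :=
  if t == 0 then +oo%E else (`|t| `^ (- a))%:E.

(* m-dimensional Hausdorff measure on R^n for Euclidean diameters, normalised
   by the Lebesgue measure of a ball of diameter 1 in R^m. *)
Section hausdorff.
Context {R : realType} {n : nat}.
Local Open Scope ereal_scope.

(* diam(set0)^m is 0 also when m = 0. *)
Definition diam_pow (m : nat) (F : set 'rV[R]_n) : \bar R :=
  if F == set0 then 0 else ediam F ^+ m.

Definition hausdorff_content (m : nat) (delta : R) (A : set 'rV[R]_n) : \bar R :=
  ereal_inf [set \sum_(0 <= k <oo) diam_pow m (F k) |
    F in [set F : (set 'rV[R]_n)^nat |
      A `<=` \bigcup_k F k /\ forall k, ediam (F k) <= delta%:E]].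

Definition hausdorff (m : nat) (A : set 'rV[R]_n) : \bar R :=
  leb m (eball (0 : 'rV[R]_m) (2^-1)%R) *
  ereal_sup [set hausdorff_content m delta A | delta in [set d : R | (0 < d)%R]].

End hausdorff.

(* Main.v *)
(* Fix a direction nu.  For almost every line parallel to nu the integral of
   |D^2 f|^q over the tube of radius r around the line is O(r^(n-1)) uniformly
   in r (differentiate the measure obtained by integrating along lines).  On
   such a line the averages of Df over balls of radius r have increments at most
   C |t - s|^(1 - 1/q) with C independent of r, so the precise representative of
   Df is (1 - 1/q)-Hoelder along the line.  Near a zero of J_f on the line,
   |J_f|^(-a) is then at least c / |t - s|, which is not integrable, whereas
   |J_f|^(-a) is integrable along almost every line: the lines that meet
   {J_f = 0} form a null set.

   By the intermediate value theorem J_f keeps its sign on the part in a small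
   ball of almost every line, for every direction h; hence
   {J_f > 0} and {J_f < 0} - h meet in a null set for every h, and by Fubini one
   of the two sets is null in the ball.  Connectedness of Omega finishes the
   proof. *)
Require Import Defs.
From HB Require Import structures.
From mathcomp Require Import all_boot all_order all_algebra.
From mathcomp Require Import all_classical all_reals all_analysis.
From mathcomp Require Import measurable_realfun ring lra.
Set Implicit Arguments.
Unset Strict Implicit.
Unset Printing Implicit Defensive.
Import Order.TTheory GRing.Theory Num.Theory.
Import numFieldNormedType.Exports.
Local Open Scope classical_set_scope.
Local Open Scope ring_scope.


(** Lines parallel to a direction are written as a base point in R^(n-1) plus t nu, with nu rescaled
    so that one coordinate equals 1: the change of variables is then a shear that preserves volume,
    and Fubini applies to every direction. For the tubes an upper bound C r^(n-1) suffices; it comes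
    from a weak-type estimate over dyadic cubes. The increments of the ball averages are read off
    from the weak derivative: a smooth bump slides along the line, the t-derivative of its pairing
    with Df is its pairing with a directional second derivative, and the bump then increases to the
    indicator of the ball. The bound holds for each small r, so it passes to the limsup, and
    finiteness of the representative at one point of a good line propagates along that line inside a
    ball. Fubini is applied to Borel functions, whereas the data are measurable for the completed
    sigma-algebra; hence the Borel majorants. The sign argument slices sets where J_f has a given
    sign, so J_f must be Borel on balls although the limsup runs over uncountably many radii. *)

(** * Half-open boxes and the uniqueness of Lebesgue measure *)

Section boxes.
Context {R : realType}.
Notation lam := (@lebesgue_measure R).

(** Half-open on the same side as the generators [ocitv] of the Borel sets of the line. Such boxes
    are stable under intersection, and the dyadic cubes are among them. *)
Definition obox n (a b : 'rV[R]_n) : set 'rV[R]_n :=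
  [set x | forall j, a 0 j < x 0 j <= b 0 j].

Lemma measurable_coord n j : measurable_fun [set: 'rV[R]_n]
  (fun x => x 0 j : measurableTypeR R).
Proof. exact: measurable_coord_rV. Qed.

Lemma measurable_into_rV d (T : measurableType d) n (f : T -> 'rV[R]_n) :
  (forall i, measurable_fun [set: T] (fun s => f s 0 i : measurableTypeR R)) ->
  measurable_fun [set: T] f.
Proof. by move=> mf; apply: measurable_fun_rV => i; exact: mf. Qed.

Lemma oboxE n (a b : 'rV[R]_n) :
  obox a b = \bigcap_(j in [set: 'I_n])
    ((fun x : 'rV[R]_n => x 0 j) @^-1` `]a 0 j, b 0 j]).
Proof.
apply/seteqP; split => x /= h.
  by move=> j _ /=; rewrite in_itv/= h.
by move=> j; have := h j I; rewrite /= in_itv.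
Qed.

Lemma measurable_obox n (a b : 'rV[R]_n) : measurable (obox a b).
Proof.
rewrite oboxE; apply: fin_bigcap_measurable; first exact: finite_finset.
move=> j _; rewrite -[X in measurable X]setTI.
exact: (measurable_coord j).
Qed.

Lemma oboxI n (a b c d : 'rV[R]_n) : obox a b `&` obox c d =
  obox (\row_j Num.max (a 0 j) (c 0 j)) (\row_j Num.min (b 0 j) (d 0 j)).
Proof.
apply/seteqP; split => x /=.
  move=> [h1 h2] j; rewrite !mxE gt_max le_min.
  by move: (h1 j) (h2 j) => /andP[-> ->] /andP[-> ->].
by move=> h; split => j; move: (h j); rewrite !mxE gt_max le_min => /andP[/andP[? ?] /andP[? ?]];
  apply/andP.
Qed.

Definition bbox n (k : nat) : set 'rV[R]_n :=
  obox (const_mx (- k%:R)) (const_mx k%:R).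
Arguments bbox : clear implicits.

Lemma bigcup_bbox n : \bigcup_k bbox n k = setT.
Proof.
rewrite -subTset => x _.
have [M hM] : exists M : nat, forall j, `|x 0 j| < M%:R.
  exists (Num.trunc (\sum_j `|x 0 j|)).+1 => j.
  apply: le_lt_trans (truncnS_gt _).
  by rewrite (bigD1 j)//= lerDl sumr_ge0.
exists M => // j; rewrite !mxE.
by have := hM j; rewrite ltr_norml => /andP[-> /ltW ->].
Qed.

Lemma measurable_rV_obox n :
  @measurable _ 'rV[R]_n = <<s [set obox ab.1 ab.2 | ab in [set: 'rV[R]_n * 'rV[R]_n]] >>.
Proof.
apply/seteqP; split; last first.
  apply: smallest_sub.
    split; first exact: measurable0.
      by move=> A mA; rewrite setTD; exact: measurableC.
    by move=> F mF; exact: bigcupT_measurable.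
  by move=> _ [[a b] _ <-]; exact: measurable_obox.
set G := (X in <<s X>>).
apply: smallest_sub; first exact: smallest_sigma_algebra.
rewrite -bigcup_seq; apply: bigcup_sub => j _.
move=> _ [B mB <-]; rewrite setTI.
pose f : g_sigma_algebraType G -> measurableTypeR R := fun x : 'rV[R]_n => x 0 j.
suff mf : measurable_fun setT f.
  by have := mf measurableT _ mB; rewrite setTI.
apply: (@measurability _ _ _ _ _ _ (@ocitv R)) => //.
move=> _ [_ [[a b] _ <-] <-]; rewrite setTI.
(* The slab over ]a, b] in coordinate j is the union over k of boxes whose other sides are ]-k,
   k]. *)
rewrite (_ : _ @^-1` _ = \bigcup_k
   (obox (\row_i (if i == j then a else - k%:R)) (\row_i (if i == j then b else k%:R)))).
  apply: bigcup_measurable => k _; apply: sub_sigma_algebra.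
  by eexists (_, _).
apply/seteqP; split => x /=.
  rewrite in_itv/= => abx.
  have : (\bigcup_k bbox n k) x by rewrite bigcup_bbox.
  move=> [k _ hk]; exists k => // i; rewrite !mxE.
  by case: eqP => [->//|_]; have := hk i; rewrite !mxE.
move=> [k _ /(_ j)]; rewrite !mxE eqxx.
by rewrite in_itv.
Qed.

Lemma lebesgue_measure_oc (a b : R) :
  lam `]a, b]%classic = (Num.max 0 (b - a))%:E.
Proof.
rewrite lebesgue_measure_itv/= lte_fin -EFinB.
case: ltP => h; congr EFin.
  by apply/esym/max_idPr; rewrite subr_ge0 ltW.
by apply/esym/max_idPl; rewrite subr_le0.
Qed.

Lemma borel_lebesgue_obox n (a b : 'rV[R]_n) :
  borel_lebesgue (obox a b) = (\prod_j Num.max 0 (b 0 j - a 0 j))%:E.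
Proof.
elim: n a b => [|n ih] a b.
  rewrite /= big_ord0 diracE mem_set//.
  by move=> [].
have -> : borel_lebesgue (obox a b) =
   (@borel_lebesgue R n \x lam)%E (@cons_rV R n @^-1` obox a b) by [].
have -> : @cons_rV R n @^-1` obox a b =
   obox (\row_j a 0 (lift ord0 j)) (\row_j b 0 (lift ord0 j)) `*`
   `]a 0 ord0, b 0 ord0]%classic.
  apply/seteqP; split => -[p t] /=.
    move=> h; split.
      by move=> j; have := h (lift ord0 j); rewrite !mxE liftK.
    by have := h ord0; rewrite !mxE unlift_none /= in_itv.
  move=> [h1 h2] j; rewrite mxE; case: (unliftP ord0 j) => [k ->|->].
    by have := h1 k; rewrite !mxE.
  by move: h2; rewrite in_itv.
rewrite product_measure1E//; last exact: measurable_obox.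
rewrite [X in (X * _)%E]ih big_ord_recl mulrC EFinM; congr (_ * _)%E.
  by congr EFin; apply: eq_bigr => j _; rewrite !mxE.
exact: lebesgue_measure_oc.
Qed.

Lemma borel_lebesgue_bbox_lty n k : (@borel_lebesgue R n (bbox n k) < +oo)%E.
Proof. by rewrite borel_lebesgue_obox ltry. Qed.

Lemma borel_lebesgue_sigma_finite n : sigma_finite setT (@borel_lebesgue R n).
Proof.
exists (bbox n); first by rewrite bigcup_bbox.
by move=> k; split; [exact: measurable_obox|exact: borel_lebesgue_bbox_lty].
Qed.

HB.instance Definition _ n := @Measure_isSigmaFinite.Build _ _ _ (@borel_lebesgue R n)
  (borel_lebesgue_sigma_finite n).

(** Boxes form a generating pi-system that contains an exhaustion by sets of finite measure.
    Translations and shears are checked to preserve volume through this lemma, on boxes alone. *)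
Lemma borel_lebesgue_unique n (mu : {measure set 'rV[R]_n -> \bar R}) :
  (forall a b, mu (obox a b) = (\prod_j Num.max 0 (b 0 j - a 0 j))%:E) ->
  forall A, measurable A -> mu A = borel_lebesgue A.
Proof.
move=> h A mA.
apply: (@measure_unique _ _ _ _ (bbox n) (@measurable_rV_obox n)) => //.
- move=> _ _ [[a b] _ <-] [[c d] _ <-] /=; rewrite oboxI.
  by eexists (_, _).
- by move=> k; eexists (_, _).
- exact: bigcup_bbox.
- by move=> _ [[a b] _ <-] /=; rewrite h; apply/esym/borel_lebesgue_obox.
- by move=> k; rewrite h ltry.
Qed.

Lemma borel_lebesgue_translate n (h : 'rV[R]_n) (A : set 'rV[R]_n) : measurable A ->
  borel_lebesgue ((fun x => x + h) @^-1` A) = borel_lebesgue A.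
Proof.
have mh : measurable_fun setT (fun x : 'rV[R]_n => x + h).
  apply: measurable_into_rV => i; under eq_fun do rewrite mxE.
  by apply: measurable_funD => //; exact: measurable_coord.
move=> mA.
pose mu : {measure set 'rV[R]_n -> \bar R} :=
  measure_function_pushforward__canonical__measure_function_Measure (@borel_lebesgue R n) mh.
apply: (@borel_lebesgue_unique n mu) mA => a b.
rewrite /mu /= /pushforward.
rewrite (_ : _ @^-1` _ = obox (a - h) (b - h)).
  rewrite [LHS]borel_lebesgue_obox; congr EFin; apply: eq_bigr => j _.
  by rewrite !mxE opprD opprK addrACA addNr addr0.
apply/seteqP; split => x /= H j; have := H j; rewrite /= !mxE.
  by rewrite ltrBlDr lerBrDr.
by rewrite ltrBlDr lerBrDr.
Qed.

End boxes.
Arguments bbox {R} n k.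

(** * Lebesgue measure in coordinates adapted to a direction *)

(** The product measure integrates over the first factor the measures of the slices. Tonelli
    exchanges the roles, because for [line_map] the simple slices are those at a fixed second
    coordinate t. *)
Lemma product_measure_slices d1 d2 (T1 : measurableType d1) (T2 : measurableType d2)
    (R : realType) (m1 : {sigma_finite_measure set T1 -> \bar R})
    (m2 : {sigma_finite_measure set T2 -> \bar R}) (S : set (T1 * T2)) :
  measurable S ->
  ((m1 \x m2) S = \int[m2]_t m1 [set z | S (z, t)])%E.
Proof.
move=> mS; rewrite -[in LHS](setIT S) -[LHS](integral_indic (m1 \x m2)%E measurableT mS).
have mf : measurable_fun setT (EFin \o (\1_S : T1 * T2 -> R)).
  by apply/measurable_EFinP; exact: measurable_indic.
rewrite (fubini_tonelli2 _ mf); last by move=> x; rewrite lee_fin.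
apply: eq_integral => t _; rewrite /fubini_G /=.
have mSt : measurable [set z | S (z, t)].
  rewrite -[X in measurable X]/((pair^~ t) @^-1` S) -[X in measurable X]setTI.
  by apply: pair2_measurable.
by rewrite -[X in _ = m1 X]setIT -integral_indic.
Qed.

Section lines.
Context {R : realType}.
Notation lam := (@lebesgue_measure R).

(* [line_map i nu (z, t)] is z with a zero inserted at position i, plus t nu.
   With [nu 0 i = 1] it has Jacobian 1, whatever the other entries of nu. *)
Definition line_map m (i : 'I_m.+1) (nu : 'rV[R]_m.+1)
    (p : 'rV[R]_m * measurableTypeR R) : 'rV[R]_m.+1 :=
  \row_j (if unlift i j is Some k then p.1 0 k else 0) + (p.2 : R) *: nu.

(** When [nu 0 i = 1], this is the projection along nu onto the hyperplane x_i = 0, read in the m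
    remaining coordinates; it labels the line through y. *)
Definition line_base m (i : 'I_m.+1) (nu : 'rV[R]_m.+1) (y : 'rV[R]_m.+1) : 'rV[R]_m :=
  \row_k (y 0 (lift i k) - y 0 i * nu 0 (lift i k)).

Section fixed.
Variables (m : nat) (i : 'I_m.+1) (nu : 'rV[R]_m.+1).
Hypothesis nui : nu 0 i = 1.

Lemma line_map_i p : line_map i nu p 0 i = p.2.
Proof. by rewrite !mxE unlift_none nui add0r mulr1. Qed.

Lemma line_map_lift p k : line_map i nu p 0 (lift i k) = p.1 0 k + p.2 * nu 0 (lift i k).
Proof. by rewrite !mxE liftK. Qed.

Lemma line_mapK y : line_map i nu (line_base i nu y, y 0 i) = y.
Proof.
apply/rowP => j; case: (unliftP i j) => [k ->|->].
  by rewrite line_map_lift !mxE subrK.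
by rewrite line_map_i.
Qed.

Lemma line_baseK p : line_base i nu (line_map i nu p) = p.1.
Proof. by apply/rowP => k; rewrite mxE line_map_i line_map_lift addrK. Qed.

Lemma measurable_line_map : measurable_fun setT (line_map i nu).
Proof.
apply: measurable_into_rV => j; case: (unliftP i j) => [k ->|->].
  under eq_fun do rewrite line_map_lift.
  apply: measurable_funD.
    exact: (measurableT_comp (measurable_coord _) measurable_fst).
  by apply: measurable_funM => //; exact: measurable_snd.
by under eq_fun do rewrite line_map_i; exact: measurable_snd.
Qed.

Lemma measurable_line_base : measurable_fun setT (line_base i nu).
Proof.
apply: measurable_into_rV => j.
under eq_fun do rewrite mxE.
apply: measurable_funB; first exact: measurable_coord.
by apply: measurable_funM => //; exact: measurable_coord.
Qed.

Lemma line_map_preimage_obox a b (t : R) :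
  (fun z => line_map i nu (z, t)) @^-1` obox a b =
  if a 0 i < t <= b 0 i then
    obox (\row_k (a 0 (lift i k) - t * nu 0 (lift i k)))
         (\row_k (b 0 (lift i k) - t * nu 0 (lift i k)))
  else set0.
Proof.
case: ifPn => [h|/negP h]; apply/seteqP; split => z //=.
- by move=> H k; have := H (lift i k); rewrite !mxE liftK ltrBlDr lerBrDr.
- move=> H j; case: (unliftP i j) => [k ->|->].
    by have := H k; rewrite !mxE liftK ltrBlDr lerBrDr.
  by rewrite line_map_i.
- by move=> /(_ i); rewrite line_map_i.
Qed.

(** The slices of a box at fixed t are translates of one m-dimensional box as long as t lies in the
    i-th side, and empty otherwise, so the volume is a product of side lengths. *)
Lemma line_map_measure A : measurable A ->
  (@borel_lebesgue R m \x lam)%E (line_map i nu @^-1` A) = borel_lebesgue A.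
Proof.
have mh := measurable_line_map.
pose mu : {measure set 'rV[R]_m.+1 -> \bar R} :=
  measure_function_pushforward__canonical__measure_function_Measure
    (@borel_lebesgue R m \x lam)%E mh.
move=> mA; apply: (@borel_lebesgue_unique R _ mu _ A mA) => a b.
rewrite /mu /= /pushforward.
have mB : measurable (line_map i nu @^-1` obox a b).
  by rewrite -[X in measurable X]setTI; apply: measurable_line_map => //; exact: measurable_obox.
rewrite [LHS](product_measure_slices (@borel_lebesgue R m) lam mB).
have E t : borel_lebesgue ((fun z => line_map i nu (z, t)) @^-1` obox a b) =
    (\prod_k (Num.max 0 (b 0 (lift i k) - a 0 (lift i k)))
     * \1_(`]a 0 i, b 0 i]%classic) t)%:E.
  rewrite line_map_preimage_obox indicE mem_setE in_itv/=.
  case: ifP => _; last by rewrite measure0 mulr0.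
  rewrite [LHS]borel_lebesgue_obox mulr1; congr EFin; apply: eq_bigr => k _.
  by rewrite !mxE opprB addrA subrK.
rewrite (eq_integral _ _ (fun t _ => E t)).
under eq_integral do rewrite EFinM.
rewrite ge0_integralZl_EFin//; last 2 first.
- by apply/measurable_EFinP; exact: measurable_indic.
- by apply: prodr_ge0 => k _; rewrite le_max lexx.
rewrite integral_indic ?setIT//.
rewrite [X in (_ * X)%E = _]lebesgue_measure_oc -EFinM; congr EFin.
rewrite [RHS](bigD1_ord i)//= mulrC; congr (_ * _).
Qed.

End fixed.
End lines.

(** * Dyadic cubes and the topology that they generate *)

Section dyadic.
Context {R : realType}.
Variable n : nat.
Implicit Types (x y : 'rV[R]_n) (k : nat) (S : set (nat * 'rV[int]_n)).

(** [Num.ceil] makes the cubes left-open and right-closed, like the boxes [obox]. *)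
Definition cell k x : 'rV[int]_n := \row_j Num.ceil (x 0 j * 2 ^+ k).

Definition dcube (kv : nat * 'rV[int]_n) : set 'rV[R]_n := [set x | cell kv.1 x = kv.2].

Lemma dcubeP k v x : dcube (k, v) x <->
  forall j, (v 0 j - 1)%:~R / 2 ^+ k < x 0 j <= (v 0 j)%:~R / 2 ^+ k.
Proof.
have k0 : 0 < 2 ^+ k :> R by rewrite exprn_gt0.
rewrite /dcube /cell /=; split => [<- j|h].
  by rewrite mxE ltr_pdivrMr// ler_pdivlMr// ceilB1_lt// ceil_ge.
apply/rowP => j; rewrite mxE; apply/ceil_def.
by have := h j; rewrite ltr_pdivrMr// ler_pdivlMr.
Qed.

Lemma dcube_obox k v : dcube (k, v) =
  obox (\row_j ((v 0 j - 1)%:~R / 2 ^+ k)) (\row_j ((v 0 j)%:~R / 2 ^+ k)).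
Proof.
apply/seteqP; split => x.
  by move=> /dcubeP h j; rewrite !mxE.
by move=> h; apply/dcubeP => j; have := h j; rewrite !mxE.
Qed.

Lemma measurable_dcube kv : measurable (dcube kv).
Proof. by case: kv => k v; rewrite dcube_obox; exact: measurable_obox. Qed.

Lemma borel_lebesgue_dcube kv : borel_lebesgue (dcube kv) = ((2 ^- kv.1) ^+ n)%:E.
Proof.
case: kv => k v; rewrite dcube_obox [LHS]borel_lebesgue_obox; congr EFin.
under eq_bigr => j _.
  rewrite !mxE -mulrBl -rmorphB/= opprB addrC subrK mul1r.
  rewrite (_ : Num.max _ _ = 2 ^- k); last first.
    by apply/max_idPr; rewrite invr_ge0 exprn_ge0.
  over.
by rewrite prodr_const card_ord.
Qed.

Lemma cell_coarsen k k' x y : (k <= k')%N -> cell k' x = cell k' y -> cell k x = cell k y.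
Proof.
move=> kk' /rowP e; apply/rowP => j; move: (e j); rewrite !mxE => {}e.
(* Integer upper bounds of t 2^k correspond to those upper bounds of t 2^k' that are multiples of
   2^(k'-k); the finer cell therefore determines the coarser one. *)
have c (t : R) (z : int) : (Num.ceil (t * 2 ^+ k) <= z) =
    (Num.ceil (t * 2 ^+ k') <= z * 2 ^+ (k' - k)).
  rewrite !ceil_le_int rmorphM/= rmorphXn/= -{1}(subnKC kk') exprD mulrA.
  by rewrite ler_pM2r// exprn_gt0.
apply/eqP; rewrite eq_le c e -c lexx/=.
by rewrite c -e -c.
Qed.

Lemma sub_dcube k k' x : (k <= k')%N -> dcube (k', cell k' x) `<=` dcube (k, cell k x).
Proof. by move=> kk' y /= e; exact: cell_coarsen kk' e. Qed.

Lemma dcube_center k x : dcube (k, cell k x) x.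
Proof. by []. Qed.

Lemma dcube_dist k x y : cell k x = cell k y -> forall j, `|x 0 j - y 0 j| < 2 ^- k.
Proof.
move=> e j.
have /dcubeP/(_ j) /= := dcube_center k x.
have /dcubeP/(_ j) /= := dcube_center k y.
rewrite e intrB mulrBl div1r => /andP[h1 h2] /andP[h3 h4].
by rewrite ltr_norml; apply/andP; split; lra.
Qed.

(** Maximality is measured by the generation and not by equality of sets: in dimension 0 all cubes
    are the same set, and the generation still selects one index. *)
Definition maximal_dcubes S : set (nat * 'rV[int]_n) :=
  [set kv | S kv /\ forall kv', S kv' -> dcube kv `<=` dcube kv' -> (kv.1 <= kv'.1)%N].

(** Generations are natural numbers, so the side is at most 1 and every increasing chain of cubes
    stops. *)
Lemma exists_maximal_dcube S kv : S kv ->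
  exists kv', [/\ maximal_dcubes S kv', dcube kv `<=` dcube kv' & (kv'.1 <= kv.1)%N].
Proof.
have [m] := ubnP kv.1; elim: m kv => // m ih kv kvm Skv.
have [mx|nmx] := pselect (maximal_dcubes S kv); first by exists kv; split.
have [kv' [Skv' sub lt]] : exists kv', [/\ S kv', dcube kv `<=` dcube kv' & (kv'.1 < kv.1)%N].
  apply: contrapT => no; apply: nmx; split=> // kv' Skv' sub.
  by rewrite leqNgt; apply/negP => lt; apply: no; exists kv'.
have lt' : (kv'.1 < m)%N by exact: leq_trans lt kvm.
have [kv2 [mx2 sub2 le2]] := ih kv' lt' Skv'.
exists kv2; split => //; first exact: subset_trans sub2.
by apply: leq_trans le2 _; exact: ltnW.
Qed.

Lemma maximal_dcubes_disjoint S kv kv' x :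
  maximal_dcubes S kv -> maximal_dcubes S kv' -> dcube kv x -> dcube kv' x -> kv = kv'.
Proof.
wlog kk' : kv kv' / (kv.1 <= kv'.1)%N.
  move=> W h1 h2 x1 x2; case/orP : (leq_total kv.1 kv'.1) => h; first exact: W.
  by apply/esym; exact: W.
move=> [S1 mx1] [S2 mx2] x1 x2.
have sub : dcube kv' `<=` dcube kv.
  move: x1 x2 kk' {mx1 mx2 S1 S2}.
  case: kv => k v; case: kv' => k' v'; rewrite {1 2}/dcube/= => <- <- kk'; exact: sub_dcube.
have := mx2 _ S1 sub => k'k.
have kE : kv.1 = kv'.1 by apply/eqP; rewrite eqn_leq kk' k'k.
move: x1 x2 kE; case: kv {mx1 S1 sub k'k kk'} => k v; case: kv' {mx2 S2} => k' v'.
by rewrite /dcube/= => <- <- <-.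
Qed.

(** Padding with [set0] at the indices outside S turns a countable family of cubes into a sequence,
    the form in which sigma-additivity is stated. *)
Definition dcube_seq S (j : nat) : set 'rV[R]_n :=
  if pickle_inv j is Some kv then (if `[< S kv >] then dcube kv else set0) else set0.

Lemma bigcup_dcube_seq S : \bigcup_j dcube_seq S j = \bigcup_(kv in S) dcube kv.
Proof.
apply/seteqP; split => x.
  move=> [j _]; rewrite /dcube_seq; case: pickle_inv => // kv.
  by case: asboolP => // Skv kvx; exists kv.
by move=> [kv Skv kvx]; exists (pickle kv) => //; rewrite /dcube_seq pickleK_inv asboolT.
Qed.

Lemma measurable_dcube_seq S j : measurable (dcube_seq S j).
Proof.
rewrite /dcube_seq; case: pickle_inv => [kv|]; last exact: measurable0.
by case: ifP => _; [exact: measurable_dcube|exact: measurable0].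
Qed.

Lemma measurable_bigcup_dcube S : measurable (\bigcup_(kv in S) dcube kv).
Proof.
by rewrite -bigcup_dcube_seq; apply: bigcup_measurable => j _; exact: measurable_dcube_seq.
Qed.

Lemma trivIset_maximal_dcubes S : trivIset setT (dcube_seq (maximal_dcubes S)).
Proof.
apply/trivIsetP => i j _ _; apply: contraNeq => /set0P[x []].
rewrite /dcube_seq.
have := @pickle_invK (nat * 'rV[int]_n)%type i.
have := @pickle_invK (nat * 'rV[int]_n)%type j.
case: (pickle_inv i) => [kv|//]; case: (pickle_inv j) => [kv'|//] /= <- <-.
case: asboolP => // m1 x1; case: asboolP => // m2 x2.
by rewrite (maximal_dcubes_disjoint m1 m2 x1 x2).
Qed.

Lemma bigcup_maximal_dcubes S :
  \bigcup_(kv in maximal_dcubes S) dcube kv = \bigcup_(kv in S) dcube kv.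
Proof.
apply/seteqP; split => x; first by move=> [kv [? _] ?]; exists kv.
move=> [kv Skv kvx]; have [kv' [m sub _]] := exists_maximal_dcube Skv.
by exists kv' => //; exact: sub.
Qed.

(** Openness for the topology with the dyadic cubes as a base, finer than the Euclidean one. Such a
    set is a disjoint union of cubes of side as small as desired, which is what the Hausdorff
    estimate asks of a neighbourhood. *)
Definition dyadic_open (U : set 'rV[R]_n) :=
  forall x, U x -> exists k, dcube (k, cell k x) `<=` U.

Lemma dyadic_openE U k0 : dyadic_open U ->
  U = \bigcup_(kv in [set kv | (k0 <= kv.1)%N /\ dcube kv `<=` U]) dcube kv.
Proof.
move=> oU; apply/seteqP; split => x; last by move=> [kv [_ sub] /sub].
move=> /oU[k sub]; exists (maxn k0 k, cell (maxn k0 k) x) => //=; split.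
  exact: leq_maxl.
by apply: subset_trans sub; apply: sub_dcube; exact: leq_maxr.
Qed.

Lemma dyadic_open_measurable U : dyadic_open U -> measurable U.
Proof. by move=> /(dyadic_openE 0) ->; exact: measurable_bigcup_dcube. Qed.

Lemma dyadic_openI U V : dyadic_open U -> dyadic_open V -> dyadic_open (U `&` V).
Proof.
move=> oU oV x [/oU[k sk] /oV[l sl]]; exists (maxn k l) => y h; split.
  by apply/sk/sub_dcube/h; exact: leq_maxl.
by apply/sl/sub_dcube/h; exact: leq_maxr.
Qed.

Lemma dyadic_open_bigcup I (F : I -> set 'rV[R]_n) :
  (forall i, dyadic_open (F i)) -> dyadic_open (\bigcup_i F i).
Proof.
move=> oF x [i _ /oF[k sk]]; exists k.
by apply: subset_trans sk _; exact: bigcup_sup.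
Qed.

Lemma exists_exprVn_lt (e : R) : 0 < e -> exists k, 2 ^- k < e.
Proof.
move=> e0; exists (Num.trunc e^-1).+1.
rewrite invf_plt ?posrE ?exprn_gt0//.
apply: lt_le_trans (truncnS_gt _) _.
by rewrite -natrX ler_nat ltnW// ltn_expl.
Qed.

Lemma open_dyadic_open U : open U -> dyadic_open U.
Proof.
move=> oU x Ux; have /nbhs_ballP[e /= e0 sub] := oU _ Ux.
have [k hk] := exists_exprVn_lt e0; exists k => y /= yx.
apply: sub; rewrite -ball_normE/=.
apply: (@le_lt_trans _ _ (2 ^- k)) => //.
rewrite [X in X <= _]mx_normrE; apply/bigmax_leP; split.
  by rewrite invr_ge0 exprn_ge0.
move=> [i j] _ /=; rewrite !mxE (ord1 i) ltW//.
exact: dcube_dist (esym yx) j.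
Qed.

Lemma open_measurable_rV (U : set 'rV[R]_n) : open U -> measurable U.
Proof. by move=> /open_dyadic_open/dyadic_open_measurable. Qed.

End dyadic.

(** * Outer regularity of finite Borel measures *)

Section regularity.
Context {R : realType}.
Variables (n : nat) (mu : {measure set 'rV[R]_n -> \bar R}).
Hypothesis mufin : (mu setT < +oo)%E.
Implicit Types A U : set 'rV[R]_n.

Definition outer_approximable A := forall e : R, 0 < e ->
  exists U, [/\ dyadic_open U, A `<=` U & (mu (U `\` A) < e%:E)%E].

Lemma dyadic_open_outer_approximable U : dyadic_open U -> outer_approximable U.
Proof. by move=> oU e e0; exists U; split => //; rewrite setDv measure0 lte_fin. Qed.

Lemma outer_approximable_choice (B : nat -> set 'rV[R]_n) (e : R) : 0 < e ->
  (forall i, outer_approximable (B i)) ->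
  exists U : nat -> set 'rV[R]_n, forall i, [/\ dyadic_open (U i), B i `<=` U i &
    (mu (U i `\` B i) < (e / (2 ^ i.+1)%:R)%:E)%E].
Proof.
move=> e0 oB; have h i : exists U, [/\ dyadic_open U, B i `<=` U &
    (mu (U `\` B i) < (e / (2 ^ i.+1)%:R)%:E)%E].
  by apply: oB; rewrite divr_gt0// ltr0n expn_gt0.
by have [U hU] := choice h; exists U.
Qed.

Lemma measure_bigcup_le (e : R) (F : nat -> set 'rV[R]_n) : 0 <= e ->
  (forall i, measurable (F i)) -> (forall i, (mu (F i) < (e / (2 ^ i.+1)%:R)%:E)%E) ->
  (mu (\bigcup_i F i) <= e%:E)%E.
Proof.
move=> e0 mF h; apply: le_trans (epsilon_trick0 xpredT e0).
apply: le_trans (measure_sigma_subadditive _ mF _ (@subset_refl _ _)) _.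
  exact: bigcup_measurable.
by apply: lee_nneseries => // i _; exact/ltW/h.
Qed.

Lemma outer_approximable_bigcup (B : nat -> set 'rV[R]_n) :
  (forall i, measurable (B i)) -> (forall i, outer_approximable (B i)) ->
  outer_approximable (\bigcup_i B i).
Proof.
move=> mB oB e e0; have e20 : 0 < e / 2 by rewrite divr_gt0.
have [U hU] := outer_approximable_choice e20 oB.
have mD i : measurable (U i `\` B i).
  by apply: measurableD => //; apply: dyadic_open_measurable; have [] := hU i.
exists (\bigcup_i U i); split.
- by apply: dyadic_open_bigcup => i; have [] := hU i.
- by apply: subset_bigcup => i _; have [] := hU i.
- apply: (@le_lt_trans _ _ (e / 2)%:E); last by rewrite lte_fin ltr_pdivrMr// ltr_pMr// ltr1n.
  apply: le_trans (measure_bigcup_le (ltW e20) mD (fun i => let: And3 _ _ h := hU i in h)).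
  apply: le_measure; rewrite ?inE.
  + apply: measurableD; last exact: bigcup_measurable.
    by apply: dyadic_open_measurable; apply: dyadic_open_bigcup => i; have [] := hU i.
  + exact: bigcup_measurable.
  + by move=> x [[i _ Ux] nB]; exists i => //; split => // Bx; apply: nB; exists i.
Qed.

(** A countable intersection of dyadic-open sets need not be dyadic-open, so a finite intersection
    [V N] is taken instead. Its excess over the full intersection tends to 0 by continuity from
    above, where finiteness of [mu] enters. *)
Lemma outer_approximable_bigcap (B : nat -> set 'rV[R]_n) :
  (forall i, measurable (B i)) -> (forall i, outer_approximable (B i)) ->
  outer_approximable (\bigcap_i B i).
Proof.
move=> mB oB e e0; have e20 : 0 < e / 2 by rewrite divr_gt0.
have [U hU] := outer_approximable_choice e20 oB.
have mU i : measurable (U i) by apply: dyadic_open_measurable; have [] := hU i.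
have mD i : measurable (U i `\` B i) by exact: measurableD.
pose V := fix V N := if N is M.+1 then V M `&` U M.+1 else U 0%N.
have dV N : dyadic_open (V N).
  elim: N => [|N ih] /=; first by have [] := hU 0%N.
  by apply: dyadic_openI => //; have [] := hU N.+1.
have mV N : measurable (V N) by exact: dyadic_open_measurable.
have subV N : V N `<=` U N by case: N => //= N x [].
have subW N : V N.+1 `<=` V N by move=> x [].
have capV : \bigcap_N V N = \bigcap_i U i.
  apply/seteqP; split => x h i _; first exact/subV/h.
  by elim: i => [|i ih]; [exact: h|split => //; exact: h].
have mcap : measurable (\bigcap_i U i) by apply: bigcap_measurable => //; exists 0%N.
have BV N : \bigcap_i B i `<=` V N.
  move=> x h; have : (\bigcap_N V N) x; last exact.
  by rewrite capV => i _; have [_ + _] := hU i; apply; exact: h.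
have finV N : mu (V N) \is a fin_num.
  rewrite ge0_fin_numE//; apply: le_lt_trans mufin.
  by apply: le_measure; rewrite ?inE.
have cv : mu (V N `\` \bigcap_i U i) @[N --> \oo] --> (0 : \bar R)%E.
  rewrite -(measure0 mu).
  rewrite (_ : set0 = \bigcap_N (V N `\` \bigcap_i U i)); last first.
    apply/esym/seteqP; split => // x h.
    have [_] := h 0%N I; apply; rewrite -capV => N _.
    by have [] := h N I.
  apply: nonincreasing_cvg_mu.
  - apply: le_lt_trans mufin.
    by apply: le_measure; rewrite ?inE//; exact: measurableD.
  - by move=> i; exact: measurableD.
  - by apply: bigcap_measurable => //= i _; exact: measurableD.
  - apply/nonincreasing_seqP => N; rewrite subsetEset.
    by apply: setSD; exact: subW.
have [N hN] : exists N, (mu (V N `\` \bigcap_i U i) < (e / 2)%:E)%E.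
  have [N _ /(_ N (leqnn N))/= h] := cvgr_lt _ (fine_cvg cv) _ e20.
  exists N; rewrite -(@fineK _ (mu _)) ?lte_fin// ge0_fin_numE//.
  apply: le_lt_trans mufin; apply: le_measure; rewrite ?inE//.
  exact: measurableD.
have le2 : (mu (\bigcup_i (U i `\` B i)) <= (e / 2)%:E)%E.
  by apply: measure_bigcup_le => //; [exact: ltW|move=> i; have [] := hU i].
exists (V N); split => //.
apply: (@le_lt_trans _ _ (mu (V N `\` \bigcap_i U i) + mu (\bigcup_i (U i `\` B i)))%E).
  apply: le_trans; last first.
    apply: measureU2; first exact: measurableD.
    exact: bigcup_measurable.
  apply: le_measure; rewrite ?inE.
  - by apply: measurableD => //; apply: bigcap_measurable => //; exists 0%N.
  - by apply: measurableU; [exact: measurableD|exact: bigcup_measurable].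
  - move=> x [Vx nB]; have [Ux|nU] := pselect ((\bigcap_i U i) x); last by left.
    right; apply: contrapT => no; apply: nB => i _; apply: contrapT => nBi.
    by apply: no; exists i => //; split => //; exact: Ux.
have -> : e%:E = ((e / 2)%:E + (e / 2)%:E)%E by rewrite -EFinD -splitr.
by apply: lte_leD => //; rewrite ge0_fin_numE//; exact: le_lt_trans le2 (ltry _).
Qed.

Lemma outer_regular A : measurable A -> outer_approximable A.
Proof.
(* Requiring the approximation of A and of its complement makes the class a sigma-algebra: for the
   complement of a union, the lemma on intersections is used. *)
pose C := [set A | [/\ measurable A, outer_approximable A & outer_approximable (~` A)]].
have d0 : dyadic_open (set0 : set 'rV[R]_n) by [].
have dT : dyadic_open (setT : set 'rV[R]_n) by move=> x _; exists 0%N.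
have sC : sigma_algebra setT C.
  split => [|B|F].
  - split => //; first exact: dyadic_open_outer_approximable.
    by rewrite setC0; exact: dyadic_open_outer_approximable.
  - by rewrite setTD => -[mB oB oB']; split; rewrite ?setCK//; exact: measurableC.
  - move=> CF; split.
    + by apply: bigcup_measurable => i _; have [] := CF i.
    + by apply: outer_approximable_bigcup => i; have [] := CF i.
    + rewrite setC_bigcup; apply: outer_approximable_bigcap => i; have [//] := CF i.
      by move=> ? _ _; exact: measurableC.
suff sub : @measurable _ 'rV[R]_n `<=` C by move=> /sub[].
apply: smallest_sub => //.
rewrite -bigcup_seq; apply: bigcup_sub => j _.
move=> _ [B mB <-].
have sI := @sigma_algebra_image _ _ setT (fun x : 'rV[R]_n => x 0 j) C sC.
have oo c : open [set x : 'rV[R]_n | c < x 0 j].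
  by apply: (@open_comp _ _ (fun x : 'rV[R]_n => x 0 j) [set y | c < y]);
    [move=> x _; exact: coord_continuous|exact: open_gt].
have ol c : open [set x : 'rV[R]_n | x 0 j < c].
  by apply: (@open_comp _ _ (fun x : 'rV[R]_n => x 0 j) [set y | y < c]);
    [move=> x _; exact: coord_continuous|exact: open_lt].
suff: <<s (@RGenOInfty.G R) >> `<=` image_set_system setT (fun x : 'rV[R]_n => x 0 j) C.
  apply; suff : (@RGenOInfty.G R).-sigma.-measurable B by [].
  by rewrite -RGenOInfty.measurableE.
apply: smallest_sub => // _ [c ->] /=.
rewrite /image_set_system /= setTI.
have -> : (fun x : 'rV[R]_n => x 0 j) @^-1` `]c, +oo[ = [set x | c < x 0 j].
  by apply/seteqP; split => x /=; rewrite in_itv/= andbT.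
split.
- by apply: open_measurable_rV; exact: oo.
- by apply: dyadic_open_outer_approximable; apply: open_dyadic_open; exact: oo.
(* The complement of an open half-space is a countable intersection of open half-spaces. *)
- rewrite (_ : ~` _ = \bigcap_i [set x : 'rV[R]_n | x 0 j < c + i.+1%:R^-1]).
    apply: outer_approximable_bigcap => i.
      by apply: open_measurable_rV; exact: ol.
    by apply: dyadic_open_outer_approximable; apply: open_dyadic_open; exact: ol.
  apply/seteqP; split => x /=.
    by move=> /negP; rewrite -leNgt => h i _ /=; apply: le_lt_trans h _; rewrite ltrDl.
  by move=> h /ltr_add_invr[k hk]; have /= := h k I; rewrite ltNge (ltW hk).
Qed.
End regularity.

(** * Lipschitz images of Lebesgue null sets are Hausdorff null *)

Section null_sets.
Context {R : realType}.

Lemma dyadic_open_dcube_seq n j :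
  dyadic_open (@dcube_seq R n [set kv | kv.1 = 0%N] j).
Proof.
rewrite /dcube_seq; case: pickle_inv => [[k v]|] //.
case: asboolP => [k0|_] x // xv; exists 0%N.
by move: xv; rewrite /dcube/= (k0 : k = 0%N) => <-.
Qed.

(** Lebesgue measure is infinite, so outer regularity is applied to its restriction to each unit
    cube. The unit cubes are dyadic-open, hence cutting the covers down to them keeps them
    dyadic-open. *)
Lemma null_dyadic_cover n (A : set 'rV[R]_n) (e : R) : measurable A ->
  borel_lebesgue A = 0%E -> 0 < e ->
  exists U, [/\ dyadic_open U, A `<=` U & (borel_lebesgue U <= e%:E)%E].
Proof.
move=> mA A0 e0.
pose D j := @dcube_seq R n [set kv | kv.1 = 0%N] j.
have mD j : measurable (D j) by exact: measurable_dcube_seq.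
have covD : \bigcup_j D j = setT.
  rewrite bigcup_dcube_seq -subTset => x _.
  by exists (0%N, cell 0 x).
have Dfin j : (borel_lebesgue (D j) < +oo)%E.
  rewrite /D /dcube_seq; case: pickle_inv => [kv|]; last by rewrite measure0.
  by case: ifP => _; rewrite ?measure0// [X in (X < _)%E]borel_lebesgue_dcube ltry.
have h j : exists U, [/\ dyadic_open U, A `<=` U &
    (borel_lebesgue (U `&` D j) < (e / (2 ^ j.+1)%:R)%:E)%E].
  have fin : (mrestr (@borel_lebesgue R n) (mD j) setT < +oo)%E by rewrite /mrestr setTI.
  have ej : 0 < e / (2 ^ j.+1)%:R by rewrite divr_gt0// ltr0n expn_gt0.
  have [U [oU AU hU]] := outer_regular fin mA ej.
  exists U; split=> //; apply: le_lt_trans hU; rewrite /mrestr.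
  have mU := dyadic_open_measurable oU.
  apply: (@le_trans _ _ (borel_lebesgue ((U `\` A) `&` D j) +
    borel_lebesgue (A `&` D j))%E).
    rewrite (_ : U `&` D j = ((U `\` A) `&` D j) `|` (A `&` D j)); last first.
      by rewrite -setIUl setUC setDUK.
    by apply: measureU2; apply: measurableI => //; exact: measurableD.
  rewrite [X in (_ + X)%E](_ : _ = 0%E) ?adde0//.
  apply/eqP; rewrite -measure_le0 -A0; apply: le_measure; rewrite ?inE//.
  exact: measurableI.
have {h}[U hU] := choice h.
exists (\bigcup_j (U j `&` D j)); split.
- apply: dyadic_open_bigcup => j; apply: dyadic_openI; first by have [] := hU j.
  exact: dyadic_open_dcube_seq.
- move=> x Ax; have : (\bigcup_j D j) x by rewrite covD.
  by move=> [j _ Dx]; exists j => //; split => //; have [_ + _] := hU j; exact.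
- apply: measure_bigcup_le; first exact: ltW.
    move=> j; apply: measurableI => //; apply: dyadic_open_measurable.
    by have [] := hU j.
  by move=> j; have [] := hU j.
Qed.

(** A cube of side l has volume l^m and an image of diameter at most C l, so the sum of the m-th
    powers of the diameters is at most C^m times the volume of a disjoint cubic cover of A. The
    source carries the sup distance because it is the one that cubes control. *)
Lemma hausdorff_lipschitz_null m n (A : set 'rV[R]_m) (L : 'rV[R]_m -> 'rV[R]_n) (C : R) :
  0 < C ->
  (forall (z z' : 'rV[R]_m) (d : R), (forall j, `|z 0 j - z' 0 j| <= d) -> enorm (L z - L z') <= C * d) ->
  measurable A -> borel_lebesgue A = 0%E -> hausdorff m (L @` A) = 0%E.
Proof.
move=> C0 hL mA A0; rewrite /hausdorff.
suff h delta : 0 < delta -> hausdorff_content m delta (L @` A) = 0%E.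
  rewrite (_ : [set _ | _ in _] = [set 0%E]) ?ereal_sup1 ?mule0//.
  apply/seteqP; split => x /=; first by move=> [d d0 <-]; rewrite h.
  by move=> ->; exists 1 => /=; rewrite ?h.
move=> d0; apply/eqP; rewrite eq_le; apply/andP; split; last first.
  apply: le_ereal_inf_tmp => _ [F _ <-]; apply: nneseries_ge0 => k _ _.
  rewrite /diam_pow; case: eqP => // /eqP/set0P[x Fx].
  apply: expe_ge0; apply: ereal_sup_ubound; exists x => //; exists x => //.
  by rewrite subrr /enorm /dot big1 ?sqrtr0// => i _; rewrite mxE mul0r.
apply/lee_addgt0Pr => e e0; rewrite add0e.
have e'0 : 0 < e / C ^+ m by rewrite divr_gt0// exprn_gt0.
have [U [oU AU hU]] := null_dyadic_cover mA A0 e'0.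
(* Cubes of generation at least k0 have images of diameter at most delta. *)
have [k0 hk0] := @exists_exprVn_lt R (delta / C) (divr_gt0 d0 C0).
pose S : set (nat * 'rV[int]_m) := [set kv | (k0 <= kv.1)%N /\ @dcube R m kv `<=` U].
pose M := @maximal_dcubes R m S.
have UE : U = \bigcup_j dcube_seq M j.
  by rewrite bigcup_dcube_seq bigcup_maximal_dcubes; exact: dyadic_openE.
pose F j := L @` (dcube_seq M j).
have diamF kv : (ediam (L @` dcube kv) <= (C * 2 ^- kv.1)%:E)%E.
  apply: ge_ereal_sup => _ [_ [x xk <-] [_ [y yk <-] <-]]; rewrite lee_fin.
  apply: hL => j; apply/ltW/dcube_dist.
  by rewrite xk yk.
have ediam0 T (x : 'rV[R]_n) : T x -> (0 <= ediam T)%E.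
  move=> Tx; apply: ereal_sup_ubound; exists x => //; exists x => //.
  by rewrite subrr /enorm /dot big1 ?sqrtr0// => i _; rewrite mxE mul0r.
apply: (@le_trans _ _ (\sum_(0 <= k <oo) diam_pow m (F k))%E).
  apply: ereal_inf_lbound; exists F => //; split.
    move=> _ [z Az <-]; have := AU z Az; rewrite UE => -[j _ zj].
    by exists j => //; exists z.
  move=> j; rewrite /F /dcube_seq.
  have e_0 : (ediam (L @` set0) <= delta%:E)%E.
    by rewrite image_set0; apply: ge_ereal_sup => _ [x []].
  case: pickle_inv => [kv|//]; case: asboolP => //= -[[k0k _] _].
  apply: le_trans (diamF kv) _; rewrite lee_fin mulrC -ler_pdivlMr//.
  apply: le_trans (ltW hk0); rewrite lef_pV2 ?posrE ?exprn_gt0//.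
  by rewrite ler_eXn2l// ltr1n.
apply: (@le_trans _ _ (\sum_(0 <= k <oo) ((C ^+ m)%:E * borel_lebesgue (dcube_seq M k)))%E).
  apply: lee_nneseries => [k _ _|k _].
    by rewrite /diam_pow; case: eqP => // /eqP/set0P[x Fx]; exact/expe_ge0/(ediam0 _ x).
  rewrite /diam_pow; case: eqP => [_|/eqP/set0P[x]].
    by rewrite mule_ge0// lee_fin exprn_ge0// ltW.
  rewrite /F /dcube_seq; case: pickle_inv => [kv|]; last by rewrite image_set0.
  case: asboolP; last by rewrite image_set0.
  move=> _ Fx; rewrite [X in (_ * X)%E]borel_lebesgue_dcube -EFinM -exprMn EFin_expe.
  have := diamF kv; have := ediam0 _ _ Fx.
  case: (ediam _) => [r||] //=; rewrite !lee_fin => r0 rC.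
  by rewrite -!EFin_expe lee_fin lerXn2r// nnegrE (le_trans r0).
rewrite nneseriesZl// -measure_semi_bigcup//; last 3 first.
- by move=> i; exact: measurable_dcube_seq.
- exact: trivIset_maximal_dcubes.
- by rewrite -UE; exact: dyadic_open_measurable.
rewrite -UE; apply: le_trans (lee_wpmul2l _ hU) _; first by rewrite lee_fin exprn_ge0// ltW.
by rewrite -EFinM lee_fin mulrC divfK// gt_eqF// exprn_gt0.
Qed.

End null_sets.

(** * Finite upper density of a finite measure at almost every point *)

Lemma measurable_cube {R : realType} n (z : 'rV[R]_n) (r : R) :
  measurable [set z' : 'rV[R]_n | forall j, `|z' 0 j - z 0 j| <= r].
Proof.
rewrite (_ : [set _ | _] = \bigcap_(j in [set: 'I_n])
    ((fun z' : 'rV[R]_n => z' 0 j) @^-1` `[z 0 j - r, z 0 j + r])).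
  apply: fin_bigcap_measurable; first exact: finite_finset.
  move=> j _; rewrite -[X in measurable X]setTI.
  exact: (measurable_coord j).
by apply/seteqP; split => x h j;
  [move=> _; rewrite /= in_itv/= -ler_distl|have := h j I; rewrite /= in_itv/= -ler_distl].
Qed.

Section density.
Context {R : realType}.
Variables (n : nat) (mu : {measure set 'rV[R]_n -> \bar R}).
Hypothesis mufin : (mu setT < +oo)%E.

(* The maximal heavy cubes are disjoint, so no covering lemma is needed for the
   weak-type bound on the maximal function. *)
Definition heavy (c : nat) : set (nat * 'rV[int]_n) :=
  [set kv | (c.+1%:R%:E * @borel_lebesgue R n (dcube kv) < mu (dcube kv))%E].

(** The concentric cube of triple side: the ends v - 1 and v of each side are moved out by one side
    length. *)
Definition dcube_nbhd (kv : nat * 'rV[int]_n) : set 'rV[R]_n :=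
  obox (\row_j ((kv.2 0 j - 2)%:~R / 2 ^+ kv.1)) (\row_j ((kv.2 0 j + 1)%:~R / 2 ^+ kv.1)).

Lemma dcube_nbhdP kv (z y : 'rV[R]_n) : dcube kv y -> (forall j, `|z 0 j - y 0 j| <= 2 ^- kv.1) ->
  dcube_nbhd kv z.
Proof.
case: kv => k v /dcubeP h d j; have := h j; have := d j; rewrite !mxE /=.
rewrite !intrB !intrD !mulrBl !mulrDl !mul1r ler_norml => /andP[? ?] /andP[? ?].
by apply/andP; split; lra.
Qed.

Lemma borel_lebesgue_dcube_nbhd kv : borel_lebesgue (dcube_nbhd kv) =
  ((3 ^+ n)%:E * borel_lebesgue (@dcube R n kv))%E.
Proof.
rewrite [X in (_ * X)%E]borel_lebesgue_dcube [LHS]borel_lebesgue_obox -EFinM -exprMn; congr EFin.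
under eq_bigr => j _.
  rewrite !mxE -mulrBl -rmorphB/= opprB addrC addrA subrK.
  rewrite (_ : Num.max _ _ = 3 * 2 ^- kv.1); last first.
    by apply/max_idPr; rewrite mulr_ge0// ?invr_ge0 ?exprn_ge0.
  over.
by rewrite prodr_const card_ord.
Qed.

Definition heavy_seq c j : set 'rV[R]_n :=
  if pickle_inv j is Some kv then
    (if `[< maximal_dcubes (R := R) (heavy c) kv >] then dcube_nbhd kv else set0) else set0.

(** It contains every point within one side length of a heavy cube, and stands for a superlevel set
    of the maximal function. *)
Definition heavy_set c : set 'rV[R]_n := \bigcup_j heavy_seq c j.

Lemma measurable_heavy_seq c j : measurable (heavy_seq c j).
Proof.
rewrite /heavy_seq; case: pickle_inv => [kv|]; last exact: measurable0.
by case: ifP => _; [exact: measurable_obox|exact: measurable0].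
Qed.

Lemma sub_heavy_set c kv (y z : 'rV[R]_n) : heavy c kv -> dcube kv y ->
  (forall j, `|z 0 j - y 0 j| <= 2 ^- kv.1) -> heavy_set c z.
Proof.
move=> hkv ky zy; have [kv' [mx sub le]] := @exists_maximal_dcube R n _ _ hkv.
exists (pickle kv') => //; rewrite /heavy_seq pickleK_inv asboolT//.
apply: (dcube_nbhdP (sub _ ky)) => j; apply: le_trans (zy j) _.
by rewrite lef_pV2 ?posrE ?exprn_gt0// ler_eXn2l// ltr1n.
Qed.

Lemma heavy_set_le c :
  (borel_lebesgue (heavy_set c) <= (3 ^+ n / c.+1%:R)%:E * mu setT)%E.
Proof.
pose M := maximal_dcubes (R := R) (heavy c).
apply: (@le_trans _ _ (\sum_(j <oo) borel_lebesgue (heavy_seq c j))%E).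
  apply: measure_sigma_subadditive => //; first exact: measurable_heavy_seq.
  by apply: bigcup_measurable => j _; exact: measurable_heavy_seq.
apply: (@le_trans _ _ (\sum_(j <oo) ((3 ^+ n / c.+1%:R)%:E * mu (dcube_seq M j)))%E).
  apply: lee_nneseries => // j _; rewrite /heavy_seq /dcube_seq.
  case: pickle_inv => [kv|]; last by rewrite !measure0 mule0.
  case: asboolP => [[h _]|_]; last by rewrite !measure0 mule0.
  rewrite [leLHS]borel_lebesgue_dcube_nbhd EFinM -muleA.
  apply: lee_wpmul2l; first by rewrite lee_fin exprn_ge0.
  by rewrite muleC lee_pdivlMr// muleC ltW.
rewrite nneseriesZl//; apply: lee_wpmul2l.
  by rewrite lee_fin divr_ge0// exprn_ge0.
rewrite -measure_semi_bigcup.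
- apply: le_measure; rewrite ?inE//.
  by apply: bigcup_measurable => j _; exact: measurable_dcube_seq.
- by move=> i; exact: measurable_dcube_seq.
- exact: trivIset_maximal_dcubes.
- by apply: bigcup_measurable => j _; exact: measurable_dcube_seq.
Qed.

(** k is the last generation whose side is still at least r; it exists for r < 1 because generations
    start at 0. *)
Lemma dyadic_scale (r : R) : 0 < r -> r < 1 -> exists k, r <= 2 ^- k /\ 2 ^- k <= 2 * r.
Proof.
move=> r0 r1; have [k0 hk0] := exists_exprVn_lt r0.
have ex : exists k, 2 ^- k < r by exists k0.
case: (ex_minnP ex) => -[|k] hk mink.
  by move: hk; rewrite expr0 invr1 ltNge (ltW r1).
exists k; split.
  by rewrite leNgt; apply/negP => /mink; rewrite ltnn.
move/ltW : hk; rewrite exprS invfM => h.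
by rewrite -ler_pdivrMl// mulrC mulrC.
Qed.

(** N is the intersection of all [heavy_set c], null by the weak-type bound. If z avoids
    [heavy_set c], every dyadic cube of side between r and 2 r that meets the cube of radius r
    around z is light, and these cubes are disjoint and lie within distance 4 r of z. *)
Lemma density_finite : exists N : set 'rV[R]_n, [/\ measurable N, borel_lebesgue N = 0%E &
  forall z : 'rV[R]_n, ~ N z -> exists C : R, 0 <= C /\ forall r : R, 0 < r ->
    (mu [set z' : 'rV[R]_n | (forall j, `|z' 0 j - z 0 j| <= r)%R] <= (C * r ^+ n)%:E)%E].
Proof.
have mH c : measurable (heavy_set c).
  by apply: bigcup_measurable => j _; exact: measurable_heavy_seq.
have muTE : mu setT = (fine (mu setT))%:E by rewrite fineK// ge0_fin_numE.
exists (\bigcap_c heavy_set c); split.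
- by apply: bigcap_measurable => // ; exists 0%N.
- apply/eqP; rewrite -measure_le0; apply/lee_addgt0Pr => e e0; rewrite add0e.
  set M := 3 ^+ n * fine (mu setT).
  have M0 : 0 <= M by rewrite mulr_ge0 ?exprn_ge0// fine_ge0.
  pose c := Num.trunc (M / e).
  apply: (@le_trans _ _ (borel_lebesgue (heavy_set c))).
    apply: le_measure; rewrite ?inE//; first by apply: bigcap_measurable => //; exists 0%N.
    by move=> x; exact.
  apply: le_trans (heavy_set_le c) _; rewrite muTE -EFinM lee_fin mulrAC -/M.
  by rewrite ler_pdivrMr// mulrC -ler_pdivrMr// ltW// truncnS_gt.
move=> z zN.
have [c hc] : exists c, ~ heavy_set c z.
  by apply: contrapT => no; apply: zN => c _; apply: contrapT => h; apply: no; exists c.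
set M := fine (mu setT); have M0 : 0 <= M by rewrite fine_ge0.
pose C := c.+1%:R * 8 ^+ n : R.
have C0 : 0 <= C by rewrite mulr_ge0// exprn_ge0.
(* M serves the radii r >= 1, where r^n >= 1. C serves r < 1; its factor 8^n comes from the box of
   half-side 4 r. *)
exists (M + C); split => [|r r0]; first exact: addr_ge0.
have mB := measurable_cube z r.
have [r1|r1] := leP 1 r.
  apply: (@le_trans _ _ (mu setT)); first by apply: le_measure; rewrite ?inE.
  rewrite muTE lee_fin -/M; apply: (@le_trans _ _ (M * 1)); first by rewrite mulr1.
  by apply: ler_pM => //; [rewrite lerDl|exact: exprn_ege1].
have [k [rk kr]] := dyadic_scale r0 r1.
(* All cubes of T have generation k, hence all are maximal; [maximal_dcubes] only gives access to
   the disjoint enumeration. *)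
pose T : set (nat * 'rV[int]_n) := [set kv | kv.1 = k /\
  exists y : 'rV[R]_n, dcube kv y /\ forall j, `|y 0 j - z 0 j| <= r].
pose Mx := maximal_dcubes (R := R) T.
have mbig : measurable (\bigcup_j @dcube_seq R n Mx j).
  by apply: bigcup_measurable => j _; exact: measurable_dcube_seq.
apply: (@le_trans _ _ (\sum_(j <oo) mu (@dcube_seq R n Mx j))%E).
  apply: measure_sigma_subadditive => //; first by move=> j; exact: measurable_dcube_seq.
  rewrite bigcup_dcube_seq bigcup_maximal_dcubes => x xr.
  by exists (k, cell k x) => //; split => //; exists x.
apply: (@le_trans _ _ (\sum_(j <oo) (c.+1%:R%:E * borel_lebesgue (@dcube_seq R n Mx j)))%E).
  apply: lee_nneseries => // j _; rewrite /dcube_seq.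
  case: pickle_inv => [kv|]; last by rewrite !measure0 mule0.
  case: asboolP => [[[kE [y [ky yr]]] _]|_]; last by rewrite !measure0 mule0.
  rewrite leNgt; apply/negP => h; apply: hc; apply: (sub_heavy_set h ky) => i.
  by rewrite distrC kE; exact: le_trans rk.
rewrite nneseriesZl// -measure_semi_bigcup//; last 2 first.
- by move=> i; exact: measurable_dcube_seq.
- exact: trivIset_maximal_dcubes.
apply: (@le_trans _ _ (c.+1%:R%:E * ((8 * r) ^+ n)%:E)%E); last first.
  rewrite -EFinM lee_fin exprMn mulrA; apply: ler_wpM2r; last by rewrite lerDr.
  by apply: exprn_ge0; exact: ltW.
apply: lee_wpmul2l; first by rewrite lee_fin.
apply: (@le_trans _ _ (borel_lebesgue (obox (\row_j (z 0 j - 4 * r)) (\row_j (z 0 j + 4 * r))))).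
  apply: le_measure; rewrite ?inE//; first exact: measurable_obox.
  move=> x; rewrite bigcup_dcube_seq => -[[k' v] [[/= -> [y [yv yr]]] _] xv] j; rewrite !mxE.
  have xy : cell k x = cell k y by rewrite -[RHS]/(cell (k, v).1 y) xv yv.
  have := dcube_dist xy j; have := yr j.
  rewrite ler_norml ltr_norml => /andP[? ?] /andP[? ?].
  by apply/andP; split; lra.
rewrite [leLHS]borel_lebesgue_obox lee_fin.
under eq_bigr => j _.
  rewrite !mxE (_ : Num.max _ _ = 8 * r); last first.
    rewrite (_ : _ - _ = 8 * r); last by ring.
    by apply/max_idPr; rewrite mulr_ge0// ltW.
  over.
by rewrite prodr_const card_ord.
Qed.

End density.

(** * Borel majorants of functions measurable for the completed measure *)

Section completion.
Context {R : realType}.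
Variable n : nat.

Lemma measurable_Rn (A : set 'rV[R]_n) : measurable A -> measurable (A : set (Rn R n)).
Proof. exact: caratheodory_measurable_mu_ext. Qed.

Lemma leb_borel (A : set 'rV[R]_n) : measurable A -> leb n A = borel_lebesgue A.
Proof. by move=> mA; exact: measurable_mu_extE. Qed.

Lemma measurable_id_Rn : measurable_fun setT (id : Rn R n -> 'rV[R]_n).
Proof. by move=> _ B mB; rewrite setTI; exact: measurable_Rn. Qed.

Lemma measurable_fun_Rn d (T : measurableType d) (f : 'rV[R]_n -> T) D :
  measurable D -> measurable_fun D f -> measurable_fun (D : set (Rn R n)) (f : Rn R n -> T).
Proof. by move=> mD mf _ B mB; apply: measurable_Rn; exact: mf. Qed.

Lemma ge0_integral_leb (D : set 'rV[R]_n) (f : 'rV[R]_n -> \bar R) :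
  measurable D -> measurable_fun D f -> (forall x, D x -> 0 <= f x)%E ->
  (\int[leb n]_(x in D) f x = \int[@borel_lebesgue R n]_(x in D) f x)%E.
Proof.
move=> mD mf f0.
have mh := measurable_id_Rn.
pose nu : {measure set 'rV[R]_n -> \bar R} :=
  measure_function_pushforward__canonical__measure_function_Measure (@leb R n) mh.
transitivity (\int[nu]_(x in D) f x)%E.
  by rewrite /nu/= (ge0_integral_pushforward mh)// => x /set_mem; exact: f0.
by apply: eq_measure_integral => A mA _; exact: leb_borel.
Qed.

(** The completed measure is the outer measure of the Borel one, so Borel covers with excess 1/(k+1)
    exist; their intersection has the measure of A. *)
Lemma borel_superset (A : set (Rn R n)) : measurable A -> (leb n A < +oo)%E ->
  exists B : set 'rV[R]_n, [/\ measurable B, A `<=` B & leb n (B `\` A) = 0%E].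
Proof.
move=> mA Afin.
have fA : leb n A \is a fin_num by rewrite ge0_fin_numE.
have h k : exists G : set 'rV[R]_n, [/\ measurable G, A `<=` G &
    (borel_lebesgue G <= leb n A + (k.+1%:R^-1)%:E)%E].
  have k0 : 0 < k.+1%:R^-1 :> R by [].
  have [_ [F [mF AF] <-] lt] := lb_ereal_inf_adherent k0 (fA : _ \is a fin_num).
  exists (\bigcup_k F k); split => //; first exact: bigcup_measurable.
  apply: le_trans (ltW lt); apply: measure_sigma_subadditive => //.
  exact: bigcup_measurable.
have {h}[G hG] := choice h.
have mG : measurable (\bigcap_k G k).
  by apply: bigcap_measurable => [|k _]; [exists 0%N|have [] := hG k].
have AG : A `<=` \bigcap_k G k by move=> x Ax k _; have [_ + _] := hG k; exact.
have le : (leb n (\bigcap_k G k) <= leb n A)%E.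
  apply/lee_addgt0Pr => e e0.
  have [k hk] := ltr_add_invr (e0 : 0 < e); rewrite add0r in hk.
  rewrite [leLHS]leb_borel//; apply: (@le_trans _ _ (borel_lebesgue (G k))).
    apply: le_measure; rewrite ?inE//; first by have [] := hG k.
    by move=> x; exact.
  have [_ _ lek] := hG k; apply: le_trans lek _.
  by apply: leeD => //; rewrite lee_fin ltW.
exists (\bigcap_k G k); split => //.
have mG' := measurable_Rn mG.
rewrite measureD//; last exact: le_lt_trans le Afin.
have E : leb n (\bigcap_k G k) = leb n A.
  by apply/eqP; rewrite eq_le le/=; apply: le_measure; rewrite ?inE.
by rewrite setIidr// [X in (X - _)%E]E subee.
Qed.

Lemma negligible_leb_borel (N : set 'rV[R]_n) : measurable N -> borel_lebesgue N = 0%E ->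
  (leb n).-negligible N.
Proof.
by move=> mN N0; exists N; split => //; [exact: measurable_Rn|rewrite [LHS]leb_borel].
Qed.

Definition pos_rat (j : nat) : R :=
  if pickle_inv j is Some q then (if (0 : rat) < q then ratr q else 1) else 1.

Lemma pos_rat_gt0 j : 0 < pos_rat j.
Proof.
by rewrite /pos_rat; case: pickle_inv => // q; case: ifPn => // ?; rewrite ltr0q.
Qed.

Lemma pos_rat_between (x y : \bar R) : (0 <= x)%E -> (x < y)%E ->
  exists j, (x < (pos_rat j)%:E /\ (pos_rat j)%:E < y)%E.
Proof.
move=> x0 xy.
have [r [s [xr rs]]] : exists r s : R, [/\ x = r%:E, r < s & (s%:E <= y)%E].
  case: x x0 xy => [r| |] //=.
    case: y => [s| |] // _; first by rewrite lte_fin => rs; exists r, s.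
    by move=> _; exists r, (r + 1); rewrite ltrDl ltr01 leey.
  by move=> _; rewrite ltNge leey.
have [q /andP[rq qs]] : exists q : rat, r < ratr q < s.
  by have [q] := rat_in_itvoo rs; rewrite in_itv/=; exists q.
move=> sy; exists (pickle q); rewrite /pos_rat pickleK_inv.
have -> : (0 : rat) < q by rewrite -(@ltr0q R); apply: le_lt_trans rq; rewrite -lee_fin -xr.
by rewrite xr lte_fin rq; split => //; apply: lt_le_trans sy; rewrite lte_fin.
Qed.

(** H is the supremum over positive rationals s of s times the indicator of a Borel superset of {W >
    s}. It exceeds W on a null set only, so the integral does not grow, while the domination holds
    at every point of D and hence on every line. *)
Lemma borel_majorant (D : set (Rn R n)) (W : Rn R n -> \bar R) :
  measurable D -> measurable_fun D W -> (forall x, D x -> 0 <= W x)%E ->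
  (\int[leb n]_(x in D) W x < +oo)%E ->
  exists H : 'rV[R]_n -> \bar R, [/\ measurable_fun setT H, (forall x, 0 <= H x)%E,
    (forall x, D x -> W x <= H x)%E & (\int[@borel_lebesgue R n]_x H x < +oo)%E].
Proof.
move=> mD mW W0 Wfin.
pose A j := D `&` [set x | ((pos_rat j)%:E < W x)%E].
have mA j : measurable (A j) by exact: emeasurable_fun_o_infty.
have hA j : exists B : set 'rV[R]_n, [/\ measurable B, A j `<=` B & leb n (B `\` A j) = 0%E].
  apply: borel_superset => //.
  (* Markov's inequality: a superlevel set of positive level has finite measure. *)
  have : ((pos_rat j)%:E * leb n (A j) < +oo)%E.
    rewrite -integral_cst//; apply: le_lt_trans Wfin.
    apply: (@le_trans _ _ (\int[leb n]_(x in A j) W x)%E).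
      apply: ge0_le_integral => //.
      - by move=> x _; rewrite lee_fin ltW// pos_rat_gt0.
      - by apply: measurable_funS mW => // x [].
      - by move=> x [_ /= /ltW].
    by apply: ge0_subset_integral => // x [].
  rewrite !ltey; apply: contraNneq => ->.
  by rewrite gt0_muley// lte_fin pos_rat_gt0.
have {hA}[B hB] := choice hA.
have mB j : measurable (B j) by have [] := hB j.
pose h j (x : 'rV[R]_n) : \bar R := (pos_rat j * \1_(B j) x)%:E.
have h0 j x : (0 <= h j x)%E by rewrite lee_fin mulr_ge0// ltW// pos_rat_gt0.
pose H x := esups (h ^~ x) 0.
have hH j x : (h j x <= H x)%E by apply: ereal_sup_ubound; exists j.
have mH : measurable_fun setT H.
  apply: measurable_fun_esups => j; apply/measurable_EFinP.
  by apply: measurable_funM => //; exact: measurable_indic.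
have H0 x : (0 <= H x)%E by exact: le_trans (h0 0%N x) (hH 0%N x).
exists H; split => //.
  move=> x Dx; rewrite leNgt; apply/negP => lt.
  have [j [h1 h2]] := pos_rat_between (H0 x) lt.
  have [_ AB _] := hB j.
  have := hH j x; rewrite /h indicE mem_set ?mulr1; first by rewrite leNgt h1.
  by apply: AB; split.
apply: le_lt_trans Wfin.
rewrite -ge0_integral_leb// [leRHS]integral_mkcond.
apply: ae_ge0_le_integral => //.
- exact: (measurable_fun_Rn measurableT mH).
- by move=> x _; rewrite patchE; case: ifPn => // /set_mem; exact: W0.
- by apply/(measurable_restrictT _ mD).
pose Z := \bigcup_j (B j `\` A j) : set (Rn R n).
have Z0 : (leb n).-negligible Z.
  apply: negligible_bigcup => j; apply/negligibleP; last by have [] := hB j.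
  by apply: measurableD => //; exact: measurable_Rn.
apply: negligibleS Z0 => x /= /not_implyP[_ nle]; apply: contrapT => nZ.
apply: nle; apply: ge_ereal_sup => _ [j _ <-].
rewrite /h indicE; case: (boolP (x \in B j)) => [/set_mem Bx|_].
  rewrite mulr1; have [Dx /= /ltW lex] : A j x.
    by apply: contrapT => nA; apply: nZ; exists j.
  by rewrite patchE mem_set.
by rewrite mulr0 patchE; case: ifPn => // /set_mem; exact: W0.
Qed.

End completion.

(** * Smooth bump functions built from exp(-1/s) *)

Section flat.
Context {R : realType}.

(* The linear span of the functions s^-m exp(-1/s) is closed under
   differentiation: smoothness of what is built from them is an induction. *)
Definition flat (m : nat) (s : R) : R :=
  if 0 < s then (s^-1) ^+ m * expR (- s^-1) else 0.

Lemma flat_le0 m s : s <= 0 -> flat m s = 0.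
Proof. by rewrite /flat ltNge => ->. Qed.

(** From exp(t) >= (t / (m+1))^(m+1) with t = 1/s. *)
Lemma flat_bound m (s : R) : 0 < s -> flat m s <= m.+1%:R ^+ m.+1 * s.
Proof.
move=> s0; rewrite /flat s0.
set t := s^-1; have t0 : 0 < t by rewrite invr_gt0.
have h : (t / m.+1%:R) ^+ m.+1 <= expR t.
  have -> : expR t = (expR (t / m.+1%:R)) ^+ m.+1.
    by rewrite -expRM_natl mulrC divfK.
  rewrite lerXn2r ?nnegrE ?divr_ge0 ?expR_ge0// ?(ltW t0)//.
  by apply: le_trans (expR_ge1Dx _); rewrite lerDr.
have -> : s = t^-1 by rewrite invrK.
rewrite expRN ler_pdivrMr ?expR_gt0// mulrAC ler_pdivlMr// -exprSr.
move: h; rewrite expr_div_n ler_pdivrMr ?exprn_gt0// => h.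
by rewrite mulrC.
Qed.

Lemma flat_ge0 m s : 0 <= flat m s.
Proof.
by rewrite /flat; case: ifP => // s0; rewrite mulr_ge0 ?expR_ge0// exprn_ge0// invr_ge0 ltW.
Qed.

Lemma is_derive_flat m (s : R) :
  is_derive s 1 (flat m) (flat m.+2 s - m%:R * flat m.+1 s).
Proof.
have [s0|s0|->] := ltgtP s 0.
- rewrite !flat_le0 ?(ltW s0)// mulr0 subr0.
  apply: (@near_eq_is_derive _ _ _ (cst 0)).
  near=> t; rewrite flat_le0//; apply: ltW; near: t.
  exact: lt_nbhsl.
- apply: (@near_eq_is_derive _ R R (fun t : R => (t^-1) ^+ m * expR (- t^-1))).
    near=> t; rewrite /flat ifT//; near: t.
    exact: lt_nbhsr.
  rewrite /flat s0.
  have sn0 : s != 0 by rewrite gt_eqF.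
  have dV : is_derive s 1 (fun t : R => t^-1) (- s ^- 2).
    by apply: (is_derive_eq (is_deriveV _ (is_derive_id s 1))); rewrite // /GRing.scale/= mulr1.
  have dE : is_derive s 1 (fun t : R => expR (- t^-1)) (expR (- s^-1) * s ^- 2).
    have dN := is_deriveN dV.
    have := @is_derive1_comp _ expR (fun t : R => - t^-1) s _ _ (is_derive_expR _) dN.
    by rewrite opprK.
  have dX : is_derive s 1 (fun t : R => t^-1 ^+ m) (- m%:R * s^-1 ^+ m.+1).
    elim: m => [|m ih].
      by rewrite oppr0 mul0r; exact: is_derive_cst.
    have := is_deriveM dV ih.
    rewrite (_ : (fun t : R => t^-1) * _ = (fun t : R => t^-1 ^+ m.+1)); last first.
      by apply/funext => t; rewrite exprS.
    move/is_derive_eq; apply; rewrite /GRing.scale/= -[in RHS]natr1 !exprS; field.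
    by rewrite sn0.
  have := is_deriveM dX dE.
  rewrite (_ : (fun t : R => t^-1 ^+ m) * _ = (fun t : R => t^-1 ^+ m * expR (- t^-1)))//.
  move/is_derive_eq; apply; rewrite /GRing.scale/= !exprS; field.
  by rewrite sn0.
- rewrite !flat_le0// mulr0 subr0.
  have cv : h^-1 *: (flat m (h *: 1 + 0) - flat m 0) @[h --> 0^'] --> (0 : R).
    apply/cvgr0Pnorm_le => e e0.
    near=> h.
    rewrite addr0 [flat m 0]flat_le0// subr0 /GRing.scale/= mulr1.
    have [h0|h0] := leP h 0; first by rewrite flat_le0// mulr0 normr0 ltW.
    (* Dividing by h raises the index by one, so the difference quotient at 0 is again at most a
       constant times h. *)
    rewrite (_ : h^-1 * _ = flat m.+1 h); last by rewrite /flat h0 exprS mulrA.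
    rewrite ger0_norm ?flat_ge0//.
    apply: le_trans (flat_bound _ h0) _.
    rewrite mulrC -ler_pdivlMr ?exprn_gt0//.
    apply: le_trans (ler_norm _) _; near: h.
    apply: (@dnbhs0_le _ R^o); rewrite divr_gt0// exprn_gt0//.
  apply: DeriveDef; first by apply/cvg_ex; exists 0.
  exact: cvg_lim cv.
Unshelve. all: by end_near. Qed.

End flat.

Section smooth_class.
Context {R : realType}.
Variable n : nat.
Implicit Types (u v : 'rV[R]_n -> R).

(** A syntactic class of differentiable functions that is stable under [partial]; membership yields
    all iterated partial derivatives at once. *)
Inductive flat_generated : ('rV[R]_n -> R) -> Prop :=
| flat_generated_cst c : flat_generated (fun=> c)
| flat_generated_coord j : flat_generated (fun x => x 0 j)
| flat_generatedD u v : flat_generated u -> flat_generated v ->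
    flat_generated (fun x => u x + v x)
| flat_generatedM u v : flat_generated u -> flat_generated v ->
    flat_generated (fun x => u x * v x)
| flat_generated_flat m u : flat_generated u -> flat_generated (fun x => flat m (u x)).

Lemma differentiable_flat m (s : R) : differentiable (flat m) s.
Proof. by apply/derivable1_diffP; have [] := is_derive_flat m s. Qed.

Lemma flat_generated_differentiable u x : flat_generated u -> differentiable u x.
Proof.
elim=> [c|j|{}u v _ du _ dv|{}u v _ du _ dv|m {}u _ du].
- exact: differentiable_cst.
- exact: differentiable_coord.
- exact: differentiableD.
- exact: differentiableM.
- exact: (differentiable_comp du (differentiable_flat m (u x))).
Qed.

Lemma derive_coord j (x h : 'rV[R]_n) : 'D_h (fun y : 'rV[R]_n => y 0 j) x = h 0 j.
Proof.
apply: cvg_lim => //; apply: cvg_near_cst; near=> t.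
rewrite /= !mxE addrK /GRing.scale/= mulKf//; near: t.
exact: nbhs_dnbhs_neq.
Unshelve. all: by end_near. Qed.

Lemma derive_flat_comp m u (x h : 'rV[R]_n) : differentiable u x ->
  'D_h (fun y => flat m (u y)) x =
  (flat m.+2 (u x) - m%:R * flat m.+1 (u x)) * 'D_h u x.
Proof.
move=> du.
rewrite (deriveE h (differentiable_comp du (differentiable_flat m (u x)))).
rewrite diff_comp//; last exact: differentiable_flat.
rewrite /= (diff1E (differentiable_flat m _)) derive1E.
have [_ ->] := is_derive_flat m (u x).
by rewrite deriveE// /GRing.scale/= mulrC.
Qed.

Lemma flat_generated_partial i u : flat_generated u -> flat_generated (partial i u).
Proof.
have diff := flat_generated_differentiable.
elim=> [c|j|{}u v gu du gv dv|{}u v gu du gv dv|m {}u gu du].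
- rewrite (_ : partial i _ = fun=> 0); first exact: flat_generated_cst.
  by apply/funext => x; exact: derive_cst.
- rewrite (_ : partial i _ = fun=> (delta_mx 0 i : 'rV[R]_n) 0 j); first exact: flat_generated_cst.
  by apply/funext => x; exact: derive_coord.
- rewrite (_ : partial i _ = fun x => partial i u x + partial i v x); first exact: flat_generatedD.
  by apply/funext => x; apply: deriveD; apply: diff_derivable; exact: diff.
- rewrite (_ : partial i _ = fun x => u x * partial i v x + v x * partial i u x).
    by apply: flat_generatedD; exact: flat_generatedM.
  by apply/funext => x; apply: deriveM; apply: diff_derivable; exact: diff.
- rewrite (_ : partial i _ = fun x => (flat m.+2 (u x) + - m%:R * flat m.+1 (u x)) * partial i u x).
    apply: flat_generatedM => //; apply: flat_generatedD; first exact: flat_generated_flat.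
    by apply: flat_generatedM; [exact: flat_generated_cst|exact: flat_generated_flat].
  by apply/funext => x; rewrite /partial derive_flat_comp ?mulNr//; exact: diff.
Qed.

Lemma flat_generated_smooth u : flat_generated u -> smooth u.
Proof.
move=> gu s; have gs : flat_generated (partials s u).
  by elim: s => //= i s; exact: flat_generated_partial.
split=> [x|i x]; first exact/differentiable_continuous/flat_generated_differentiable.
exact/diff_derivable/flat_generated_differentiable.
Qed.

Lemma flat_generated_sum (I : finType) (F : I -> 'rV[R]_n -> R) :
  (forall i, flat_generated (F i)) -> flat_generated (fun x => \sum_i F i x).
Proof.
move=> gF; rewrite (_ : (fun _ => _) = \sum_i F i); last first.
  by apply/funext => x; rewrite fct_sumE.
elim/big_ind : _ => [|f g gf gg|i _]; [exact: flat_generated_cst|exact: flat_generatedD|exact: gF].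
Qed.

Lemma deriveE_partial u x (h : 'rV[R]_n) : differentiable u x ->
  'D_h u x = \sum_j h 0 j * partial j u x.
Proof.
move=> du; rewrite deriveE// {1}(row_sum_delta h) linear_sum/=.
by apply: eq_bigr => j _; rewrite linearZ/= /partial deriveE.
Qed.

(* The scaling by k+1 makes these smooth functions increase to the indicator
   function of the ball as k grows. *)
Definition ball_bump (k : nat) (c : 'rV[R]_n) (r : R) : 'rV[R]_n -> R :=
  fun y => flat 0 (k.+1%:R * (r ^+ 2 + \sum_j - (y 0 j - c 0 j) ^+ 2)).

Lemma flat_generated_ball_bump k c r : flat_generated (ball_bump k c r).
Proof.
apply: flat_generated_flat; apply: flat_generatedM; first exact: flat_generated_cst.
apply: flat_generatedD; first exact: flat_generated_cst.
apply: flat_generated_sum => j.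
under eq_fun do rewrite expr2 -mulN1r.
apply: flat_generatedM; first exact: flat_generated_cst.
by apply: flat_generatedM; apply: flat_generatedD;
  try exact: flat_generated_coord; exact: flat_generated_cst.
Qed.

Lemma dotE_sum_sqr (x : 'rV[R]_n) : dot x x = \sum_j x 0 j ^+ 2.
Proof. by apply: eq_bigr => j _; rewrite expr2. Qed.

Lemma enorm_ge0 (x : 'rV[R]_n) : 0 <= enorm x.
Proof. exact: sqrtr_ge0. Qed.

Lemma sqr_enorm (x : 'rV[R]_n) : enorm x ^+ 2 = \sum_j x 0 j ^+ 2.
Proof. by rewrite sqr_sqrtr dotE_sum_sqr// sumr_ge0// => j _; rewrite sqr_ge0. Qed.

Lemma ball_bumpE k c r y : ball_bump k c r y = flat 0 (k.+1%:R * (r ^+ 2 - enorm (y - c) ^+ 2)).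
Proof.
rewrite /ball_bump sqr_enorm sumrN; congr (flat 0 (_ * (_ - _))).
by apply: eq_bigr => j _; rewrite !mxE.
Qed.

Lemma ball_bump_ge0 k c r y : 0 <= ball_bump k c r y.
Proof. exact: flat_ge0. Qed.

Lemma ball_bump_le1 k c r y : ball_bump k c r y <= 1.
Proof.
rewrite /ball_bump /flat; case: ifP => // s0; rewrite expr0 mul1r.
by rewrite -[leRHS]expR0 ler_expR oppr_le0 invr_ge0 ltW.
Qed.

Lemma ball_bump_out k c r y : 0 < r -> ~ eball c r y -> ball_bump k c r y = 0.
Proof.
move=> r0 /negP; rewrite -leNgt => h; rewrite ball_bumpE flat_le0// pmulr_rle0// subr_le0.
by rewrite lerXn2r// nnegrE ?enorm_ge0 ?ltW.
Qed.

Lemma ball_bump_translate k c r t (h : 'rV[R]_n) y :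
  ball_bump k (c + t *: h) r y = ball_bump k c r (y - t *: h).
Proof. by rewrite !ball_bumpE opprD addrA addrAC. Qed.

(** Inside the ball the value is exp(-1/((k+1) d)) with d = r^2 - |y - c|^2 > 0. On the sphere and
    outside it is 0 for every k, so the limit is the indicator of the open ball. *)
Lemma cvg_ball_bump c r y : 0 < r ->
  ball_bump k c r y @[k --> \oo] --> (\1_(eball c r) y : R).
Proof.
move=> r0; rewrite indicE; case: (boolP (y \in eball c r)) => [/set_mem/= h|]; last first.
  by rewrite notin_setE => h; under eq_fun do rewrite ball_bump_out//; exact: cvg_cst.
have d0 : 0 < r ^+ 2 - enorm (y - c) ^+ 2.
  by rewrite subr_gt0 ltr_pXn2r// nnegrE ?enorm_ge0 ?ltW.
set d := (X in 0 < X) in d0.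
rewrite (_ : (fun k => _) = (fun k => expR (- (d^-1 * k.+1%:R^-1)))); last first.
  apply/funext => k; rewrite ball_bumpE /flat -/d mulr_gt0// expr0 mul1r.
  by rewrite invfM mulrC.
rewrite -[X in _ --> X]expR0 -[X in expR X]oppr0 -(mulr0 d^-1).
apply: (@cvg_comp _ _ _ (fun k : nat => - (d^-1 * k.+1%:R^-1)) expR _
  (nbhs (- (d^-1 * 0)))); last exact: continuous_expR.
by apply: cvgN; apply: cvgM; [exact: cvg_cst|exact: cvg_harmonic].
Qed.

End smooth_class.
Arguments ball_bump {R n} k c r _.

(** * Euclidean norm and balls *)

Section euclidean_geometry.
Context {R : realType}.
Variable n : nat.
Implicit Types (x y z c : 'rV[R]_n) (r : R).

Lemma dotC x y : dot x y = dot y x.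
Proof. by apply: eq_bigr => j _; rewrite mulrC. Qed.

Lemma dotDl x y z : dot (x + y) z = dot x z + dot y z.
Proof. by rewrite /dot -big_split; apply: eq_bigr => j _; rewrite mxE mulrDl. Qed.

Lemma dotZl (a : R) x y : dot (a *: x) y = a * dot x y.
Proof. by rewrite /dot mulr_sumr; apply: eq_bigr => j _; rewrite mxE mulrA. Qed.

Lemma dotNl x y : dot (- x) y = - dot x y.
Proof. by rewrite -scaleN1r dotZl mulN1r. Qed.

Lemma dotDr x y z : dot z (x + y) = dot z x + dot z y.
Proof. by rewrite dotC dotDl !(dotC z). Qed.

Lemma dotZr (a : R) x y : dot x (a *: y) = a * dot x y.
Proof. by rewrite dotC dotZl dotC. Qed.

Lemma dotNr x y : dot x (- y) = - dot x y.
Proof. by rewrite dotC dotNl dotC. Qed.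

Lemma dot_ge0 x : 0 <= dot x x.
Proof. by rewrite dotE_sum_sqr sumr_ge0// => j _; rewrite sqr_ge0. Qed.

Lemma dot_eq0 x : dot x x = 0 -> x = 0.
Proof.
rewrite dotE_sum_sqr => /eqP; rewrite psumr_eq0 => [/allP h|j _]; last exact: sqr_ge0.
apply/rowP => j; rewrite mxE; apply/eqP; rewrite -sqrf_eq0.
by apply: (implyP (h j _)) => //; rewrite mem_index_enum.
Qed.

Lemma dot_le_enorm x y : dot x y <= enorm x * enorm y.
Proof.
have [->|y0] := eqVneq y 0.
  have -> : dot x 0 = 0 by rewrite -(scale0r 0) dotZr mul0r.
  by rewrite mulr_ge0// enorm_ge0.
have Y0 : 0 < dot y y.
  by rewrite lt_neqAle dot_ge0 andbT eq_sym; apply: contra_neq y0; exact: dot_eq0.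
apply: le_trans (ler_norm _) _.
rewrite -sqrtrM ?dot_ge0// -sqrtr_sqr ler_sqrt ?mulr_ge0 ?dot_ge0//.
have := dot_ge0 (x - (dot x y / dot y y) *: y).
rewrite !(dotDl, dotDr, dotNl, dotNr, dotZl, dotZr) (dotC y x).
set X := dot x x; set Y := dot y y in Y0 *; set P := dot x y.
rewrite (_ : X - _ + _ = X - P ^+ 2 / Y); last by field; rewrite gt_eqF.
by rewrite subr_ge0 ler_pdivrMr.
Qed.

Lemma enormD x y : enorm (x + y) <= enorm x + enorm y.
Proof.
rewrite -(@ler_pXn2r _ 2)// ?nnegrE ?addr_ge0 ?enorm_ge0// sqrrD.
have E z : enorm z ^+ 2 = dot z z by rewrite sqr_sqrtr// dot_ge0.
rewrite !E dotDl !dotDr (dotC y x).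
have := dot_le_enorm x y; lra.
Qed.

Lemma enormZ (a : R) x : enorm (a *: x) = `|a| * enorm x.
Proof.
by rewrite /enorm dotZl dotZr mulrA -expr2 sqrtrM ?sqr_ge0// sqrtr_sqr.
Qed.

Lemma enormN x : enorm (- x) = enorm x.
Proof. by rewrite -scaleN1r enormZ normrN1 mul1r. Qed.

Lemma enorm_sub x y : enorm (x - y) = enorm (y - x).
Proof. by rewrite -enormN opprB. Qed.

Lemma enorm0 : enorm (0 : 'rV[R]_n) = 0.
Proof. by rewrite -(scale0r 0) enormZ normr0 mul0r. Qed.

Lemma enorm_gt0 x : x != 0 -> 0 < enorm x.
Proof.
move=> x0; rewrite sqrtr_gt0 lt_neqAle dot_ge0 andbT eq_sym.
by apply: contra_neq x0; exact: dot_eq0.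
Qed.

Lemma coord_le_enorm x j : `|x 0 j| <= enorm x.
Proof.
rewrite -sqrtr_sqr ler_sqrt ?dot_ge0// dotE_sum_sqr (bigD1 j)//= lerDl.
by rewrite sumr_ge0// => i _; rewrite sqr_ge0.
Qed.

Lemma enorm_le_sum x : enorm x <= \sum_j `|x 0 j|.
Proof.
have S0 : 0 <= \sum_j `|x 0 j| by rewrite sumr_ge0.
rewrite -[leRHS]ger0_norm// -sqrtr_sqr ler_sqrt ?sqr_ge0// dotE_sum_sqr expr2 mulr_suml.
apply: ler_sum => j _; rewrite -real_normK ?num_real// expr2 ler_wpM2l//.
by rewrite (bigD1 j)//= lerDl sumr_ge0.
Qed.

Lemma enorm_le_cube x (d : R) : (forall j, `|x 0 j| <= d) -> enorm x <= n%:R * d.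
Proof.
move=> h; apply: le_trans (enorm_le_sum x) _.
apply: le_trans (ler_sum _ (fun j _ => h j)) _.
by rewrite sumr_const card_ord mulr_natl.
Qed.

Definition ecball c r : set 'rV[R]_n := [set y | enorm (y - c) <= r].

Lemma enorm_continuous c : continuous (fun y => enorm (y - c)).
Proof.
have gF : flat_generated (fun y : 'rV[R]_n => \sum_j (y 0 j - c 0 j) ^+ 2).
  apply: flat_generated_sum => j; under eq_fun do rewrite expr2.
  by apply: flat_generatedM; apply: flat_generatedD;
    try exact: flat_generated_coord; exact: flat_generated_cst.
rewrite (_ : (fun _ => _) = Num.sqrt \o (fun y => \sum_j (y 0 j - c 0 j) ^+ 2)).
  move=> y; apply: continuous_comp; last exact: sqrt_continuous.
  exact/differentiable_continuous/flat_generated_differentiable.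
apply/funext => y; rewrite /enorm dotE_sum_sqr /=; congr Num.sqrt.
by apply: eq_bigr => j _; rewrite !mxE.
Qed.

Lemma eball_open c r : open (eball c r).
Proof.
apply: (@open_comp _ _ (fun y : 'rV[R]_n => enorm (y - c)) [set y | y < r]);
  [by move=> y _; exact: enorm_continuous|exact: open_lt].
Qed.

Lemma ecball_closed c r : closed (ecball c r).
Proof.
apply: (@closed_comp _ _ (fun y : 'rV[R]_n => enorm (y - c)) [set y | y <= r]);
  [by move=> y _; exact: enorm_continuous|exact: closed_le].
Qed.

Lemma ecball_compact c r : compact (ecball c r).
Proof.
apply: bounded_closed_compact; last exact: ecball_closed.
exists (enorm c + r); split; first exact: num_real.
move=> M hM y /= yr; apply: le_trans (ltW hM).
rewrite [leLHS]mx_normrE; apply/bigmax_leP; split.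
  by rewrite addr_ge0 ?enorm_ge0// (le_trans (enorm_ge0 _) yr).
move=> [i j] _ /=; rewrite (ord1 i); apply: le_trans (coord_le_enorm y j) _.
by rewrite -{1}(subrK c y) addrC; apply: le_trans (enormD _ _) _; rewrite lerD2l.
Qed.

Lemma eball_sub_ecball c r : eball c r `<=` ecball c r.
Proof. by move=> y /ltW. Qed.

Lemma ecball_sub_eball c c' r r' : enorm (c' - c) + r' < r -> ecball c' r' `<=` eball c r.
Proof.
move=> h y /= yr; rewrite /eball/=; apply: le_lt_trans h.
rewrite -(subrK c' y) -addrA; apply: le_trans (enormD _ _) _.
by rewrite [leRHS]addrC lerD2r.
Qed.

Lemma measurable_eball c r : measurable (eball c r).
Proof. by apply: open_measurable_rV; exact: eball_open. Qed.

Lemma measurable_eball_Rn c r : measurable (eball c r : set (Rn R n)).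
Proof. by apply: measurable_Rn; exact: measurable_eball. Qed.

Lemma closed_measurable_rV (A : set 'rV[R]_n) : closed A -> measurable A.
Proof.
by move=> cA; rewrite -[A]setCK; apply: measurableC; apply: open_measurable_rV; exact: closed_openC.
Qed.

Lemma compact_measurable_rV (A : set 'rV[R]_n) : compact A -> measurable A.
Proof. by move=> cA; apply: closed_measurable_rV; exact: compact_closed. Qed.

Lemma continuous_measurable_rV (u : 'rV[R]_n -> R) : continuous u -> measurable_fun setT u.
Proof.
move=> cu; apply: (measurability _ (RGenOInfty.measurableE R)) => //.
move=> _ [_ [c ->] <-]; rewrite setTI; apply: open_measurable_rV.
by apply: open_comp => //; exact: interval_open.
Qed.

Lemma nbhs_eball (U : set 'rV[R]_n) x : open U -> U x ->
  exists2 r, 0 < r & eball x r `<=` U.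
Proof.
move=> oU Ux; have /nbhs_ballP[e /= e0 sub] := oU _ Ux.
exists e => // y yx; apply: sub; rewrite -ball_normE/= [ltLHS]mx_normrE.
apply: (@le_lt_trans _ _ (enorm (y - x))) => //.
apply/bigmax_leP; split; first exact: enorm_ge0.
move=> [i j] _ /=; rewrite (ord1 i); apply: le_trans (coord_le_enorm _ j) _.
by rewrite enorm_sub.
Qed.

Lemma borel_lebesgue_eball c r :
  borel_lebesgue (eball c r) = borel_lebesgue (eball (0 : 'rV[R]_n) r).
Proof.
rewrite -(borel_lebesgue_translate (- c) (measurable_eball 0 r)); congr borel_lebesgue.
by apply/seteqP; split => y; rewrite /eball/= subr0.
Qed.

Lemma borel_lebesgue_eball_lty c r : (borel_lebesgue (eball c r) < +oo)%E.
Proof.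
apply: (@le_lt_trans _ _ (borel_lebesgue (obox (\row_j (c 0 j - (`|r| + 1))) (\row_j (c 0 j + (`|r| + 1)))))).
  apply: le_measure; rewrite ?inE; [exact: measurable_eball|exact: measurable_obox|].
  move=> y /= yr j; have := coord_le_enorm (y - c) j.
  have := ler_norm r; move: yr; rewrite /eball /= !mxE => h1 h2 h3.
  by move: (le_lt_trans h3 h1); rewrite ltr_norml => /andP[h4 h5]; apply/andP; split; lra.
by rewrite [X in (X < _)%E]borel_lebesgue_obox ltry.
Qed.

Lemma borel_lebesgue_eball_ge c r : 0 < r -> (0 < n)%N ->
  (((r / n%:R) ^+ n)%:E <= borel_lebesgue (eball c r))%E.
Proof.
move=> r0 n0; have nr0 : 0 < n%:R :> R by rewrite ltr0n.
(* The cube of half-side d lies in the ball, since the norm there is at most n d = r / 2; its side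
   is r / n. Only the order r^n of the volume matters. *)
set d := r / (2 * n%:R); have d0 : 0 < d by rewrite divr_gt0// mulr_gt0.
apply: (@le_trans _ _ (borel_lebesgue (obox (\row_j (c 0 j - d)) (\row_j (c 0 j + d))))).
  rewrite [leRHS]borel_lebesgue_obox lee_fin.
  under eq_bigr => j _.
    rewrite !mxE (_ : Num.max _ _ = r / n%:R); last first.
      rewrite (_ : _ - _ = r / n%:R); last by rewrite /d; field; rewrite gt_eqF.
      by apply/max_idPr; rewrite ltW// divr_gt0.
    over.
  by rewrite prodr_const card_ord.
apply: le_measure; rewrite ?inE; [exact: measurable_obox|exact: measurable_eball|].
move=> y h; apply: le_lt_trans (@enorm_le_cube (y - c) d _) _.
  move=> j; have := h j; rewrite !mxE => /andP[h1 h2].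
  by rewrite ler_norml; apply/andP; split; lra.
rewrite /d mulrC -ltr_pdivlMr//.
by rewrite ltr_pM2l// ltf_pV2 ?posrE ?mulr_gt0// ltr_pMl// ltr1n.
Qed.

Lemma ball_bump_test_function (Omega : set 'rV[R]_n) k c r : 0 < r ->
  ecball c r `<=` Omega -> test_function Omega (ball_bump k c r).
Proof.
move=> r0 sub.
have sup : Defs.support (ball_bump k c r) `<=` ecball c r.
  rewrite /Defs.support ((closure_id (ecball c r)).1 (@ecball_closed c r)).
  apply: closure_subset => y /= /eqP y0; apply: contrapT => h; apply: y0.
  by apply: ball_bump_out => // h'; apply: h; exact: eball_sub_ecball.
split; first exact/flat_generated_smooth/flat_generated_ball_bump.
  by apply: subclosed_compact (@ecball_compact c r) sup; exact: closed_closure.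
exact: subset_trans sub.
Qed.

Lemma ball_bump_partial_out k c r j y : 0 < r -> ~ ecball c r y -> partial j (ball_bump k c r) y = 0.
Proof.
move=> r0 yr; rewrite /partial.
transitivity ('D_(delta_mx 0 j) (cst 0 : 'rV[R]_n -> R) y); last exact: derive_cst.
apply: near_eq_derive; have oC := closed_openC (@ecball_closed c r).
near=> z; apply: ball_bump_out => // h.
have : (~` ecball c r) z by near: z; exact: oC.
by apply; exact: eball_sub_ecball.
Unshelve. all: by end_near. Qed.

End euclidean_geometry.

(** * Increments of ball integrals when the centre moves along a line *)

Section moving_bump.
Context {R : realType}.
Variable n : nat.
Implicit Types (u : 'rV[R]_n -> R).

Lemma derive_translate u (a v x : 'rV[R]_n) :
  'D_v (fun y => u (y - a)) x = 'D_v u (x - a).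
Proof.
have E : (fun h : R => h^-1 *: (((fun y => u (y - a)) \o shift x) (h *: v) - u (x - a))) =
         (fun h : R => h^-1 *: ((u \o shift (x - a)) (h *: v) - u (x - a))).
  by apply/funext => h /=; rewrite addrA.
by rewrite /derive E.
Qed.

(** Moving the centre by t nu amounts to differentiating in direction -nu; this trades the
    t-derivative for the space derivatives that the weak formulation handles. *)
Lemma is_derive_moving u (nu y : 'rV[R]_n) (t : R) : differentiable u (y - t *: nu) ->
  is_derive t 1 (fun s : R => u (y - s *: nu)) (- \sum_j nu 0 j * partial j u (y - t *: nu)).
Proof.
move=> du; set z := y - t *: nu in du *.
have E : (fun h : R => h^-1 *: (((fun s : R => u (y - s *: nu)) \o shift t) (h *: 1) - u z)) =
         (fun h : R => h^-1 *: ((u \o shift z) (h *: - nu) - u z)).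
  apply/funext => h /=; congr (_ *: (u _ - _)).
  have -> : h *: (1 : R) = h by rewrite /GRing.scale/= mulr1.
  by rewrite /z scalerDl opprD scalerN addrCA.
apply: DeriveDef.
  have := @diff_derivable _ _ _ u z (- nu) du.
  by rewrite /derivable E.
rewrite /derive E -[LHS]/('D_(- nu) u z) deriveE// linearN/= -deriveE//.
by rewrite deriveE_partial.
Qed.

Lemma continuous_bounded_on u (K : set 'rV[R]_n) : compact K -> continuous u ->
  exists2 C : R, 0 <= C & forall x, K x -> `|u x| <= C.
Proof.
move=> cK cu.
have [M [_ hM]] : bounded_set (u @` K).
  by apply: compact_bounded; apply: continuous_compact => //; exact: continuous_subspaceT.
exists (`|M| + 1); first by rewrite addr_ge0.
move=> x Kx; apply: hM; last by exists x.
by rewrite (le_lt_trans (ler_norm M))// ltrDl.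
Qed.

Lemma integrable_mul_bounded (K : set (Rn R n)) (g h : 'rV[R]_n -> R) (C : R) :
  measurable K -> (leb n).-integrable K (EFin \o g) ->
  measurable_fun K (h : Rn R n -> R) -> (forall x, K x -> `|h x| <= C) ->
  (leb n).-integrable K (EFin \o (fun y => g y * h y)).
Proof.
move=> mK ig mh hC.
(* K may be empty, and then nothing forces C >= 0. *)
have C0 : 0 <= Num.max C 0 by rewrite le_max lexx orbT.
apply: (@le_integrable _ _ _ _ _ mK _ (fun x => ((Num.max C 0) * g x)%:E)).
- apply/measurable_EFinP; apply: measurable_funM => //.
  by apply/measurable_EFinP; exact: (measurable_int _ ig).
- move=> x Kx /=; rewrite lee_fin !normrM (ger0_norm C0) mulrC ler_wpM2r//.
  by rewrite le_max hC.
- by have := integrableZl mK (Num.max C 0) ig.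
Qed.

End moving_bump.

Section increment.
Context {R : realType}.
Variables (n : nat) (Omega K : set 'rV[R]_n) (g w : 'rV[R]_n -> R) (nu c : 'rV[R]_n).
Variables (r a b e : R).
Hypotheses (cK : compact K) (KO : K `<=` Omega).
Hypotheses (ig : (leb n).-integrable K (EFin \o g)) (iw : (leb n).-integrable K (EFin \o w)).
Hypotheses (r0 : 0 < r) (ab : a < b) (e0 : 0 < e).
Hypothesis tube : forall t : R, a - e < t < b + e -> ecball (c + t *: nu) r `<=` K.
Hypothesis weak : forall phi, test_function Omega phi ->
  \int[leb n]_(x in Omega) (g x * \sum_j nu 0 j * partial j phi x) =
  - \int[leb n]_(x in Omega) (w x * phi x).

Let mK : measurable (K : set (Rn R n)).
Proof. by apply: measurable_Rn; exact: compact_measurable_rV. Qed.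

Let phi k t := ball_bump k (c + t *: nu) r.

Let phiE k t y : phi k t y = ball_bump k c r (y - t *: nu).
Proof. exact: ball_bump_translate. Qed.

Let diff_phi k t y : differentiable (phi k t) y.
Proof. exact/flat_generated_differentiable/flat_generated_ball_bump. Qed.

Let cont_phi k t : continuous (phi k t).
Proof. by move=> y; exact/differentiable_continuous. Qed.

Let mphi k t : measurable_fun (K : set (Rn R n)) (phi k t : Rn R n -> R).
Proof.
have h := continuous_measurable_rV (@cont_phi k t).
have h' := measurable_fun_Rn measurableT h.
exact: measurable_funTS h'.
Qed.

Let norm_phi k t y : `|phi k t y| <= 1.
Proof. by rewrite ger0_norm ?ball_bump_ge0// ball_bump_le1. Qed.

Let dphi k t y := \sum_j nu 0 j * partial j (phi k t) y.

Let dphiE k t y : dphi k t y = \sum_j nu 0 j * partial j (ball_bump k c r) (y - t *: nu).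
Proof.
apply: eq_bigr => j _; congr (_ * _); rewrite /partial.
rewrite (_ : phi k t = fun y => ball_bump k c r (y - t *: nu)).
  exact: derive_translate.
by apply/funext => z; exact: phiE.
Qed.

Let integral_sub (h : 'rV[R]_n -> R) : (forall y, ~ K y -> h y = 0) ->
  \int[leb n]_(x in Omega) h x = \int[leb n]_(x in K) h x.
Proof.
move=> h0; rewrite [LHS]Rintegral_mkcond [RHS]Rintegral_mkcond.
apply: eq_Rintegral => y _; rewrite !patchE.
case: (boolP (y \in K)) => [/set_mem Ky|].
  by rewrite mem_set//; exact: KO.
by rewrite notin_setE => /h0 ->; case: ifP.
Qed.

(** Differentiation under the integral gives minus the integral of g times the nu-derivative of the
    bump, and the weak formulation turns this into the integral of w times the bump. *)
Let moving_derive k (t : R) : a - e < t < b + e ->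
  derivable (fun s => \int[leb n]_(y in K) (g y * phi k s y)) t 1 /\
  derive1 (fun s => \int[leb n]_(y in K) (g y * phi k s y)) t =
    \int[leb n]_(y in K) (w y * phi k t y).
Proof.
move=> tI.
have It : `](a - e), (b + e)[%classic t by rewrite /= in_itv.
pose f s y := g y * phi k s y.
have if_ s : (leb n).-integrable K (EFin \o f s).
  by apply: integrable_mul_bounded (mphi k s) _ => // x _; exact: norm_phi.
have df (s : R) y : is_derive s (1 : R) (fun s' : R => f s' y) (- (g y * dphi k s y)).
  have h := @is_derive_moving R n (ball_bump k c r) nu y s
    (flat_generated_differentiable _ (@flat_generated_ball_bump R n k c r)).
  have hZ := is_deriveZ (g y) h.
  rewrite (_ : (fun s' : R => f s' y) = g y \*: (fun s : R => ball_bump k c r (y - s *: nu))); last first.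
    by apply/funext => s'; rewrite /f phiE.
  by apply: is_derive_eq hZ _; rewrite dphiE /GRing.scale/= mulrN.
(* T bounds the parameter s, so for y in K the points y - s nu stay in one compact ball; the
   gradient of the bump is bounded there, which gives the domination. *)
pose T := Num.max `|a - e| `|b + e|.
have [B /= B0 hB] : exists2 B : R, 0 <= B & forall y, K y -> enorm (y - 0) <= B.
  by have [B ? hB] := continuous_bounded_on cK (@enorm_continuous R n 0); exists B => // y /hB;
    apply: le_trans; exact: ler_norm.
pose D y := \sum_j nu 0 j * partial j (ball_bump k c r) y.
have cD : continuous D.
  move=> y; apply/differentiable_continuous/flat_generated_differentiable.
  apply: flat_generated_sum => j; apply: flat_generatedM; first exact: flat_generated_cst.
  exact/flat_generated_partial/flat_generated_ball_bump.
have [C C0 hC] := continuous_bounded_on (@ecball_compact R n 0 (B + T * enorm nu)) cD.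
have dphi_bd' (s : R) y : `](a - e), (b + e)[%classic s -> K y -> `|dphi k s y| <= C.
  rewrite /= in_itv/= => /andP[s1 s2] Ky; rewrite dphiE.
  apply: hC; rewrite /ecball/= subr0; apply: le_trans (enormD _ _) _.
  apply: lerD; first by have := hB y Ky; rewrite subr0.
  rewrite enormN enormZ ler_wpM2r ?enorm_ge0// ler_norml.
  have h1 : `|a - e| <= T by rewrite /T le_max lexx.
  have h2 : `|b + e| <= T by rewrite /T le_max lexx orbT.
  move: h1 h2; rewrite !ler_norml => /andP[h1 _] /andP[_ h2].
  by apply/andP; split; lra.
have bd (s : R) y : `](a - e), (b + e)[%classic s -> K y -> `|partial1of2 f s y| <= C * `|g y|.
  move=> sI Ky; rewrite /partial1of2 derive1E.
  by have [_ ->] := df s y; rewrite normrN normrM mulrC ler_wpM2r// dphi_bd'.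
have dphi_bd y : K y -> `|dphi k t y| <= C by move=> Ky; exact: dphi_bd'.
have icg : (leb n).-integrable K (EFin \o (fun y => C * `|g y|)).
  have := integrableZl mK C (integrable_abse ig).
  by [].
have Cg0 y : 0 <= C * `|g y| by rewrite mulr_ge0.
split.
  apply: (derivable_under_integral mK It (fun s _ => if_ s)
    (fun s y _ _ => let: @DeriveDef _ _ _ _ _ _ _ h _ := df s y in h) Cg0 icg bd).
rewrite (differentiation_under_integral mK It (fun s _ => if_ s)
    (fun s y _ _ => let: @DeriveDef _ _ _ _ _ _ _ h _ := df s y in h) Cg0 icg bd).
have test : test_function Omega (phi k t).
  by apply: ball_bump_test_function => //; apply: subset_trans KO; exact: tube.
have out y : ~ K y -> ~ ecball (c + t *: nu) r y by move=> nK /(tube tI).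
have := weak test; rewrite !integral_sub; last 2 first.
- move=> y /out nK; rewrite /phi ball_bump_out ?mulr0// => h.
  by apply: nK; exact: eball_sub_ecball.
- move=> y /out nK; rewrite big1 ?mulr0// => j _.
  by rewrite /phi ball_bump_partial_out// mulr0.
move=> /(congr1 (@GRing.opp R)); rewrite opprK => <-.
rewrite -mulN1r -RintegralZl//; last first.
  have cd : continuous (fun y => \sum_j nu 0 j * partial j (phi k t) y).
    move=> y; apply/differentiable_continuous/flat_generated_differentiable.
    apply: flat_generated_sum => j; apply: flat_generatedM; first exact: flat_generated_cst.
    exact/flat_generated_partial/flat_generated_ball_bump.
  have md := measurable_fun_Rn measurableT (continuous_measurable_rV cd).
  exact: (integrable_mul_bounded mK ig (measurable_funTS md) dphi_bd).
apply: eq_Rintegral => y _; rewrite /partial1of2 derive1E.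
by have [_ ->] := df t y; rewrite mulN1r.
Qed.

Let moving_continuous k :
  {in `](a - e), (b + e)[%classic, continuous (fun t => \int[leb n]_(y in K) (w y * phi k t y))}.
Proof.
pose f (s : R) y := w y * phi k s y.
have iw' : (leb n).-integrable K (EFin \o (fun y => `|w y|)) by exact: integrable_abse iw.
have if_ s : `](a - e), (b + e)[%classic s -> (leb n).-integrable K (EFin \o f s).
  by move=> _; apply: integrable_mul_bounded (mphi k s) _ => // x _; exact: norm_phi.
have cf : {ae leb n, forall y, K y -> {in `](a - e), (b + e)[%classic, continuous (f ^~ y)}}.
  apply: aeW => y _ s _.
  have hc : {for s, continuous (fun s' : R => phi k s' y)}.
    apply/differentiable_continuous/derivable1_diffP.
    have h := @is_derive_moving R n (ball_bump k c r) nu y s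
      (flat_generated_differentiable _ (@flat_generated_ball_bump R n k c r)).
    rewrite (_ : (fun s' => phi k s' y) = (fun s' : R => ball_bump k c r (y - s' *: nu))).
      by case: h.
    by apply/funext => s'; exact: phiE.
  exact: (cvgM (cvg_cst (w y)) hc).
have fw s : `](a - e), (b + e)[%classic s -> {ae leb n, forall y, K y -> `|f s y| <= `|w y|}.
  move=> _; apply: aeW => y _; rewrite /f normrM.
  by rewrite -[leRHS]mulr1 ler_wpM2l.
exact: (continuity_under_integral mK if_ cf iw' fw).
Qed.

Let moving_increment k (M : measurableTypeR R -> \bar R) :
  measurable_fun (`[a, b]%classic : set (measurableTypeR R)) M ->
  (forall t : R, a <= t <= b -> (\int[leb n]_(y in eball (c + t *: nu) r) `|w y|%:E <= M t)%E) ->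
  (`|\int[leb n]_(y in K) (g y * phi k b y) - \int[leb n]_(y in K) (g y * phi k a y)|%:E
   <= \int[lebesgue_measure]_(t in `[a, b]) M t)%E.
Proof.
move=> mM hM.
pose F t := \int[leb n]_(y in K) (g y * phi k t y).
pose F' t := \int[leb n]_(y in K) (w y * phi k t y).
have inI (t : R) : a <= t <= b -> a - e < t < b + e.
  by move=> /andP[t1 t2]; rewrite ltrBlDr (le_lt_trans t1) ?ltrDl// (le_lt_trans t2) ?ltrDl.
have dF (t : R) : a <= t <= b -> derivable F t 1.
  by move=> /inI tI; have [] := @moving_derive k t tI.
have cF (t : R) : a <= t <= b -> {for t, continuous F}.
  by move=> h; apply/differentiable_continuous/derivable1_diffP/dF.
have cF' (t : R) : a <= t <= b -> {for t, continuous F'}.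
  by move=> /inI tI; apply: moving_continuous; rewrite inE/= in_itv.
have cF'w : {within `[a, b], continuous F'}.
  by apply: continuous_in_subspaceT => t; rewrite inE/= in_itv/=; exact: cF'.
have FTC := @continuous_FTC2 R F' F a b ab cF'w.
have {}FTC : (\int[lebesgue_measure]_(t in `[a, b]) (F' t)%:E = (F b)%:E - (F a)%:E)%E.
  apply: FTC.
  - split.
    + by move=> t; rewrite in_itv/= => /andP[/ltW ? /ltW ?]; apply: dF; apply/andP.
    + by apply: cvg_at_right_filter; apply: cF; rewrite lexx ltW.
    + by apply: cvg_at_left_filter; apply: cF; rewrite lexx ltW.
  - move=> t; rewrite in_itv/= => /andP[/ltW ? /ltW ?].
    by have [|_ ->] := @moving_derive k t; first by apply: inI; apply/andP.
rewrite -abse_EFin EFinB -FTC.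
have mI : measurable (`[a, b]%classic : set (measurableTypeR R)) by [].
have mF' : measurable_fun (`[a, b]%classic : set (measurableTypeR R)) (EFin \o F').
  apply/measurable_EFinP; exact: subspace_continuous_measurable_fun.
apply: le_trans (le_abse_integral _ mI mF') _.
apply: ge0_le_integral => //.
- exact: measurableT_comp mF'.
- move=> t; rewrite /= in_itv/= => tab; have tI := inI t tab.
  have iwp : (leb n).-integrable K (EFin \o (fun y => w y * phi k t y)).
    by apply: integrable_mul_bounded (mphi k t) _ => // x _; exact: norm_phi.
  apply: le_trans (hM t tab).
  have sub : eball (c + t *: nu) r `<=` K.
    by apply: subset_trans (tube tI); exact: eball_sub_ecball.
  rewrite /= EFin_normr_Rintegral//.
  apply: le_trans (le_abse_integral (leb n) mK (measurable_int _ iwp)) _.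
  rewrite [leRHS](_ : _ = \int[leb n]_(y in K) ((fun y => `|w y|%:E) \_ (eball (c + t *: nu) r)) y)%E; last first.
    by rewrite -integral_mkcondr setIidr.
  apply: ge0_le_integral.
  + exact: mK.
  + by [].
  + by apply: measurableT_comp; [|exact: measurable_int iwp].
  + apply/measurable_restrict => //; first exact: measurable_eball_Rn.
    rewrite setIidr//; apply/measurable_EFinP; apply: measurableT_comp => //.
    have mw : measurable_fun (K : set (Rn R n)) (w : Rn R n -> R).
      by apply/measurable_EFinP; exact: measurable_int iw.
    exact: (measurable_funS mK sub mw).
  + move=> y Ky /=; rewrite patchE; case: (boolP (y \in _)) => [yB|].
      rewrite lee_fin normrM; by rewrite -[leRHS]mulr1 ler_wpM2l.
    by rewrite notin_setE => h; rewrite /phi ball_bump_out// mulr0 normr0.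
Qed.

Let cvg_moving (t : R) : a <= t <= b ->
  \int[leb n]_(y in K) (g y * phi k t y) @[k --> \oo] -->
  \int[leb n]_(y in eball (c + t *: nu) r) g y.
Proof.
move=> /andP[at_ tb].
have sub : eball (c + t *: nu) r `<=` K.
  apply: subset_trans (tube (t := t) _); first exact: eball_sub_ecball.
  by rewrite ltrBlDr (le_lt_trans at_) ?ltrDl// (le_lt_trans tb) ?ltrDl.
have igp k : (leb n).-integrable K (EFin \o (fun y => g y * phi k t y)).
  by apply: integrable_mul_bounded (mphi k t) _ => // x _; exact: norm_phi.
have igB : (leb n).-integrable (eball (c + t *: nu) r) (EFin \o g).
  exact: (integrableS mK (@measurable_eball_Rn _ _ _ _) sub ig).
apply: fine_cvg; rewrite fineK; last exact: (integrable_fin_num (@measurable_eball_Rn _ _ _ _) igB).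
rewrite (_ : (\int[leb n]_(y in eball (c + t *: nu) r) (g y)%:E)%E =
   (\int[leb n]_(y in K) ((EFin \o g) \_ (eball (c + t *: nu) r)) y)%E); last first.
  by rewrite -integral_mkcondr setIidr.
apply: (@dominated_cvg _ _ _ _ _ mK _ _ (fun y => `|g y|%:E)) => //.
- by move=> k; exact: measurable_int (igp k).
- move=> y Ky; rewrite patchE.
  rewrite (_ : (if _ then _ else _) = (g y * \1_(eball (c + t *: nu) r) y)%:E); last first.
    by rewrite indicE; case: ifP => _; rewrite ?mulr1 ?mulr0.
  apply: cvg_EFin; first exact: nearW.
  by apply: cvgM; [exact: cvg_cst|exact: cvg_ball_bump].
- exact: integrable_abse ig.
- move=> k y Ky /=; rewrite lee_fin normrM; by rewrite -[leRHS]mulr1 ler_wpM2l.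
Qed.

(** For each bump the fundamental theorem of calculus gives the bound, as the bump is at most 1 and
    vanishes off the ball; the right side does not depend on k, so the bound survives dominated
    convergence. The margin e makes [a, b] interior to the interval where the derivative formula
    holds. *)
Lemma ball_integral_increment (M : measurableTypeR R -> \bar R) :
  measurable_fun (`[a, b]%classic : set (measurableTypeR R)) M ->
  (forall t : R, a <= t <= b -> (\int[leb n]_(y in eball (c + t *: nu) r) `|w y|%:E <= M t)%E) ->
  (`|\int[leb n]_(y in eball (c + b *: nu) r) g y -
     \int[leb n]_(y in eball (c + a *: nu) r) g y|%:E
   <= \int[lebesgue_measure]_(t in `[a, b]) M t)%E.
Proof.
move=> mM hM; have h k := @moving_increment k M mM hM.
set I := (X in (_ <= X)%E) in h *.
have I0 : (0 <= I)%E by apply: le_trans (h 0%N).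
have [Ifin|] := boolP (I \is a fin_num); last first.
  by rewrite ge0_fin_numE// -leNgt leye_eq => /eqP ->; rewrite leey.
rewrite -(fineK Ifin) lee_fin.
have cv : `|\int[leb n]_(y in K) (g y * phi k b y) - \int[leb n]_(y in K) (g y * phi k a y)|
   @[k --> \oo] --> `|\int[leb n]_(y in eball (c + b *: nu) r) g y -
     \int[leb n]_(y in eball (c + a *: nu) r) g y|.
  by apply: cvg_norm; apply: cvgB; apply: cvg_moving; rewrite lexx ltW.
apply: (cvgr_to_le cv); apply: nearW => k.
by rewrite -lee_fin fineK.
Qed.

End increment.

(** * The mass of tubes around lines *)

Section integral_density.
Context {R : realType}.

Definition cube n (z : 'rV[R]_n) (r : R) : set 'rV[R]_n :=
  [set z' : 'rV[R]_n | forall j, `|z' 0 j - z 0 j| <= r].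

Lemma density_finite_integral n (F : 'rV[R]_n -> \bar R) :
  measurable_fun setT F -> (forall z, 0 <= F z)%E ->
  (\int[@borel_lebesgue R n]_z F z < +oo)%E ->
  exists N : set 'rV[R]_n, [/\ measurable N, borel_lebesgue N = 0%E &
    forall z : 'rV[R]_n, ~ N z -> exists C : R, 0 <= C /\ forall r : R, 0 < r ->
      (\int[@borel_lebesgue R n]_(z' in cube z r) F z' <= (C * r ^+ n)%:E)%E].
Proof.
move=> mF F0 Ffin.
pose nu A := (\int[@borel_lebesgue R n]_(z in A) F z)%E.
have nu0 : nu set0 = 0%E by rewrite /nu integral_set0.
have nuge0 A : (0 <= nu A)%E by exact: integral_ge0.
have nuadd : semi_sigma_additive nu by exact: semi_sigma_additive_nng_induced.
pose h := isMeasure.Build _ _ _ nu nu0 nuge0 nuadd.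
pose mu : {measure set 'rV[R]_n -> \bar R} := HB.pack nu h.
exact: (@density_finite R n mu Ffin).
Qed.

End integral_density.

Section tube.
Context {R : realType}.
Notation lam := (@lebesgue_measure R).
Variables (m : nat) (i : 'I_m.+1) (nu : 'rV[R]_m.+1).
Hypothesis nui : nu 0 i = 1.
Notation BL n := (@borel_lebesgue R n).

Lemma ge0_integral_line_map (f : 'rV[R]_m.+1 -> \bar R) :
  measurable_fun setT f -> (forall x, 0 <= f x)%E ->
  (\int[BL m.+1]_y f y = \int[BL m \x lam]_p f (line_map i nu p))%E.
Proof.
move=> mf f0; have mh := measurable_line_map nui.
pose mu : {measure set 'rV[R]_m.+1 -> \bar R} :=
  measure_function_pushforward__canonical__measure_function_Measure
    (BL m \x lam)%E mh.
transitivity (\int[mu]_y f y)%E.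
  apply: eq_measure_integral => A mA _.
  by apply/esym; exact: line_map_measure.
by rewrite /mu/= (ge0_integral_pushforward mh).
Qed.

Variable H : 'rV[R]_m.+1 -> \bar R.
Hypotheses (mH : measurable_fun setT H) (H0 : forall x, (0 <= H x)%E).

Let mHl : measurable_fun setT (fun p => H (line_map i nu p)).
Proof. exact: (measurableT_comp mH (measurable_line_map nui)). Qed.

Definition line_integral (z : 'rV[R]_m) : \bar R := (\int[lam]_t H (line_map i nu (z, t)))%E.

Lemma measurable_line_integral : measurable_fun setT line_integral.
Proof. by apply: (measurable_fun_fubini_tonelli_F _ mHl). Qed.

Lemma line_integral_ge0 z : (0 <= line_integral z)%E.
Proof. exact: integral_ge0. Qed.

Lemma integral_line_integral : (\int[BL m]_z line_integral z = \int[BL m.+1]_y H y)%E.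
Proof.
rewrite ge0_integral_line_map//.
by rewrite (fubini_tonelli1 _ mHl).
Qed.

(** The projection [line_base] expands distances by at most this factor, from the Euclidean norm to
    the sup norm. *)
Let slope : R := 1 + enorm nu.

Lemma eball_line_map z t (r : R) y : eball (line_map i nu (z, t)) r y ->
  cube z (slope * r) (line_base i nu y) /\ `|y 0 i - t| <= r.
Proof.
rewrite /eball /= => h.
have ht : `|y 0 i - t| <= r.
  have := coord_le_enorm (y - line_map i nu (z, t)) i.
  by rewrite 2!mxE (line_map_i nui)/= => /le_trans; apply; exact: ltW.
split => // j; have := coord_le_enorm (y - line_map i nu (z, t)) (lift i j).
have -> : (y - line_map i nu (z, t)) 0 (lift i j) =
    (line_base i nu y 0 j - z 0 j) + (y 0 i - t) * nu 0 (lift i j).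
  by rewrite !mxE !liftK /=; ring.
move=> h1; rewrite -(addrK ((y 0 i - t) * nu 0 (lift i j)) (line_base i nu y 0 j - z 0 j)).
apply: le_trans (ler_normB _ _) _; rewrite /slope [leRHS]mulrDl mul1r.
apply: lerD; first exact: le_trans h1 (ltW h).
rewrite normrM mulrC; apply: ler_pM => //; exact: coord_le_enorm.
Qed.

Let slab (r : R) : set (measurableTypeR R) := [set u | `|u| <= r].

(** The ball around the point of parameter s is enlarged to a set of product type: base point in a
    cube, height within r of s. Integrating over s first then contributes exactly the factor 2 r. *)
Definition tube_indic (z : 'rV[R]_m) (r : R) (sy : measurableTypeR R * 'rV[R]_m.+1) : R :=
  \1_(cube z (slope * r)) (line_base i nu sy.2) * \1_(slab r) (sy.2 0 i - sy.1 : R).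

Definition tube_kernel z r (sy : measurableTypeR R * 'rV[R]_m.+1) : \bar R :=
  (H sy.2 * (tube_indic z r sy)%:E)%E.

Definition tube_mass (z : 'rV[R]_m) (r : R) : measurableTypeR R -> \bar R :=
  fubini_F (BL m.+1) (tube_kernel z r).

Let mslab (r : R) : measurable (slab r).
Proof.
rewrite (_ : slab r = `[- r, r]%classic); first exact: measurable_itv.
by apply/seteqP; split => u; rewrite /slab /= in_itv/= ler_norml.
Qed.

Let mcube_base z r : measurable_fun setT (fun y => \1_(cube z r) (line_base i nu y) : R).
Proof.
apply: (measurableT_comp (f := \1_(cube z r) : 'rV[R]_m -> R)).
  by apply: measurable_indic; exact: measurable_cube.
exact: measurable_line_base.
Qed.

Let mtube z r : measurable_fun setT (tube_indic z r).
Proof.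
apply: measurable_funM.
  exact: (measurableT_comp (mcube_base z (slope * r)) measurable_snd).
apply: (measurableT_comp (f := \1_(slab r) : measurableTypeR R -> R)).
  by apply: measurable_indic; exact: mslab.
apply: (@measurable_funB _ _ R) => //.
exact: (measurableT_comp (measurable_coord i) measurable_snd).
Qed.

Let tube_ge0 z r sp : 0 <= tube_indic z r sp.
Proof. by rewrite mulr_ge0. Qed.

Let mkernel z r : measurable_fun setT (tube_kernel z r).
Proof.
apply: emeasurable_funM; first exact: (measurableT_comp mH measurable_snd).
by apply/measurable_EFinP; exact: mtube.
Qed.

Let kernel_ge0 z r sp : (0 <= tube_kernel z r sp)%E.
Proof. by rewrite mule_ge0// lee_fin tube_ge0. Qed.

Lemma measurable_tube_mass z r : measurable_fun setT (tube_mass z r).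
Proof.
exact: (@measurable_fun_fubini_tonelli_F _ _ _ _ R (BL m.+1) (tube_kernel z r)
  (mkernel z r) (kernel_ge0 z r)).
Qed.

Lemma tube_mass_ge0 z r s : (0 <= tube_mass z r s)%E.
Proof. by apply: integral_ge0 => y _; exact: kernel_ge0. Qed.

Lemma integral_eball_le_tube_mass z r s :
  (\int[BL m.+1]_(y in eball (line_map i nu (z, s)) r) H y <= tube_mass z r s)%E.
Proof.
have mB := @measurable_eball R m.+1 (line_map i nu (z, s)) r.
rewrite integral_mkcond.
apply: ge0_le_integral.
- exact: measurableT.
- by move=> y _; rewrite patchE; case: ifP.
- by apply/(measurable_restrictT _ mB); exact: measurable_funTS mH.
- exact: (measurableT_comp (mkernel z r) (pair1_measurable s)).
move=> y _; rewrite patchE; case: ifPn => [/set_mem/eball_line_map[hc ht]|_]; last first.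
  exact: kernel_ge0.
rewrite /tube_kernel /tube_indic/= !indicE (mem_set hc).
by rewrite (mem_set (_ : slab r (y 0 i - s)))// !mulr1 mule1.
Qed.

Lemma integral_tube_mass z (r : R) : 0 <= r ->
  (\int[lam]_s tube_mass z r s =
   (2 * r)%:E * \int[BL m]_(z' in cube z (slope * r)) line_integral z')%E.
Proof.
move=> r0.
rewrite [LHS](@fubini_tonelli _ _ _ _ R lam (BL m.+1) (tube_kernel z r) (mkernel z r) (kernel_ge0 z r)).
pose G y : \bar R := (H y * (\1_(cube z (slope * r)) (line_base i nu y))%:E)%E.
have G0 y : (0 <= G y)%E by rewrite mule_ge0// lee_fin.
have mG : measurable_fun setT G.
  by apply: emeasurable_funM => //; apply/measurable_EFinP; exact: mcube_base.
transitivity (\int[BL m.+1]_y ((2 * r)%:E * G y))%E.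
  apply: eq_integral => y _; rewrite /tube_kernel/= /tube_indic/=.
  under eq_integral do rewrite EFinM muleA.
  rewrite ge0_integralZl//; last 2 first.
  - apply/measurable_EFinP.
    apply: (measurableT_comp (f := \1_(slab r) : measurableTypeR R -> R)).
      by apply: measurable_indic; exact: mslab.
    by apply: (@measurable_funB _ _ R).
  - exact: (G0 y).
  rewrite muleC; congr (_ * _)%E.
  transitivity (\int[lam]_s (\1_(`[y 0 i - r, y 0 i + r]%classic) s)%:E)%E.
    apply: eq_integral => s _; congr (EFin (_ %:R)); congr nat_of_bool.
    by apply/idP/idP => /set_mem h; apply/mem_set; move: h;
      rewrite /slab /= in_itv/= -?ler_distl distrC.
  rewrite integral_indic ?setIT// [LHS]lebesgue_measure_itv/= lte_fin.
  case: ltP => h; first by rewrite -EFinB; congr EFin; ring.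
  by congr EFin; apply/eqP; rewrite eq_le; apply/andP; split; lra.
rewrite ge0_integralZl//; last by rewrite lee_fin mulr_ge0.
congr (_ * _)%E; rewrite ge0_integral_line_map//.
have mGl : measurable_fun setT (fun p => G (line_map i nu p)).
  exact: (measurableT_comp mG (measurable_line_map nui)).
rewrite (fubini_tonelli1 _ mGl)// [RHS]integral_mkcond.
apply: eq_integral => z' _; rewrite /fubini_F /G/= patchE.
under eq_integral do rewrite line_baseK//= indicE.
case: ifP => _; first by under eq_integral do rewrite mule1.
by under eq_integral do rewrite mule0; rewrite integral0.
Qed.

End tube.

(** * Hoelder bound for ball averages along almost every line *)

Section line_average.
Context {R : realType}.
Notation lam := (@lebesgue_measure R).
Notation BL n := (@borel_lebesgue R n).

Lemma line_mapE m (i : 'I_m.+1) (nu : 'rV[R]_m.+1) z (t : R) :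
  line_map i nu (z, t) = line_map i nu (z, 0) + t *: nu.
Proof. by rewrite /line_map /= scale0r addr0. Qed.

Lemma powR_add_gt0 (x s t : R) : 0 < x -> x `^ (s + t) = x `^ s * x `^ t.
Proof. by move=> x0; rewrite powRD// (gt_eqF x0) implybT. Qed.

(* This replaces Hoelder's inequality: it is integrated with x = |w| and the
   level k = (b - a)^(-1/q). *)
Lemma le_add_powR (x k q : R) : 0 <= x -> 0 < k -> 1 < q ->
  x <= k + k `^ (1 - q) * x `^ q.
Proof.
move=> x0 k0 q1; have [xk|kx] := leP x k.
  by apply: le_trans xk _; rewrite lerDl mulr_ge0// powR_ge0.
have xpos : 0 < x by exact: lt_trans kx.
apply: (@le_trans _ _ (k `^ (1 - q) * x `^ q)); last by rewrite lerDr ltW.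
have -> : x `^ q = x `^ (q - 1) * x.
  by rewrite -[X in _ * X](powRr1 x0) -powR_add_gt0// subrK.
rewrite mulrA -[leLHS]mul1r ler_wpM2r//.
have E : k `^ (1 - q) * k `^ (q - 1) = 1.
  by rewrite -powR_add_gt0// addrA subrK subrr powRr0.
rewrite -[leLHS]E ler_wpM2l ?powR_ge0// ge0_ler_powR ?nnegrE ?ltW// ?subr_gt0//.
Qed.

(** N depends on H and on the direction only, and C also on the line. One N thus serves all entries
    of Df, and the uniformity in r is what the passage to the limsup requires. *)
Lemma line_average_holder m (i : 'I_m.+1) (nu : 'rV[R]_m.+1) (q : R) (H : 'rV[R]_m.+1 -> \bar R) :
  nu 0 i = 1 -> 1 < q -> measurable_fun setT H -> (forall x, 0 <= H x)%E ->
  (\int[BL m.+1]_y H y < +oo)%E ->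
  exists N : set 'rV[R]_m, [/\ measurable N, borel_lebesgue N = 0%E &
    forall z, ~ N z -> exists C : R, 0 <= C /\
    forall (Omega K : set 'rV[R]_m.+1) (g w : 'rV[R]_m.+1 -> R) (r a b e : R),
      compact K -> K `<=` Omega ->
      (leb m.+1).-integrable K (EFin \o g) -> (leb m.+1).-integrable K (EFin \o w) ->
      0 < r -> a < b -> 0 < e ->
      (forall t : R, a - e < t < b + e -> ecball (line_map i nu (z, t)) r `<=` K) ->
      (forall phi, test_function Omega phi ->
        \int[leb m.+1]_(x in Omega) (g x * \sum_j nu 0 j * partial j phi x) =
        - \int[leb m.+1]_(x in Omega) (w x * phi x)) ->
      (forall x, K x -> ((`|w x| `^ q)%:E <= H x)%E) ->
      `|\int[leb m.+1]_(y in eball (line_map i nu (z, b)) r) g y -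
        \int[leb m.+1]_(y in eball (line_map i nu (z, a)) r) g y| <=
      C * (b - a) `^ (1 - q^-1) * fine (BL m.+1 (eball 0 r))].
Proof.
move=> nui q1 mH H0 Hfin.
have mF := measurable_line_integral nui mH H0.
have F0 := line_integral_ge0 i nu H0.
have Ffin : (\int[BL m]_z line_integral i nu H z < +oo)%E.
  by rewrite integral_line_integral.
have [N [mN N0 hN]] := density_finite_integral mF F0 Ffin.
exists N; split => // z /hN[C0 [C00 hC]].
pose slope : R := 1 + enorm nu.
have slope0 : 0 < slope by rewrite ltr_pwDl// enorm_ge0.
(* The summand 1 comes from the constant level k. The other one is the tube bound 2 r C0 (slope
   r)^m, compared with the volume V of the ball through r^(m+1) <= (m+1)^(m+1) V. *)
exists (1 + 2 * C0 * slope ^+ m * m.+1%:R ^+ m.+1); split.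
  by rewrite addr_ge0// !mulr_ge0// exprn_ge0// ltW.
move=> Omega K g w r a b e cK KO ig iw r0 ab e0 tube weak wH.
set V := fine _.
have VE : BL m.+1 (eball 0 r) = V%:E.
  by rewrite fineK// ge0_fin_numE//; exact: borel_lebesgue_eball_lty.
have V0 : 0 <= V by rewrite fine_ge0.
have rV : r ^+ m.+1 <= m.+1%:R ^+ m.+1 * V.
  have := @borel_lebesgue_eball_ge R m.+1 0 r r0 isT.
  rewrite [X in (_ <= X)%E]VE lee_fin expr_div_n ler_pdivrMr ?exprn_gt0//.
  by rewrite mulrC.
have ba0 : 0 < b - a by rewrite subr_gt0.
have q0 : 0 < q by exact: lt_trans q1.
(* This level balances the two terms: k (b - a) and k^(1 - q) both equal (b - a)^(1 - 1/q). *)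
pose k := (b - a) `^ (- q^-1).
have k0 : 0 < k by rewrite powR_gt0.
have kba : k * (b - a) = (b - a) `^ (1 - q^-1).
  by rewrite [1 - _]addrC powR_add_gt0// powRr1// ltW.
have kq : k `^ (1 - q) = (b - a) `^ (1 - q^-1).
  by rewrite -powRrM; congr (_ `^ _); field; rewrite gt_eqF.
have kq0 : 0 <= k `^ (1 - q) by exact: powR_ge0.
pose M (s : measurableTypeR R) := ((k * V)%:E + (k `^ (1 - q))%:E * tube_mass i nu H z r s)%E.
have mT : measurable_fun setT (tube_mass i nu H z r) by exact: measurable_tube_mass.
have T0 s : (0 <= tube_mass i nu H z r s)%E by exact: tube_mass_ge0.
have mM : measurable_fun (`[a, b]%classic : set (measurableTypeR R)) M.
  apply: emeasurable_funD; first exact: measurable_cst.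
  apply: emeasurable_funM; first exact: measurable_cst.
  exact: measurable_funTS mT.
have tubeE (t : R) : line_map i nu (z, t) = line_map i nu (z, 0%R) + t *: nu by exact: line_mapE.
have tube' (t : R) : a - e < t < b + e -> ecball (line_map i nu (z, 0%R) + t *: nu) r `<=` K.
  by move=> /tube; rewrite tubeE.
have mK : measurable (K : set (Rn R m.+1)).
  by apply: measurable_Rn; exact: compact_measurable_rV.
have hM (t : R) : a <= t <= b ->
    (\int[leb m.+1]_(y in eball (line_map i nu (z, 0%R) + t *: nu) r) `|w y|%:E <= M t)%E.
  move=> /andP[at_ tb]; rewrite -tubeE; set B := eball _ r.
  have sub : B `<=` K.
    apply: subset_trans (tube _ _); first exact: eball_sub_ecball.
    by rewrite ltrBlDr (le_lt_trans at_) ?ltrDl// (le_lt_trans tb) ?ltrDl.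
  have mB : measurable B by exact: measurable_eball.
  have mHB : measurable_fun B H by exact: measurable_funTS mH.
  have mkH : measurable_fun B (fun y => (k%:E + (k `^ (1 - q))%:E * H y)%E).
    apply: emeasurable_funD; first exact: measurable_cst.
    by apply: emeasurable_funM; first exact: measurable_cst.
  have kH0 y : (0 <= k%:E + (k `^ (1 - q))%:E * H y)%E.
    by rewrite adde_ge0 ?mule_ge0// lee_fin ltW.
  apply: (@le_trans _ _ (\int[leb m.+1]_(y in B) (k%:E + (k `^ (1 - q))%:E * H y))%E).
    apply: ge0_le_integral.
    - exact: measurable_Rn.
    - by [].
    - apply/measurable_EFinP; apply: measurableT_comp => //.
      have mw : measurable_fun (K : set (Rn R m.+1)) (w : Rn R m.+1 -> R).
        by apply/measurable_EFinP; exact: measurable_int iw.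
      exact: (measurable_funS mK sub mw).
    - exact: (measurable_fun_Rn mB mkH).
    - move=> y /sub Ky; apply: le_trans (_ : (_ <= k%:E + (k `^ (1 - q))%:E * (`|w y| `^ q)%:E)%E) _.
        by rewrite -EFinM -EFinD lee_fin; exact: le_add_powR.
      by rewrite leeD2l// lee_wpmul2l ?wH.
  rewrite ge0_integral_leb// ge0_integralD//; last 3 first.
  - by move=> y _; rewrite lee_fin ltW.
  - by move=> y _; rewrite mule_ge0.
  - by apply: emeasurable_funM; first exact: measurable_cst.
  rewrite (integral_cst _ mB) ge0_integralZl//.
  rewrite /M; apply: leeD; last first.
    by apply: lee_wpmul2l; [rewrite lee_fin|exact: integral_eball_le_tube_mass].
  by rewrite [X in (_ * X <= _)%E]borel_lebesgue_eball [X in (_ * X <= _)%E]VE EFinM.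
have := @ball_integral_increment R m.+1 Omega K g w nu (line_map i nu (z, 0%R)) r a b e
  cK KO ig iw r0 ab e0 tube' weak M mM hM.
rewrite -!tubeE => inc; rewrite -lee_fin; apply: le_trans inc _.
have mab : measurable (`[a, b]%classic : set (measurableTypeR R)) by exact: measurable_itv.
rewrite /M ge0_integralD//; last 3 first.
- by move=> y _; rewrite lee_fin mulr_ge0// ltW.
- by move=> y _; rewrite mule_ge0.
- by apply: emeasurable_funM; [exact: measurable_cst|exact: measurable_funTS mT].
rewrite (integral_cst _ mab) [X in (_ * X + _)%E]lebesgue_measure_itv/= lte_fin ab -EFinB -EFinM.
rewrite ge0_integralZl//; last exact: measurable_funTS mT.
apply: (@le_trans _ _ ((k * V * (b - a))%:E + (k `^ (1 - q))%:E *
   ((2 * r)%:E * (C0 * (slope * r) ^+ m)%:E))%E).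
  apply: leeD2l; apply: lee_wpmul2l; first by rewrite lee_fin.
  (* Enlarging [a, b] to the whole line is harmless, since the power of b - a already sits in the
     factor k^(1 - q). *)
  apply: (@le_trans _ _ (\int[lam]_s tube_mass i nu H z r s)%E).
    exact: ge0_subset_integral.
  rewrite (integral_tube_mass nui mH H0 z (ltW r0)).
  by apply: lee_wpmul2l; [rewrite lee_fin mulr_ge0// ltW|apply: hC; rewrite mulr_gt0].
rewrite -!EFinM -EFinD lee_fin kq.
have -> : k * V * (b - a) = (b - a) `^ (1 - q^-1) * V by rewrite -kba; ring.
set p := (b - a) `^ _; have p0 : 0 <= p by exact: powR_ge0.
have -> : p * (2 * r * (C0 * (slope * r) ^+ m)) = p * (2 * C0 * slope ^+ m) * r ^+ m.+1.
  by rewrite exprS exprMn; ring.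
apply: (@le_trans _ _ (p * V + p * (2 * C0 * slope ^+ m) * (m.+1%:R ^+ m.+1 * V))).
  rewrite lerD2l ler_wpM2l// !mulr_ge0// exprn_ge0// ltW//.
by rewrite le_eqVlt; apply/orP; left; apply/eqP; ring.
Qed.

End line_average.

(** * From ball averages to the precise representative *)

Section limsup.
Context {R : realType}.

Lemma limf_esup_le_add (f g : R -> \bar R) (rho c : R) : 0 < rho ->
  (forall r : R, 0 < r < rho -> (f r <= g r + c%:E)%E) ->
  (limf_esup f 0^'+ <= limf_esup g 0^'+ + c%:E)%E.
Proof.
move=> rho0 fg; rewrite !limf_esupE -leeBlDr//.
apply: le_ereal_inf_tmp => _ [V FV <-]; rewrite leeBlDr//.
have FW : (0^'+ : set_system R) (V `&` [set r | 0 < r < rho]).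
  apply: filterI => //; near=> r; apply/andP; split; near: r; first exact: nbhs_right_gt.
  exact: nbhs_right_lt.
apply: (@le_trans _ _ (ereal_sup (f @` (V `&` [set r | 0 < r < rho])))).
  by apply: ereal_inf_lbound; exists (V `&` [set r | 0 < r < rho]).
apply: ge_ereal_sup => _ [r [Vr rrho] <-]; apply: le_trans (fg r rrho) _.
by apply: leeD2r; apply: ereal_sup_ubound; exists r.
Unshelve. all: by end_near. Qed.

Lemma fin_num_le_add (x y : \bar R) (c : R) : (x <= y + c%:E)%E -> (y <= x + c%:E)%E ->
  y \is a fin_num -> x \is a fin_num /\ `|fine x - fine y| <= c.
Proof.
case: y => [y| |] //; case: x => [x| |] //=.
rewrite !lee_fin => h1 h2 _; split => //.
by rewrite ler_norml; apply/andP; split; lra.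
Qed.

Definition ball_average n (u : 'rV[R]_n -> R) x r : \bar R :=
  (((fine (leb n (eball x r)))^-1)%:E * \int[leb n]_(y in eball x r) (u y)%:E)%E.

Lemma ball_averageE n (u : 'rV[R]_n -> R) x r :
  (leb n).-integrable (eball x r) (EFin \o u) ->
  ball_average u x r = ((fine (borel_lebesgue (eball (0 : 'rV[R]_n) r)))^-1 *
    \int[leb n]_(y in eball x r) u y)%:E.
Proof.
move=> iu; rewrite /ball_average.
have -> : leb n (eball x r) = borel_lebesgue (eball (0 : 'rV[R]_n) r).
  by rewrite leb_borel; [exact: borel_lebesgue_eball|exact: measurable_eball].
by rewrite EFinM [in RHS]/Rintegral fineK//; exact: (integrable_fin_num (@measurable_eball_Rn _ _ _ _) iu).
Qed.

Lemma fine_eball_gt0 n (r : R) : (0 < n)%N -> 0 < r ->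
  0 < fine (borel_lebesgue (eball (0 : 'rV[R]_n) r)).
Proof.
move=> n0 r0; have h := @borel_lebesgue_eball_ge R n 0 r r0 n0.
rewrite -lte_fin fineK; last by rewrite ge0_fin_numE//; exact: borel_lebesgue_eball_lty.
by apply: lt_le_trans h; rewrite lte_fin exprn_gt0// divr_gt0// ltr0n.
Qed.

(** The two limsups are compared by one inequality in each direction and never subtracted, so that
    finiteness at y yields finiteness at x. *)
Lemma precise_close n (u : 'rV[R]_n -> R) x y (rho c : R) : (0 < n)%N -> 0 < rho ->
  (forall r : R, 0 < r < rho -> (leb n).-integrable (eball x r) (EFin \o u)) ->
  (forall r : R, 0 < r < rho -> (leb n).-integrable (eball y r) (EFin \o u)) ->
  (forall r : R, 0 < r < rho -> `|\int[leb n]_(t in eball x r) u t -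
     \int[leb n]_(t in eball y r) u t| <= c * fine (borel_lebesgue (eball (0 : 'rV[R]_n) r))) ->
  precise u y \is a fin_num ->
  precise u x \is a fin_num /\ `|fine (precise u x) - fine (precise u y)| <= c.
Proof.
move=> n0 rho0 ix iy h; apply: fin_num_le_add; apply: (limf_esup_le_add rho0) => r rr.
  rewrite -![X in (X <= _)%E]/(ball_average _ _ _) -[X in (_ <= X + _)%E]/(ball_average _ _ _).
  rewrite (ball_averageE (ix r rr)) (ball_averageE (iy r rr)).
  have V0 := fine_eball_gt0 n0 (andP rr).1.
  rewrite -EFinD lee_fin -lerBlDl -mulrBr mulrC ler_pdivrMr//.
  by apply: le_trans (h r rr); exact: ler_norm.
rewrite -![X in (X <= _)%E]/(ball_average _ _ _) -[X in (_ <= X + _)%E]/(ball_average _ _ _).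
rewrite (ball_averageE (ix r rr)) (ball_averageE (iy r rr)).
have V0 := fine_eball_gt0 n0 (andP rr).1.
rewrite -EFinD lee_fin -lerBlDl -mulrBr mulrC ler_pdivrMr//.
by apply: le_trans (h r rr); rewrite distrC; exact: ler_norm.
Qed.

End limsup.

(** * The determinant as a function of the entries *)

Section det_continuity.
Context {R : realType}.
Variables (n : nat) (A : 'M[R]_n).

(** A Lipschitz bound at the single matrix A, for perturbations of size at most 1; in this form it
    is stable under sums and products. *)
Definition lipschitz_at (P : 'M[R]_n -> R) := exists C : R, 0 <= C /\
  forall (B : 'M[R]_n) (d : R), 0 <= d <= 1 -> (forall i j, `|B i j - A i j| <= d) ->
    `|P B - P A| <= C * d.

Lemma lipschitz_at_cst c : lipschitz_at (fun=> c).
Proof. by exists 0; split => // B d _ _; rewrite subrr normr0 mul0r. Qed.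

Lemma lipschitz_at_coord i j : lipschitz_at (fun B => B i j).
Proof. by exists 1; split => // B d _ h; rewrite mul1r. Qed.

Lemma lipschitz_atD P Q : lipschitz_at P -> lipschitz_at Q -> lipschitz_at (fun B => P B + Q B).
Proof.
move=> [C [C0 hC]] [D [D0 hD]]; exists (C + D); split; first exact: addr_ge0.
move=> B d d01 h; rewrite opprD addrACA mulrDl; apply: le_trans (ler_normD _ _) _.
by apply: lerD; [exact: hC|exact: hD].
Qed.

Lemma lipschitz_atM P Q : lipschitz_at P -> lipschitz_at Q -> lipschitz_at (fun B => P B * Q B).
Proof.
move=> [C [C0 hC]] [D [D0 hD]].
exists (C * (`|Q A| + D) + `|P A| * D); split.
  by rewrite addr_ge0// mulr_ge0// addr_ge0.
move=> B d d01 h; have := hC B d d01 h; have := hD B d d01 h => h1 h2.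
have -> : P B * Q B - P A * Q A = (P B - P A) * Q B + P A * (Q B - Q A) by ring.
apply: le_trans (ler_normD _ _) _; rewrite !normrM mulrDl; apply: lerD; last first.
  by rewrite -mulrA ler_wpM2l.
rewrite mulrAC; apply: ler_pM => //.
rewrite -(subrK (Q A) (Q B)) addrC; apply: le_trans (ler_normD _ _) _.
rewrite lerD2l; apply: le_trans h1 _; rewrite -[leRHS]mulr1 ler_wpM2l//.
by case/andP: d01.
Qed.

Lemma lipschitz_at_det : lipschitz_at (fun B => \det B).
Proof.
have sum_ (I : finType) (F : I -> 'M[R]_n -> R) :
    (forall i, lipschitz_at (F i)) -> lipschitz_at (fun B => \sum_i F i B).
  move=> hF; rewrite (_ : (fun _ => _) = \sum_i F i); last by apply/funext => B; rewrite fct_sumE.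
  elim/big_ind : _ => [|P Q hP hQ|i _]; [exact: lipschitz_at_cst|exact: lipschitz_atD|exact: hF].
have prod_ (F : 'I_n -> 'M[R]_n -> R) (s : seq 'I_n) :
    (forall i, lipschitz_at (F i)) -> lipschitz_at (fun B => \prod_(i <- s) F i B).
  move=> hF; elim: s => [|i s ih].
    by under eq_fun do rewrite big_nil; exact: lipschitz_at_cst.
  by under eq_fun do rewrite big_cons; exact: lipschitz_atM.
apply: sum_ => s; apply: lipschitz_atM; first exact: lipschitz_at_cst.
by apply: prod_ => i; exact: lipschitz_at_coord.
Qed.

End det_continuity.

(** * Divergence of the integral of 1/s at 0 *)

Section divergence.
Context {R : realType}.
Notation lam := (@lebesgue_measure R).

(** Each dyadic interval ]d (k+1), d k] towards t0 contributes at least c / 2: its length is half of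
    d k - t0, and c / (s - t0) >= c / (d k - t0) on it. *)
Lemma integral_inv_diverges (h : measurableTypeR R -> \bar R) (t0 delta c : R) :
  measurable_fun setT h -> (forall s, 0 <= h s)%E -> 0 < delta -> 0 < c ->
  (forall s : R, t0 < s < t0 + delta -> ((c / (s - t0))%:E <= h s)%E) ->
  (\int[lam]_s h s = +oo)%E.
Proof.
move=> mh h0 d0 c0 hc.
(* The exponent k+1 keeps d 0 strictly below t0 + delta. *)
pose d k : R := t0 + delta / 2 ^+ k.+1.
have dS k : d k.+1 < d k.
  rewrite /d ltrD2l ltr_pM2l// ltf_pV2 ?posrE ?exprn_gt0//.
  by rewrite ltr_eXn2l// ltr1n.
have dlt k : d k < t0 + delta.
  by rewrite /d ltrD2l ltr_pdivrMr ?exprn_gt0// ltr_pMr// exprn_egt1 ?ltr1n.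
have dgt k : t0 < d k by rewrite /d ltrDl divr_gt0// exprn_gt0.
have dle k : d k <= d 0%N by elim: k => [//|k ih]; exact: le_trans (ltW (dS k)) ih.
have mI (x y : R) : measurable (`]x, y]%classic : set (measurableTypeR R)) by exact: measurable_itv.
have step k : ((c / 2)%:E <= \int[lam]_(s in `]d k.+1, d k]%classic) h s)%E.
  apply: (@le_trans _ _ (\int[lam]_(s in `]d k.+1, d k]%classic) (cst (c / (d k - t0))%:E) s)%E).
    rewrite integral_cst// [X in (_ <= _ * X)%E]lebesgue_measure_oc -EFinM lee_fin.
    rewrite (max_idPr _); last by rewrite subr_ge0 ltW.
    have E : d k - t0 = 2 * (d k - d k.+1).
      by rewrite /d !exprS; field; rewrite expf_neq0.
    rewrite E le_eqVlt; apply/orP; left; apply/eqP; field.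
    by rewrite subr_eq0 gt_eqF.
  apply: ge0_le_integral => //.
  - by move=> s _; rewrite lee_fin divr_ge0 ?subr_ge0 ?ltW.
  - exact: measurable_funTS mh.
  - move=> s; rewrite /= in_itv/= => /andP[s1 s2].
    have s3 : t0 < s by exact: lt_trans (dgt k.+1) s1.
    apply: le_trans (hc s _); last by rewrite s3 (le_lt_trans s2).
    by rewrite lee_fin ler_pM2l// lef_pV2 ?posrE ?subr_gt0// lerD2r.
have tot N : ((N%:R * (c / 2))%:E <= \int[lam]_(s in `]d N, d 0%N]%classic) h s)%E.
  elim: N => [|N ih]; first by rewrite mul0r integral_ge0.
  have -> : `]d N.+1, d 0%N]%classic = `]d N.+1, d N]%classic `|` `]d N, d 0%N]%classic.
    by rewrite -itv_bndbnd_setU// bnd_simp// ?ltW.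
  rewrite ge0_integral_setU//; last 2 first.
  - exact: measurable_funTS mh.
  - apply/disj_setPRL => s /=; rewrite !in_itv/= => /andP[s1 s2] /andP[_ s3].
    by move: s1; rewrite ltNge s3.
  by rewrite -natr1 mulrDl mul1r addrC EFinD; apply: leeD.
apply/eqyP => A A0.
pose N := (Num.trunc (A / (c / 2))).+1.
apply: (@le_trans _ _ ((N%:R * (c / 2))%:E)).
  by rewrite lee_fin -ler_pdivrMr ?divr_gt0// ltW// truncnS_gt.
apply: le_trans (tot N) _; exact: ge0_subset_integral.
Qed.

End divergence.

(** * Orthogonal projections and Hausdorff null sets *)

Section projection.
Context {R : realType}.
Variable n : nat.

Lemma hausdorff_content_ge0 m (delta : R) (A : set 'rV[R]_n) :
  (0 <= hausdorff_content m delta A)%E.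
Proof.
apply: le_ereal_inf_tmp => _ [F _ <-]; apply: nneseries_ge0 => k _ _.
rewrite /diam_pow; case: eqP => // /eqP/set0P[x Fx].
apply: expe_ge0; apply: ereal_sup_ubound; exists x => //; exists x => //.
by rewrite subrr enorm0.
Qed.

Lemma hausdorff_null_sub m (A B : set 'rV[R]_n) : A `<=` B ->
  hausdorff m B = 0%E -> hausdorff m A = 0%E.
Proof.
move=> AB B0; apply/eqP; rewrite eq_le; apply/andP; split.
  rewrite -B0; apply: lee_wpmul2l; first exact: measure_ge0.
  apply: ge_ereal_sup => _ [d d0 <-].
  apply: (@le_trans _ _ (hausdorff_content m d B)).
    apply: ereal_inf_le_tmp => _ [F [BF Fd] <-]; exists F => //; split => //.
    exact: subset_trans BF.
  by apply: ereal_sup_ubound; exists d.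
apply: mule_ge0; first exact: measure_ge0.
apply: (@le_trans _ _ (hausdorff_content m 1 A)); first exact: hausdorff_content_ge0.
by apply: ereal_sup_ubound; exists 1 => //=.
Qed.

(** The vector y - p x is orthogonal to x - p x by hypothesis, and to nu since both points lie in
    the hyperplane; being a combination of these two vectors, it is 0. *)
Lemma orthogonal_projectionE (nu : 'rV[R]_n) (c : R) p x : nu != 0 ->
  orthogonal_projection (hyperplane nu c) p ->
  p x = x - ((dot nu x - c) / dot nu nu) *: nu.
Proof.
move=> nu0 hp; set y := RHS.
have d0 : dot nu nu != 0 by apply: contra_neq nu0; exact: dot_eq0.
have [Hp orth] := hp x.
have Hy : hyperplane nu c y.
  by rewrite /hyperplane/= /y dotDr dotNr dotZr divfK// opprB addrCA subrr addr0.
have := orth y Hy => h1.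
have h2 : dot nu (y - p x) = 0 by rewrite dotDr dotNr Hy Hp subrr.
have h3 : dot (y - p x) (y - p x) = 0.
  rewrite {1}(_ : y - p x = (x - p x) - ((dot nu x - c) / dot nu nu) *: nu).
    by rewrite dotDl h1 dotNl dotZl h2 mulr0 oppr0 addr0.
  by rewrite /y addrAC.
by apply/esym/eqP; rewrite -subr_eq0; apply/eqP; exact: dot_eq0.
Qed.

End projection.

(** * Weak directional derivatives of the first derivatives *)

Section finite_sums.
Context d (T : measurableType d) (R : realType) (mu : {measure set T -> \bar R}).
Variables (D : set T) (I : Type) (c : I -> R) (F : I -> T -> R).
Hypotheses (mD : measurable D) (iF : forall k, mu.-integrable D (EFin \o F k)).

Lemma integrable_linear_comb (s : seq I) :
  mu.-integrable D (EFin \o (fun y => \sum_(k <- s) c k * F k y)).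
Proof.
elim: s => [|k s ih].
  by under eq_fun do rewrite /= big_nil; exact: integrable0.
rewrite (_ : _ \o _ = ((EFin \o (fun y => (c k * F k y)%R)) \+
    (EFin \o (fun y => (\sum_(k <- s) c k * F k y)%R)))%E); last first.
  by apply/funext => y /=; rewrite big_cons EFinD.
by apply: integrableD => //; exact: (integrableZl mD (c k) (iF k)).
Qed.

Lemma Rintegral_linear_comb (s : seq I) :
  \int[mu]_(y in D) (\sum_(k <- s) c k * F k y) =
  \sum_(k <- s) c k * \int[mu]_(y in D) F k y.
Proof.
elim: s => [|k s ih].
  by rewrite big_nil; under eq_Rintegral do rewrite big_nil; rewrite Rintegral_cst// mul0r.
under eq_Rintegral do rewrite big_cons.
rewrite RintegralD//; last 2 first.
- exact: (integrableZl mD (c k) (iF k)).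
- exact: integrable_linear_comb.
by rewrite big_cons RintegralZl// ih.
Qed.

End finite_sums.

Section weak_directional_derivative.
Context {R : realType}.
Variable n : nat.
Implicit Types (Omega : set 'rV[R]_n) (phi : 'rV[R]_n -> R).

Lemma partial_out_support k phi x : ~ Defs.support phi x -> partial k phi x = 0.
Proof.
move=> nS; rewrite /partial.
transitivity ('D_(delta_mx 0 k) (cst 0 : 'rV[R]_n -> R) x); last exact: derive_cst.
apply: near_eq_derive; have oC := closed_openC (@closed_closure _ [set x | phi x != 0]).
near=> z; apply/eqP; apply: contrapT => /negP h.
have : (~` Defs.support phi) z by near: z; exact: oC.
by apply; exact: subset_closure.
Unshelve. all: by end_near. Qed.

Lemma test_function_partial Omega k phi :
  test_function Omega phi -> test_function Omega (partial k phi).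
Proof.
move=> [sm cS SO].
have sub : Defs.support (partial k phi) `<=` Defs.support phi.
  rewrite {2}/Defs.support ((closure_id (closure [set x | phi x != 0])).1 (@closed_closure _ _)).
  apply: closure_subset => x /= /eqP h; apply: contrapT => nS; apply: h.
  exact: partial_out_support.
split.
- by move=> s; have := sm (rcons s k); rewrite /partials foldr_rcons.
- by apply: subclosed_compact cS sub; exact: closed_closure.
- exact: subset_trans SO.
Qed.

Lemma test_function_continuous Omega phi : test_function Omega phi -> continuous phi.
Proof. by move=> [sm _ _]; have [] := sm [::]. Qed.

Lemma integrable_test Omega (g phi : 'rV[R]_n -> R) : measurable Omega ->
  loc_integrable Omega g -> test_function Omega phi ->
  (leb n).-integrable Omega (EFin \o (fun y => g y * phi y)).
Proof.
move=> mO ig tphi; have [sm cS SO] := tphi; set K := Defs.support phi in cS SO.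
have mK : measurable (K : set (Rn R n)).
  by apply: measurable_Rn; exact: compact_measurable_rV.
have cphi := test_function_continuous tphi.
have [C _ hC] := continuous_bounded_on cS cphi.
have mphi := measurable_fun_Rn measurableT (continuous_measurable_rV cphi).
have iK := integrable_mul_bounded mK (ig K cS SO) (measurable_funTS mphi) hC.
apply/(integrable_mkcond _ (measurable_Rn mO)).
move/(integrable_mkcond _ mK) : iK; congr (_.-integrable _ _).
apply/funext => y; rewrite !patchE; case: (boolP (y \in K)) => [/set_mem Ky|].
  by rewrite mem_set//; exact: SO.
rewrite notin_setE => nK; case: ifP => // _ /=; congr EFin.
have -> : phi y = 0 by apply/eqP; apply: contrapT => /negP h; apply: nK; exact: subset_closure.
by rewrite mulr0.
Qed.

(** The hypotheses concern derivatives of u. Testing the first-order identity with [partial k phi]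
    gives the same left side as the second-order identity for [[:: j; k]]; comparing the two makes v
    k the k-th weak derivative of g. *)
Lemma weak_directional Omega (u g : 'rV[R]_n -> R) (v : 'I_n -> 'rV[R]_n -> R) j (nu : 'rV[R]_n) phi :
  measurable Omega -> weak_derivative Omega [:: j] u g ->
  (forall k, weak_derivative Omega [:: j; k] u (v k)) -> test_function Omega phi ->
  \int[leb n]_(x in Omega) (g x * \sum_k nu 0 k * partial k phi x) =
  - \int[leb n]_(x in Omega) ((\sum_k nu 0 k * v k x) * phi x).
Proof.
move=> mO [_ ig wg] wv tphi.
have mO' := measurable_Rn mO.
transitivity (\int[leb n]_(x in Omega) (\sum_k nu 0 k * (g x * partial k phi x))).
  by apply: eq_Rintegral => x _; rewrite mulr_sumr; apply: eq_bigr => k _; rewrite mulrCA.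
rewrite Rintegral_linear_comb//; last first.
  by move=> k; apply: integrable_test => //; exact: test_function_partial.
transitivity (- \int[leb n]_(x in Omega) (\sum_k nu 0 k * (v k x * phi x))); last first.
  by congr (- _); apply: eq_Rintegral => x _; rewrite mulr_suml; apply: eq_bigr => k _; rewrite mulrA.
rewrite Rintegral_linear_comb//; last first.
  by move=> k; apply: integrable_test => //; have [] := wv k.
rewrite -sumrN; apply: eq_bigr => k _; rewrite -mulrN; congr (_ * _).
have := wg _ (test_function_partial k tphi); have [_ _ /(_ phi tphi)] := wv k.
rewrite /= expr1 expr2 mulN1r opprK mul1r => -> /eqP; rewrite mulN1r eq_sym eqr_oppLR => /eqP.
by [].
Qed.

Lemma loc_integrable_linear_comb Omega (c : 'I_n -> R) (v : 'I_n -> 'rV[R]_n -> R) :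
  (forall k, loc_integrable Omega (v k)) ->
  loc_integrable Omega (fun x => \sum_k c k * v k x).
Proof.
move=> iv K cK KO; apply: integrable_linear_comb => [|k]; last exact: iv.
by apply: measurable_Rn; exact: compact_measurable_rV.
Qed.

End weak_directional_derivative.

(** * An integrable majorant of the second derivatives *)

Section sobolev_majorant.
Context {R : realType}.

(** All terms are bounded by the largest |v k|, whose power is one summand on the right. *)
Lemma powR_linear_comb_le n (nu : 'rV[R]_n) (v : 'I_n -> R) (q : R) : 0 < q -> (0 < n)%N ->
  `|\sum_k nu 0 k * v k| `^ q <= (n%:R * enorm nu) `^ q * \sum_k `|v k| `^ q.
Proof.
move=> q0 n0.
have [k hk] : exists k, forall j, `|v j| <= `|v k|.
  have i0 : 'I_n by exact: Ordinal n0.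
  have := @arg_maxP _ _ _ i0 xpredT (fun j => `|v j|) isT.
  by case=> k _ h; exists k => j; exact: h.
apply: (@le_trans _ _ ((n%:R * enorm nu * `|v k|) `^ q)).
  apply: ge0_ler_powR; rewrite ?nnegrE ?mulr_ge0 ?enorm_ge0 ?(ltW q0)//.
  apply: le_trans (ler_norm_sum _ _ _) _.
  apply: (@le_trans _ _ (\sum_(j < n) (enorm nu * `|v k|))).
    by apply: ler_sum => j _; rewrite normrM; apply: ler_pM => //; exact: coord_le_enorm.
  by rewrite sumr_const card_ord mulr_natl mulrnAl.
rewrite powRM ?mulr_ge0 ?enorm_ge0// ler_wpM2l ?powR_ge0//.
by rewrite (bigD1 k)//= lerDl sumr_ge0// => j _; exact: powR_ge0.
Qed.

Lemma second_derivatives_majorant n (Omega : set 'rV[R]_n) (I : finType) (q : R)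
    (v : I -> 'rV[R]_n -> R) : measurable Omega -> (forall l, Lq Omega q (v l)) ->
  exists H : 'rV[R]_n -> \bar R, [/\ measurable_fun setT H, (forall x, 0 <= H x)%E,
    (forall x, Omega x -> ((\sum_l `|v l x| `^ q)%:E <= H x)%E) &
    (\int[@borel_lebesgue R n]_x H x < +oo)%E].
Proof.
move=> mO Lv; have mO' := measurable_Rn mO.
have mv l : measurable_fun (Omega : set (Rn R n)) (fun x : Rn R n => `|v l x| `^ q).
  have [m _] := Lv l.
  apply: (measurableT_comp (measurable_powR q)).
  exact: (measurableT_comp (@normr_measurable R setT) m).
pose F l (x : Rn R n) := (`|v l x| `^ q)%:E.
have mF l : measurable_fun (Omega : set (Rn R n)) (F l).
  by apply/measurable_EFinP; exact: mv.
have F0 l x : (0 <= F l x)%E by rewrite lee_fin powR_ge0.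
pose W (x : Rn R n) := (\sum_l F l x)%E.
have mW : measurable_fun (Omega : set (Rn R n)) W by exact: emeasurable_sum.
have W0 x : (0 <= W x)%E by exact: sume_ge0.
have Wfin : (\int[leb n]_(x in Omega) W x < +oo)%E.
  have -> := @ge0_integral_sum _ _ R (leb n) _ mO' I F mF (fun l x _ => F0 l x) (index_enum I).
  by apply: lte_sum_pinfty => l _; have [_] := Lv l.
have [H [mH H0 WH Hfin]] := @borel_majorant R n Omega W mO' mW (fun x _ => W0 x) Wfin.
exists H; split => // x Ox; apply: le_trans (WH x Ox).
by rewrite /W /F sumEFin.
Qed.

End sobolev_majorant.

(** * Hoelder continuity of the representative along almost every line *)

Section good_lines.
Context {R : realType}.
Variables (m : nat) (Omega : set 'rV[R]_m.+1) (q : R).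
Variables (f : 'rV[R]_m.+1 -> 'rV[R]_m.+1) (Df : 'rV[R]_m.+1 -> 'M[R]_m.+1).
Hypotheses (oOmega : open Omega) (q1 : 1 < q).
Hypotheses (sob : sobolev_map Omega 2 q f) (jac : weak_jacobian Omega f Df).

(** The majorant H bounds the directional second derivatives of all components at once, hence one
    null set N and one constant per line for all entries of Df and all balls. *)
Lemma good_lines (i0 : 'I_m.+1) (nu : 'rV[R]_m.+1) : nu 0 i0 = 1 ->
  exists N : set 'rV[R]_m, [/\ measurable N, borel_lebesgue N = 0%E &
    forall z, ~ N z -> exists C : R, 0 <= C /\
    forall (x0 : 'rV[R]_m.+1) (rho s t : R) i j, 0 < rho -> ecball x0 (3 * rho) `<=` Omega ->
      eball x0 rho (line_map i0 nu (z, s)) -> eball x0 rho (line_map i0 nu (z, t)) ->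
      precise (fun y => Df y i j) (line_map i0 nu (z, s)) \is a fin_num ->
      precise (fun y => Df y i j) (line_map i0 nu (z, t)) \is a fin_num /\
      `|fine (precise (fun y => Df y i j) (line_map i0 nu (z, t))) -
        fine (precise (fun y => Df y i j) (line_map i0 nu (z, s)))| <=
      C * `|t - s| `^ (1 - q^-1)].
Proof.
move=> nui.
have mO : measurable Omega by exact: open_measurable_rV.
have q0 : 0 < q by exact: lt_trans q1.
have hv (l : 'I_m.+1 * 'I_m.+1 * 'I_m.+1) : exists v, Lq Omega q v /\
    weak_derivative Omega [:: l.1.2; l.2] (fun x => f x ord0 l.1.1) v.
  by have [_ /(_ [:: l.1.2; l.2] isT)[v ? ?]] := sob l.1.1; exists v.
have [v hv'] := choice hv.
have [H0 [mH0 H00 vH0 H0fin]] := second_derivatives_majorant mO (fun l => (hv' l).1).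
pose c := (m.+1%:R * enorm nu) `^ q; have c0 : 0 <= c by exact: powR_ge0.
pose H x := (c%:E * H0 x)%E.
have mH : measurable_fun setT H by apply: emeasurable_funM => //; exact: measurable_cst.
have Hge0 x : (0 <= H x)%E by rewrite mule_ge0.
have Hfin : (\int[@borel_lebesgue R m.+1]_y H y < +oo)%E.
  by rewrite ge0_integralZl// lte_mul_pinfty.
have [N [mN N0 hN]] := line_average_holder nui q1 mH Hge0 Hfin.
exists N; split; [exact: mN|exact: N0|].
move=> z /hN[C [C0 hC]]; exists C; split; [exact: C0|].
move=> x0 rho s t i j rho0 sub xs xt.
pose g y := Df y i j.
pose w y := \sum_k nu 0 k * v (i, j, k) y.
have [_ ig _] := jac i j.
have iw : loc_integrable Omega w.
  by apply: loc_integrable_linear_comb => k; have [_ []] := hv' (i, j, k).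
have cK := @ecball_compact R m.+1 x0 (3 * rho).
have wH x : ecball x0 (3 * rho) x -> ((`|w x| `^ q)%:E <= H x)%E.
  move=> /sub Ox; apply: (@le_trans _ _ (c%:E * (\sum_l `|v l x| `^ q)%:E)%E); last first.
    by apply: lee_wpmul2l; [rewrite lee_fin|exact: vH0].
  rewrite -EFinM lee_fin.
  apply: le_trans (powR_linear_comb_le nu (fun k => v (i, j, k) x) q0 (ltn0Sn m)) _.
  rewrite ler_wpM2l//.
  pose F (l : 'I_m.+1 * 'I_m.+1 * 'I_m.+1) := `|v l x| `^ q.
  have -> : \sum_l `|v l x| `^ q = \sum_p \sum_k F (p, k).
    by rewrite pair_big/=; apply: eq_bigr => -[p k] _.
  by rewrite (bigD1 (i, j))//= lerDl sumr_ge0// => p _; rewrite sumr_ge0// => k _; exact: powR_ge0.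
have weak phi : test_function Omega phi ->
    \int[leb m.+1]_(x in Omega) (g x * \sum_k nu 0 k * partial k phi x) =
    - \int[leb m.+1]_(x in Omega) (w x * phi x).
  by apply: (weak_directional _ mO (jac i j)) => k; have [] := hv' (i, j, k).
have inball r x : 0 < r < rho -> eball x0 rho x -> eball x r `<=` ecball x0 (3 * rho).
  move=> /andP[r0 rr] xr; apply: subset_trans (@eball_sub_ecball _ _ _ _) _.
  apply: subset_trans (@eball_sub_ecball _ _ _ _); apply: ecball_sub_eball.
  by move: xr; rewrite /eball/= => xr; lra.
have iB r x : 0 < r < rho -> eball x0 rho x -> (leb m.+1).-integrable (eball x r) (EFin \o g).
  move=> rr xr.
  have mK : measurable (ecball x0 (3 * rho) : set (Rn R m.+1)).
    by apply: measurable_Rn; exact: compact_measurable_rV.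
  have mB : measurable (eball x r : set (Rn R m.+1)) by exact: measurable_eball_Rn.
  exact: (@integrableS _ _ _ _ _ _ _ mK mB (inball r x rr xr) (ig _ cK sub)).
have key (a b : R) : a < b -> eball x0 rho (line_map i0 nu (z, a)) ->
    eball x0 rho (line_map i0 nu (z, b)) -> forall r, 0 < r < rho ->
    `|\int[leb m.+1]_(y in eball (line_map i0 nu (z, b)) r) g y -
      \int[leb m.+1]_(y in eball (line_map i0 nu (z, a)) r) g y| <=
    C * (b - a) `^ (1 - q^-1) * fine (borel_lebesgue (eball (0 : 'rV[R]_m.+1) r)).
  move=> ab xa xb r /andP[r0 rr].
  have nu_gt0 : 0 < enorm nu.
    apply: enorm_gt0; apply/eqP => nu0; move: nui; rewrite nu0 mxE => /esym/eqP.
    by rewrite oner_eq0.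
  have e0 : 0 < rho / enorm nu by rewrite divr_gt0.
  (* Parameters in this margin move the point by less than rho, so the centres stay within 2 rho of
     x0, and the balls of radius r < rho within 3 rho. *)
  apply: (hC Omega (ecball x0 (3 * rho)) g w r a b (rho / enorm nu)) => //.
  - exact: ig.
  - exact: iw.
  move=> u /andP[ua ub].
  apply: subset_trans (@eball_sub_ecball _ _ _ _); apply: ecball_sub_eball.
  suff : enorm (line_map i0 nu (z, u) - x0) < 2 * rho by lra.
  have move_ x y : eball x0 rho (line_map i0 nu (z, x)) -> `|y - x| * enorm nu < rho ->
      enorm (line_map i0 nu (z, y) - x0) < 2 * rho.
    rewrite /eball/= => h1 h2.
    have -> : line_map i0 nu (z, y) - x0 = (line_map i0 nu (z, x) - x0) + (y - x) *: nu.
      rewrite (line_mapE i0 nu z y) (line_mapE i0 nu z x).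
      by move: (line_map _ _ _) => p; apply/rowP => k; rewrite !mxE; ring.
    apply: le_lt_trans (enormD _ _) _; rewrite enormZ; lra.
  have [ua'|ua'] := leP u a.
    apply: (move_ a) => //; rewrite -ltr_pdivlMr// ltr_norml; apply/andP; split; lra.
  have [bu|bu] := leP b u.
    apply: (move_ b) => //; rewrite -ltr_pdivlMr// ltr_norml; apply/andP; split; lra.
  have h1 := xa; have h2 := xb; rewrite /eball/= in h1 h2.
  pose l := (u - a) / (b - a).
  have l0 : 0 <= l by apply: divr_ge0; rewrite subr_ge0 ltW.
  have l1 : l <= 1 by rewrite /l ler_pdivrMr ?subr_gt0// mul1r lerD2r ltW.
  have -> : line_map i0 nu (z, u) - x0 =
      (1 - l) *: (line_map i0 nu (z, a) - x0) + l *: (line_map i0 nu (z, b) - x0).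
    rewrite (line_mapE i0 nu z u) (line_mapE i0 nu z a) (line_mapE i0 nu z b) /l.
    move: (line_map _ _ _) => p; apply/rowP => k; rewrite !mxE; field.
    by rewrite subr_eq0 gt_eqF.
  apply: le_lt_trans (enormD _ _) _; rewrite !enormZ !ger0_norm ?subr_ge0//.
  apply: (@le_lt_trans _ _ ((1 - l) * rho + l * rho)); last by lra.
  by apply: lerD; rewrite ler_wpM2l ?subr_ge0// ltW.
apply: (precise_close (ltn0Sn m) rho0).
- by move=> r rr; exact: iB.
- by move=> r rr; exact: iB.
move=> r rr; have [st|ts|->] := ltgtP s t.
- by rewrite [`|t - s|]gtr0_norm ?subr_gt0//; exact: key.
- by rewrite [`|t - s|]ltr0_norm ?subr_lt0// opprB distrC; exact: key.
- by rewrite !subrr normr0; apply: mulr_ge0; [apply: mulr_ge0 => //; exact: powR_ge0|exact: fine_ge0].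
Qed.

End good_lines.

(** * Lines that meet the zero set of the Jacobian *)

Local Notation BL n := (@borel_lebesgue _ n).

Section infinite_values.
Context {R : realType} {n : nat}.

Lemma infinite_values_null (F : 'rV[R]_n -> \bar R) : measurable_fun setT F ->
  (forall x, 0 <= F x)%E -> (\int[BL n]_x F x < +oo)%E ->
  measurable [set x | F x = +oo%E] /\ BL n [set x | F x = +oo%E] = 0%E.
Proof.
move=> mF F0 Ffin.
have mA : measurable [set x | F x = +oo%E].
  by rewrite -[X in measurable X]setTI; apply: (mF measurableT [set +oo%E]); exact: emeasurable_set1.
split => //; apply: measure_negligible => //.
have iF : (BL n).-integrable setT F.
  apply/integrableP; split => //; under eq_integral do rewrite gee0_abs//.
  by [].
have := integrable_ae measurableT iF.
by apply: negligibleS => x /= Fx /(_ Logic.I); rewrite Fx.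
Qed.

End infinite_values.

Section line_stays.
Context {R : realType} {m : nat}.

Lemma line_map_near (i0 : 'I_m.+1) (nu x0 : 'rV[R]_m.+1) (rho s : R) z :
  eball x0 rho (line_map i0 nu (z, s)) ->
  exists2 delta, 0 < delta & forall t : R, `|t - s| < delta -> eball x0 rho (line_map i0 nu (z, t)).
Proof.
rewrite /eball/= => xs; set e := rho - enorm (line_map i0 nu (z, s) - x0).
have e0 : 0 < e by rewrite subr_gt0.
have nu0 : 0 < 1 + enorm nu by rewrite ltr_pwDl// enorm_ge0.
exists (e / (1 + enorm nu)) => [|t ts]; first exact: divr_gt0.
have -> : line_map i0 nu (z, t) - x0 = (line_map i0 nu (z, s) - x0) + (t - s) *: nu.
  rewrite (line_mapE i0 nu z t) (line_mapE i0 nu z s).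
  by move: (line_map _ _ _) => p; apply/rowP => k; rewrite !mxE; ring.
apply: le_lt_trans (enormD _ _) _; rewrite enormZ -ltrBrDl -/e.
move: ts; rewrite ltr_pdivlMr//; apply: le_lt_trans.
by apply: ler_wpM2l => //; rewrite lerDr.
Qed.

End line_stays.

Section zeros.
Context {R : realType}.
Variables (m : nat) (Omega : set 'rV[R]_m.+1) (q : R).
Variables (f : 'rV[R]_m.+1 -> 'rV[R]_m.+1) (Df : 'rV[R]_m.+1 -> 'M[R]_m.+1).
Hypotheses (oOmega : open Omega) (q1 : 1 < q).
Hypotheses (sob : sobolev_map Omega 2 q f) (jac : weak_jacobian Omega f Df).
Let alpha := 1 - q^-1.
Let J := precise_det Df.

Let alpha0 : 0 < alpha.
Proof. by rewrite subr_gt0 invf_lt1// (lt_trans _ q1). Qed.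

Lemma line_det_holder (i0 : 'I_m.+1) (nu : 'rV[R]_m.+1) : nu 0 i0 = 1 ->
  exists N : set 'rV[R]_m, [/\ measurable N, BL m N = 0%E &
    forall z, ~ N z -> forall (x0 : 'rV[R]_m.+1) (rho s : R),
      0 < rho -> ecball x0 (3 * rho) `<=` Omega ->
      eball x0 rho (line_map i0 nu (z, s)) -> precise_finite Df (line_map i0 nu (z, s)) ->
      (forall t : R, eball x0 rho (line_map i0 nu (z, t)) -> precise_finite Df (line_map i0 nu (z, t))) /\
      exists D delta, [/\ 0 < D, 0 < delta & forall t : R, `|t - s| < delta ->
        eball x0 rho (line_map i0 nu (z, t)) /\
        `|J (line_map i0 nu (z, t)) - J (line_map i0 nu (z, s))| <= D * `|t - s| `^ alpha]].
Proof.
move=> nui; have [N [mN N0 hN]] := good_lines oOmega q1 sob jac nui.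
exists N; split; [exact: mN|exact: N0|].
move=> z /hN[C [C0 hC]] x0 rho s rho0 sub xs fs.
have hC' t i j (xt : eball x0 rho (line_map i0 nu (z, t))) :=
  hC x0 rho s t i j rho0 sub xs xt (fs i j).
split; first by move=> t xt i j; have [] := hC' t i j xt.
have [delta d0 hd] := line_map_near xs.
have [P PE JE] : exists2 P : 'rV[R]_m.+1 -> 'M[R]_m.+1,
    forall y i j, P y i j = fine (precise (fun y => Df y i j) y) & forall y, J y = \det (P y).
  by exists (fun y => \matrix_(i, j) fine (precise (fun y => Df y i j) y)) => // y i j; rewrite mxE.
have [C1 [C10 hC1]] := lipschitz_at_det (P (line_map i0 nu (z, s))).
have C1gt0 : 0 < C + 1 by rewrite ltr_wpDl.
(* Within distance d' the entries change by at most C / (C + 1) <= 1, the range in which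
   [lipschitz_at] applies. *)
pose d' := (C + 1)^-1 `^ alpha^-1.
have d'0 : 0 < d' by apply: powR_gt0; rewrite invr_gt0.
exists (C1 * C + 1), (Num.min delta d'); split.
- by rewrite ltr_wpDl// mulr_ge0.
- by rewrite lt_min d0.
move=> t; rewrite lt_min => /andP[td td']; have xt := hd t td; split => //.
have p0 : 0 <= `|t - s| `^ alpha by exact: powR_ge0.
apply: (@le_trans _ _ (C1 * (C * `|t - s| `^ alpha))); last first.
  by rewrite mulrA ler_wpM2r// lerDl.
rewrite !JE; apply: (hC1 (P (line_map i0 nu (z, t)))) => [|i j]; last first.
  by rewrite !PE; exact: (hC' t i j xt).2.
rewrite mulr_ge0//=.
have h : `|t - s| `^ alpha <= (C + 1)^-1.
  apply: (@le_trans _ _ (d' `^ alpha)).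
    by apply: ge0_ler_powR; rewrite ?nnegrE// ltW.
  by rewrite /d' -powRrM mulVf ?gt_eqF// powRr1// invr_ge0 ltW.
apply: le_trans (ler_wpM2l C0 h) _.
by rewrite ler_pdivrMr// mul1r lerDl.
Qed.

Variable a : R.
Hypotheses (a0 : 0 < a) (alpha_a : 1 <= alpha * a).
Hypothesis iJ : (leb m.+1).-integrable Omega (fun x => neg_power (J x) a).

Lemma neg_power_ge0 (t : R) : (0 <= neg_power t a)%E.
Proof. by rewrite /neg_power; case: ifP => // _; rewrite lee_fin powR_ge0. Qed.

(** |t|^(-a) is at least D^(-a) s^(-alpha a), and s^(-alpha a) >= 1/s because s <= 1 and alpha a >=
    1; this is where the relation between q and a enters. *)
Lemma neg_power_lower (t D s : R) : 0 < D -> 0 < s -> s <= 1 ->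
  `|t| <= D * s `^ alpha -> ((D `^ (- a) / s)%:E <= neg_power t a)%E.
Proof.
move=> D0 s0 s1 h; rewrite /neg_power; case: ifP => [_|/negbT t0]; first by rewrite leey.
rewrite lee_fin; have t0' : 0 < `|t| by rewrite normr_gt0.
apply: (@le_trans _ _ ((D * s `^ alpha) `^ (- a))); last first.
  rewrite !powRN lef_pV2 ?posrE ?powR_gt0 ?mulr_gt0 ?powR_gt0//.
  by apply: ge0_ler_powR => //; rewrite ?nnegrE ?normr_ge0 ?mulr_ge0 ?powR_ge0// ltW.
rewrite powRM ?powR_ge0 ?(ltW D0)// ler_wpM2l ?powR_ge0//.
rewrite powRN lef_pV2 ?posrE ?powR_gt0// -powRrM.
rewrite -[leRHS]powRr1 ?(ltW s0)//.
by apply: ger_powR => //; apply/andP; split.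
Qed.

Lemma regular_lines (i0 : 'I_m.+1) (nu : 'rV[R]_m.+1) : nu 0 i0 = 1 ->
  exists N : set 'rV[R]_m, [/\ measurable N, BL m N = 0%E &
    forall z, ~ N z -> forall (x0 : 'rV[R]_m.+1) (rho s : R),
      0 < rho -> ecball x0 (3 * rho) `<=` Omega ->
      eball x0 rho (line_map i0 nu (z, s)) -> precise_finite Df (line_map i0 nu (z, s)) ->
      [/\ J (line_map i0 nu (z, s)) != 0,
      forall t : R, eball x0 rho (line_map i0 nu (z, t)) -> precise_finite Df (line_map i0 nu (z, t)) &
      exists D delta, [/\ 0 < D, 0 < delta & forall t : R, `|t - s| < delta ->
        `|J (line_map i0 nu (z, t)) - J (line_map i0 nu (z, s))| <= D * `|t - s| `^ alpha]]].
Proof.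
move=> nui; have [N [mN N0 hN]] := line_det_holder nui.
have mO : measurable (Omega : set (Rn R m.+1)) by apply: measurable_Rn; exact: open_measurable_rV.
have [mW Wfin] : measurable_fun (Omega : set (Rn R m.+1)) (fun x : Rn R m.+1 => neg_power (J x) a) /\
    (\int[leb m.+1]_(x in Omega) neg_power (J x) a < +oo)%E.
  have /integrableP[mW] := iJ; split => //.
  by under eq_integral do rewrite -[neg_power _ _]gee0_abs ?neg_power_ge0//.
have [H [mH H0 WH Hfin]] := @borel_majorant R m.+1 Omega _ mO mW
  (fun x _ => neg_power_ge0 (J x)) Wfin.
have mF := measurable_line_integral nui mH H0.
have F0 := line_integral_ge0 i0 nu H0.
have Ffin : (\int[BL m]_z line_integral i0 nu H z < +oo)%E by rewrite integral_line_integral.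
have [mI I0] := infinite_values_null mF F0 Ffin.
exists (N `|` [set z | line_integral i0 nu H z = +oo%E]); split.
- exact: measurableU.
- exact: null_set_setU.
move=> z /not_orP[Nz Iz] x0 rho s rho0 sub xs fs.
have [hfin [D [delta [D0 d0 hd]]]] := hN z Nz x0 rho s rho0 sub xs fs.
split; [|exact: hfin|by exists D, delta; split => // t /hd[]].
apply/eqP => Js; apply: Iz; rewrite /= /line_integral.
(* The interval is cut at length 1 for the sake of [neg_power_lower]. *)
have Dx : Num.min delta 1 > 0 by rewrite lt_min d0 ltr01.
apply: (@integral_inv_diverges R _ s (Num.min delta 1) (D `^ (- a))) => //.
- exact: (measurableT_comp mH (measurableT_comp (measurable_line_map nui) (measurable_pair1 z))).
- by rewrite powR_gt0.
move=> t /andP[st]; rewrite -ltrBlDl lt_min => /andP[t1 t2].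
have ts0 : 0 < t - s by rewrite subr_gt0.
have [|xt Jt] := hd t; first by rewrite gtr0_norm.
have Ot : Omega (line_map i0 nu (z, t)).
  apply: sub; move: xt; rewrite /eball/ecball/= => xt; apply: ltW; apply: lt_trans xt _.
  by rewrite ltr_pMl// ltr1n.
apply: le_trans (WH _ Ot); apply: neg_power_lower => //; first exact: ltW.
by move: Jt; rewrite Js subr0 [`|t - s|]gtr0_norm.
Qed.

Lemma inner_ball (x : 'rV[R]_m.+1) : Omega x -> exists2 rho, 0 < rho & ecball x (3 * rho) `<=` Omega.
Proof.
move=> /(nbhs_eball oOmega)[r r0 sub]; exists (r / 6); first by rewrite divr_gt0.
apply: subset_trans sub; apply: ecball_sub_eball; rewrite subrr enorm0.
by lra.
Qed.

Lemma eball_center (x : 'rV[R]_m.+1) (r : R) : 0 < r -> eball x r x.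
Proof. by rewrite /eball/= subrr enorm0. Qed.

(** p is constant along lines parallel to nu, so the image of the zeros lies in the image of the
    exceptional base points N under the Lipschitz map sending z to the projection of its line. *)
Lemma zeros_projection_null (nu : 'rV[R]_m.+1) (c : R) p : (0 < m)%N -> nu != 0 ->
  orthogonal_projection (hyperplane nu c) p ->
  hausdorff m (p @` [set x | [/\ Omega x, precise_finite Df x & J x = 0]]) = 0%E.
Proof.
move=> m0 nu0 hp; have pE x := orthogonal_projectionE x nu0 hp.
have D0 : dot nu nu != 0 by apply: contra_neq nu0; exact: dot_eq0.
have [i0 nui0] : exists i0, nu 0 i0 != 0.
  apply/existsP; apply: contraNT nu0; rewrite negb_exists => /forallP h.
  by apply/eqP/rowP => i; rewrite mxE; apply/eqP; move: (h i); rewrite negbK.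
pose nu' := (nu 0 i0)^-1 *: nu.
have nui : nu' 0 i0 = 1 by rewrite mxE mulVf.
have pt y t : p (y + t *: nu') = p y.
  rewrite !pE dotDr /nu' !dotZr; apply/rowP => k; rewrite !mxE.
  by field; rewrite nui0 D0.
have pB x y : p x - p y = (x - y) + (- (dot nu (x - y) / dot nu nu)) *: nu.
  by rewrite !pE dotDr dotNr; apply/rowP => k; rewrite !mxE; field.
have [N [mN N0 hN]] := regular_lines nui.
apply: (@hausdorff_null_sub _ _ _ _ ((fun z => p (line_map i0 nu' (z, 0%R))) @` N)).
  move=> _ [x [Ox fx Jx] <-]; exists (line_base i0 nu' x); last first.
    by have := pt (line_map i0 nu' (line_base i0 nu' x, 0%R)) (x 0 i0); rewrite -line_mapE line_mapK.
  apply: contrapT => /hN h; have [rho rho0 sub] := inner_ball Ox.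
  have := h x rho (x 0 i0) rho0 sub; rewrite line_mapK// => /(_ (eball_center x rho0) fx)[].
  by rewrite Jx eqxx.
(* The factor m+1 passes from the sup distance to the Euclidean one. The factor 2 bounds the
   expansion of p crudely: p x - p y is x - y plus a vector no longer than x - y. *)
apply: (@hausdorff_lipschitz_null R m m.+1 N _ (2 * m.+1%:R)) => // z z' d zd.
have d0 : 0 <= d by apply: le_trans (zd (Ordinal m0)); exact: normr_ge0.
set x := line_map _ _ _; set y := line_map _ _ _.
have xy : enorm (x - y) <= m.+1%:R * d.
  have subE (v w : 'rV[R]_m.+1) k : (v - w) 0 k = v 0 k - w 0 k by rewrite !mxE.
  apply: enorm_le_cube => // j; rewrite subE.
  case: (unliftP i0 j) => [k ->|->].
    by rewrite /x /y !line_map_lift/= !mul0r !addr0.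
  by rewrite /x /y !line_map_i//= subrr normr0.
rewrite pB.
have nup : 0 < enorm nu by exact: enorm_gt0.
apply: le_trans (enormD _ _) _; rewrite enormZ normrN normrM normfV.
rewrite [`|dot nu nu|]ger0_norm ?dot_ge0// -(sqr_sqrtr (dot_ge0 nu)) -/(enorm nu).
apply: (@le_trans _ _ (enorm (x - y) + enorm (x - y))).
  rewrite lerD2l expr2 invfM mulrA mulfVK ?gt_eqF// ler_pdivrMr// mulrC.
  rewrite ler_norml dot_le_enorm andbT lerNl -dotNr -(enormN (x - y)).
  exact: dot_le_enorm.
by lra.
Qed.

End zeros.

(** * Finiteness almost everywhere and measurability of the representative *)

Section local_averages.
Context {R : realType}.
Variables (n : nat) (Omega : set 'rV[R]_n) (x0 : 'rV[R]_n) (rho : R).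
Hypotheses (n0 : (0 < n)%N) (rho0 : 0 < rho) (sub : ecball x0 (3 * rho) `<=` Omega).
Let K := ecball x0 (3 * rho).
Let B := eball x0 rho.

Let cK : compact K. Proof. exact: (@ecball_compact R n x0 (3 * rho)). Qed.

Let mK : measurable (K : set (Rn R n)).
Proof. by apply: measurable_Rn; exact: compact_measurable_rV. Qed.

Lemma eball_sub_triple r x : 0 < r < rho -> B x -> eball x r `<=` K.
Proof.
move=> /andP[r0 rr] xr; apply: subset_trans (@eball_sub_ecball _ _ _ _) _.
apply: subset_trans (@eball_sub_ecball _ _ _ _); apply: ecball_sub_eball.
by move: xr; rewrite /B/eball/= => xr; lra.
Qed.

Lemma integrable_eball_triple (g : 'rV[R]_n -> R) r x : loc_integrable Omega g ->
  0 < r < rho -> B x -> (leb n).-integrable (eball x r) (EFin \o g).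
Proof.
move=> ig rr xr.
have mB : measurable (eball x r : set (Rn R n)) by exact: measurable_eball_Rn.
exact: (@integrableS _ _ _ _ _ _ _ mK mB (eball_sub_triple rr xr) (ig _ cK sub)).
Qed.

Lemma limf_esup_bounded (h : R -> \bar R) (M : R) :
  (forall r : R, 0 < r < rho -> (`|h r| <= M%:E)%E) -> limf_esup h 0^'+ \is a fin_num.
Proof.
move=> hM.
have l0 : limf_esup (cst 0%E : R -> \bar R) 0^'+ = 0%E.
  have supc (V : set R) : V !=set0 -> ereal_sup ((cst 0%E : R -> \bar R) @` V) = 0%E.
    move=> [r Vr]; rewrite (_ : _ @` _ = [set 0%E]) ?ereal_sup1//.
    by apply/seteqP; split => [_ [? _ <-]//|_ ->]; exists r.
  rewrite limf_esupE (_ : [set _ | _ in _] = [set 0%E]) ?ereal_inf1//.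
  apply/seteqP; split => [_ [V FV <-]|_ ->]/=; last first.
    by exists setT; [exact: filterT|rewrite supc//; exists 0].
  by rewrite supc//; exact: filter_ex FV.
suff [] : limf_esup h 0^'+ \is a fin_num /\ `|fine (limf_esup h 0^'+) - fine 0%E| <= M by [].
apply: fin_num_le_add => //.
- rewrite -l0; apply: (limf_esup_le_add rho0) => r /hM.
  by rewrite add0e; apply: le_trans; exact: lee_abs.
- rewrite -[X in (X <= _)%E]l0; apply: (limf_esup_le_add rho0) => r /hM h1.
  move: h1; case: (h r) => [s| |] //=.
  by rewrite !lee_fin ler_norml => /andP[? _]; rewrite -lerBlDr sub0r.
Qed.

(** The density bound for a Borel majorant of |g| keeps the averages bounded as r tends to 0, and a
    limsup of bounded averages is finite. *)
Lemma precise_ae_finite (g : 'rV[R]_n -> R) : loc_integrable Omega g ->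
  exists N : set 'rV[R]_n, [/\ measurable N, borel_lebesgue N = 0%E &
    forall x, B x -> ~ N x -> precise g x \is a fin_num].
Proof.
move=> ig; have /integrableP[mg gfin] := ig _ cK sub.
have mW : measurable_fun (K : set (Rn R n)) (fun x : Rn R n => `|(g x)%:E|%E).
  exact: (measurableT_comp (@abse_measurable R setT) mg).
have [H [mH H0 gH Hfin]] := @borel_majorant R n K _ mK mW (fun x _ => abse_ge0 (g x)%:E) gfin.
have [N [mN N0 hN]] := density_finite_integral mH H0 Hfin.
exists N; split; [exact: mN|exact: N0|].
move=> x Bx /hN[C [C0 hC]].
apply: (@limf_esup_bounded _ (C * n%:R ^+ n)) => r rr.
have ixr := integrable_eball_triple ig rr Bx.
have [r0 _] := andP rr.
rewrite -[X in (`|X|)%E]/(ball_average g x r) (ball_averageE ixr).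
set V := fine _; have V0 : 0 < V by exact: fine_eball_gt0.
have VE : borel_lebesgue (eball (0 : 'rV[R]_n) r) = V%:E.
  by rewrite fineK// ge0_fin_numE//; exact: borel_lebesgue_eball_lty.
have rV : r ^+ n <= n%:R ^+ n * V.
  have := @borel_lebesgue_eball_ge R n 0 r r0 n0.
  rewrite [X in (_ <= X)%E]VE lee_fin expr_div_n ler_pdivrMr ?exprn_gt0 ?ltr0n//.
  by rewrite mulrC.
rewrite abse_EFin lee_fin normrM gtr0_norm ?invr_gt0// mulrC ler_pdivrMr// -mulrA.
apply: (@le_trans _ _ (C * r ^+ n)); last by rewrite ler_wpM2l.
rewrite -lee_fin; apply: le_trans (hC r r0).
have mB := @measurable_eball R n x r.
apply: (@le_trans _ _ (\int[leb n]_(y in eball x r) H y)%E); last first.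
  rewrite ge0_integral_leb//; last exact: measurable_funTS.
  apply: ge0_subset_integral => //; [exact: measurable_cube|exact: measurable_funTS|].
  move=> y yr j; apply: le_trans (ltW yr); have := coord_le_enorm (y - x) j.
  by rewrite !mxE.
rewrite -abse_EFin fineK; last exact: (integrable_fin_num (@measurable_eball_Rn _ _ _ _) ixr).
have mBR := @measurable_eball_Rn R n x r.
have /integrableP[mgr _] := ixr.
apply: le_trans (le_abse_integral _ mBR mgr) _.
apply: ge0_le_integral.
- exact: mBR.
- by move=> y _; exact: abse_ge0.
- exact: (measurableT_comp (@abse_measurable R setT) mgr).
- exact: (measurable_fun_Rn mB (measurable_funTS mH)).
- by move=> y yr; apply: gH; exact: (eball_sub_triple rr Bx).
Qed.

Section weak_derivatives.
Variables (u g : 'rV[R]_n -> R) (v : 'I_n -> 'rV[R]_n -> R) (j : 'I_n).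
Hypotheses (oOmega : open Omega) (wg : weak_derivative Omega [:: j] u g).
Hypothesis wv : forall k, weak_derivative Omega [:: j; k] u (v k).

Let ig : loc_integrable Omega g. Proof. by have [] := wg. Qed.
Let iv k : loc_integrable Omega (v k). Proof. by have [] := wv k. Qed.

(** The ball is moved along the segment from x to y, with nu = y - x, and the mass of w on each ball
    is bounded by its mass on K. This crude bound gives continuity in the centre, from which
    measurability follows. *)
Lemma ball_integral_lipschitz : exists2 S : R, 0 <= S &
  forall r x y, 0 < r < rho -> B x -> B y ->
  `|\int[leb n]_(t in eball y r) g t - \int[leb n]_(t in eball x r) g t| <= S * enorm (y - x).
Proof.
have mO : measurable Omega by exact: open_measurable_rV.
have iabs k : (leb n).-integrable K (EFin \o (fun t => `|v k t|)).
  by have := integrable_abse (iv k cK sub).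
pose T t := \sum_k 1 * `|v k t|.
have iT : (leb n).-integrable K (EFin \o T) by exact: (integrable_linear_comb (fun=> 1) mK iabs).
have T0 t : 0 <= T t by apply: sumr_ge0 => k _; rewrite mul1r.
exists (\int[leb n]_(t in K) T t); first exact: Rintegral_ge0.
move=> r x y rr Bx By; have [->|xy] := eqVneq y x.
  by rewrite !subrr normr0 enorm0 mulr0.
have [r0 rrho] := andP rr.
pose nu := y - x; pose w t := \sum_k nu 0 k * v k t.
have iw : loc_integrable Omega w by exact: loc_integrable_linear_comb.
have wT t : `|w t| <= enorm nu * T t.
  apply: le_trans (ler_norm_sum _ _ _) _; rewrite mulr_sumr; apply: ler_sum => k _.
  by rewrite mul1r normrM ler_wpM2r// coord_le_enorm.
have tube (t : R) : 0 - 4^-1 < t < 1 + 4^-1 -> ecball (x + t *: nu) r `<=` K.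
  move=> /andP[t1 t2]; apply: subset_trans (@eball_sub_ecball _ _ _ _); apply: ecball_sub_eball.
  have -> : x + t *: nu - x0 = (1 - t) *: (x - x0) + t *: (y - x0).
    by apply/rowP => k; rewrite !mxE; ring.
  apply: le_lt_trans (lerD (enormD _ _) (lexx r)) _; rewrite !enormZ.
  have hx : `|1 - t| * enorm (x - x0) <= `|1 - t| * rho by rewrite ler_wpM2l// ltW.
  have hy : `|t| * enorm (y - x0) <= `|t| * rho by rewrite ler_wpM2l// ltW.
  have ht : `|1 - t| + `|t| <= 3 / 2.
    by case: (ger0P (1 - t)) => ?; case: (ger0P t) => ?; lra.
  have := ler_wpM2r (ltW rho0) ht; move: hx hy rrho {ht}; rewrite mulrDl; lra.
pose M : measurableTypeR R -> \bar R := cst (\int[leb n]_(t in K) (`|w t|)%:E)%E.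
have mM : measurable_fun (`[0, 1]%classic : set (measurableTypeR R)) M by exact: measurable_cst.
have hM (t : R) : 0 <= t <= 1 -> (\int[leb n]_(z in eball (x + t *: nu) r) `|w z|%:E <= M t)%E.
  move=> /andP[t0 t1]; have /integrableP[mw _] := iw _ cK sub.
  apply: ge0_subset_integral.
  - exact: measurable_eball_Rn.
  - exact: mK.
  - exact: (measurableT_comp (@abse_measurable R setT) mw).
  - by move=> z _; rewrite lee_fin.
  - by apply: subset_trans (@eball_sub_ecball _ _ _ _) _; apply: tube; lra.
have weak phi : test_function Omega phi ->
    \int[leb n]_(t in Omega) (g t * \sum_k nu 0 k * partial k phi t) =
    - \int[leb n]_(t in Omega) (w t * phi t).
  exact: (weak_directional _ mO wg wv).
have e0 : 0 < 4^-1 :> R by rewrite invr_gt0.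
have := @ball_integral_increment R n Omega K g w nu x r 0 1 4^-1 cK sub (ig cK sub)
  (iw K cK sub) r0 ltr01 e0 tube weak M mM hM.
have -> : x + 1 *: nu = y by rewrite scale1r addrC subrK.
have -> : x + 0 *: nu = x by rewrite scale0r addr0.
move=> h; rewrite -lee_fin; apply: (le_trans h) => {h}.
have mI : measurable (`[0, 1]%classic : set (measurableTypeR R)) by exact: measurable_itv.
rewrite /M (integral_cst _ mI).
rewrite [X in (_ * X <= _)%E]lebesgue_measure_itv/= lte_fin ltr01 oppr0 adde0 mule1.
rewrite mulrC EFinM fineK; last exact: (integrable_fin_num mK iT).
have mT : measurable_fun (K : set (Rn R n)) (fun t : Rn R n => (T t)%:E) by have /integrableP[] := iT.
have nT0 : 0 <= enorm nu by exact: enorm_ge0.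
have <- := @ge0_integralZl _ _ R (leb n) K mK (fun t => (T t)%:E) mT (enorm nu)%:E (fun t _ => T0 t) nT0.
apply: ge0_le_integral.
- exact: mK.
- by move=> t _; rewrite lee_fin.
- have /integrableP[mw _] := iw _ cK sub.
  exact: (measurableT_comp (@abse_measurable R setT) mw).
- by apply: emeasurable_funM; [exact: measurable_cst|exact: mT].
- by move=> t _; rewrite -EFinM lee_fin.
Qed.

Let avg r x := ball_average g x r.
Let s (k : nat) x := ereal_sup [set avg r x | r in [set r | 0 < r < rho / k.+1%:R]].

(** Each average is continuous in the centre and a supremum of continuous functions, over however
    many radii, is lower semicontinuous: its superlevel sets are open. *)
Let measurable_sup k : measurable_fun B (s k).
Proof.
have mB : measurable B by exact: measurable_eball.
apply: (measurability _ (ErealGenOInfty.measurableE R)) => // _ [_ [c ->] <-].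
apply: open_measurable_rV; rewrite openE => x [Bx].
rewrite /= in_itv/= andbT => /ereal_sup_gt[_ [r rr <-] cr].
have rr' : 0 < r < rho.
  case/andP: rr => -> /lt_le_trans; apply.
  by rewrite ler_pdivrMr ?ltr0n// ler_peMr ?(ltW rho0)// ler1n.
have [r0 _] := andP rr'.
have [S S0 hS] := ball_integral_lipschitz.
set V := fine (borel_lebesgue (eball (0 : 'rV[R]_n) r)).
have V0 : 0 < V by exact: fine_eball_gt0.
have [e1 e10 sub1] := nbhs_eball (@eball_open _ _ x0 rho) Bx.
have [I IE hI] : exists2 I : 'rV[R]_n -> R,
    forall y, B y -> avg r y = (V^-1 * I y)%:E & forall y, B y -> `|I y - I x| <= S * enorm (y - x).
  exists (fun y => \int[leb n]_(t in eball y r) g t) => y By; last exact: hS.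
  exact: (ball_averageE (integrable_eball_triple ig rr' By)).
have key y : B y -> (c%:E < avg r y)%E = (c * V < I y).
  by move=> By; rewrite IE// lte_fin mulrC ltr_pdivlMr.
move: cr; rewrite key// => cr.
pose e2 := (I x - c * V) / (S + 1).
have S1 : 0 < S + 1 by rewrite ltr_wpDl.
have e20 : 0 < e2 by rewrite divr_gt0// subr_gt0.
have sub2 : eball x (Num.min e1 e2) `<=` B `&` (s k) @^-1` `]c%:E, +oo[%classic.
  move=> y; rewrite /eball/= lt_min => /andP[ye1 ye2].
  have By : B y by exact: sub1.
  split => //; rewrite /= in_itv/= andbT.
  apply: (@lt_le_trans _ _ (avg r y)); last by apply: ereal_sup_ubound; exists r.
  rewrite key//.
  have := hI y By; rewrite ler_norml => /andP[h _].
  move: ye2; rewrite /e2 ltr_pdivlMr// mulrDr mulr1 => ye2.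
  have := enorm_ge0 (y - x); move: h ye2; rewrite [enorm _ * S]mulrC; lra.
apply: (filterS sub2); apply: open_nbhs_nbhs; split; first exact: eball_open.
by rewrite /eball/= subrr enorm0 lt_min e10.
Qed.

Lemma measurable_precise : measurable_fun B (precise g).
Proof.
(* The intervals ]0, rho/(k+1)[ are cofinal among the right neighbourhoods of 0, so the limsup is an
   infimum of countably many functions. *)
rewrite (_ : precise g = fun x => einfs (s ^~ x) 0).
  by apply: measurable_fun_einfs => k; exact: measurable_sup.
apply/funext => x; rewrite /precise limf_esupE; apply/eqP; rewrite eq_le; apply/andP; split.
  apply: le_ereal_inf_tmp => _ [k _ <-]; apply: ereal_inf_lbound.
  exists [set r | 0 < r < rho / k.+1%:R] => //.
  near=> r; apply/andP; split; near: r; first exact: nbhs_right_gt.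
  by apply: nbhs_right_lt; rewrite divr_gt0// ltr0n.
apply: le_ereal_inf_tmp => _ [V FV <-].
have [e /= e0 he] := FV.
pose k := Num.trunc (rho / e).
apply: (@le_trans _ _ (s k x)); first by apply: ereal_inf_lbound; exists k.
apply: ge_ereal_sup => _ [r /andP[r0 rk] <-]; apply: ereal_sup_ubound; exists r => //.
apply: he => //=; rewrite sub0r normrN gtr0_norm//.
apply: lt_trans rk _; rewrite ltr_pdivrMr ?ltr0n// mulrC -ltr_pdivrMr//.
exact: truncnS_gt.
Unshelve. all: by end_near. Qed.

End weak_derivatives.

End local_averages.

(** * Null sets obtained from Fubini *)

Section product_arguments.
Context {R : realType}.
Notation lam := (@lebesgue_measure R).

(* Fubini: the integral over h of |A /\ (B - h)| is |A| |B|. *)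
Lemma translate_disjoint_null n (A B : set 'rV[R]_n) : measurable A -> measurable B ->
  (forall h, BL n [set x | A x /\ B (x + h)] = 0%E) -> BL n A = 0%E \/ BL n B = 0%E.
Proof.
move=> mA mB AB.
pose S : set ('rV[R]_n * 'rV[R]_n) := (fst @^-1` A) `&` ((fun p => p.1 + p.2) @^-1` B).
have madd : measurable_fun setT (fun p : 'rV[R]_n * 'rV[R]_n => p.1 + p.2).
  apply: measurable_into_rV => i; under eq_fun do rewrite mxE.
  by apply: measurable_funD; apply: (measurableT_comp (measurable_coord_rV i)).
have mS : measurable S.
  apply: measurableI; rewrite -[X in measurable X]setTI; first exact: measurable_fst.
  exact: madd.
have S0 : (BL n \x BL n)%E S = 0%E.
  rewrite product_measure_slices//.
  by apply: integral0_eq => h _; exact: AB.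
have SE : (BL n \x BL n)%E S = (BL n B * BL n A)%E.
  rewrite /product_measure1 (eq_integral (fun x => BL n B * (\1_A x)%:E)%E); last first.
    move=> x _ /=; rewrite indicE; have [/set_mem Ax|] := boolP (x \in A).
      rewrite mule1 -(borel_lebesgue_translate x mB); congr (BL n _).
      by apply/seteqP; split => h; rewrite /xsection/= inE /S/= addrC; [case|].
    rewrite notin_setE => nA; rewrite mule0 (_ : xsection S x = set0) ?measure0//.
    by apply/seteqP; split => // h; rewrite /xsection/= inE => -[].
  rewrite (@ge0_integralZl _ _ R (BL n) setT measurableT (fun x => (\1_A x)%:E)).
  - by rewrite integral_indic// setIT.
  - by apply/measurable_EFinP; exact: measurable_indic.
  - by move=> x _; rewrite lee_fin.
  - exact: measure_ge0.
by move: S0; rewrite SE => /eqP; rewrite mule_eq0 => /orP[] /eqP; [right|left].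
Qed.

Lemma line_base_preimage_null m (i : 'I_m.+1) (nu : 'rV[R]_m.+1) (N : set 'rV[R]_m) :
  nu 0 i = 1 -> measurable N -> BL m N = 0%E ->
  measurable (line_base i nu @^-1` N) /\ BL m.+1 (line_base i nu @^-1` N) = 0%E.
Proof.
move=> nui mN N0.
have mL : measurable (line_base i nu @^-1` N).
  by rewrite -[X in measurable X]setTI; exact: measurable_line_base.
split => //; rewrite -(line_map_measure nui mL).
have -> : line_map i nu @^-1` (line_base i nu @^-1` N) = N `*` setT.
  by apply/seteqP; split => p; rewrite /preimage/= line_baseK//= => -[].
by rewrite product_measure1E// [X in (X * _)%E]N0 mul0e.
Qed.

End product_arguments.

Lemma continuous_same_sign (R : realType) (phi : R -> R) (s t : R) : s <= t ->
  {within `[s, t], continuous phi} -> (forall u, s <= u <= t -> phi u != 0) -> 0 < phi s * phi t.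
Proof.
move=> st cphi phi0; rewrite ltNge; apply/negP => neg.
have [|c cst0 c0] := @IVT R phi s t 0 st cphi; last first.
  by move: cst0; rewrite in_itv/= => /phi0; rewrite c0 eqxx.
rewrite ge_min le_max; have [ps0|ps0] := ltP (phi s) 0.
  by rewrite (ltW ps0)/=; move: neg; rewrite nmulr_rle0// => ->; rewrite orbT.
have ps1 : 0 < phi s by rewrite lt_neqAle ps0 eq_sym phi0// lexx.
by move: neg; rewrite pmulr_rle0// => ->; rewrite orbT/= ?ps0.
Qed.

(** * Constancy of the sign on segments of good lines *)

Section sign.
Context {R : realType}.
Variables (m : nat) (Omega : set 'rV[R]_m.+1) (q a : R).
Variables (f : 'rV[R]_m.+1 -> 'rV[R]_m.+1) (Df : 'rV[R]_m.+1 -> 'M[R]_m.+1).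
Hypotheses (oOmega : open Omega) (q1 : 1 < q).
Hypotheses (sob : sobolev_map Omega 2 q f) (jac : weak_jacobian Omega f Df).
Hypotheses (a0 : 0 < a) (alpha_a : 1 <= (1 - q^-1) * a).
Let J := precise_det Df.
Hypothesis iJ : (leb m.+1).-integrable Omega (fun x => neg_power (J x) a).
Let alpha := 1 - q^-1.

Let alpha0 : 0 < alpha.
Proof. by rewrite subr_gt0 invf_lt1// (lt_trans _ q1). Qed.

Lemma line_map_between (i0 : 'I_m.+1) (nu x0 : 'rV[R]_m.+1) (rho s t u : R) z :
  s <= u <= t -> eball x0 rho (line_map i0 nu (z, s)) -> eball x0 rho (line_map i0 nu (z, t)) ->
  eball x0 rho (line_map i0 nu (z, u)).
Proof.
move=> /andP[su ut] hs ht; have [st|] := ltP s t; last first.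
  by move=> ts; have -> : u = s by apply/eqP; rewrite eq_le su (le_trans ut ts).
pose l := (u - s) / (t - s).
have l0 : 0 <= l by apply: divr_ge0; rewrite subr_ge0// ltW.
have l1 : l <= 1 by rewrite /l ler_pdivrMr ?subr_gt0// mul1r lerD2r.
rewrite /eball/= in hs ht *.
have -> : line_map i0 nu (z, u) - x0 =
    (1 - l) *: (line_map i0 nu (z, s) - x0) + l *: (line_map i0 nu (z, t) - x0).
  rewrite (line_mapE i0 nu z u) (line_mapE i0 nu z s) (line_mapE i0 nu z t) /l.
  move: (line_map _ _ _) => p; apply/rowP => k; rewrite !mxE; field.
  by rewrite subr_eq0 gt_eqF.
apply: le_lt_trans (enormD _ _) _; rewrite !enormZ !ger0_norm ?subr_ge0//.
set A := enorm (line_map i0 nu (z, s) - x0) in hs *.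
set B := enorm (line_map i0 nu (z, t) - x0) in ht *.
have [l00|lp] := eqVneq l 0; first by rewrite l00; lra.
have lp' : 0 < l by rewrite lt_neqAle eq_sym lp.
have h1 : (1 - l) * A <= (1 - l) * rho by rewrite ler_wpM2l ?subr_ge0// ltW.
have h2 : l * B < l * rho by rewrite ltr_pM2l.
by lra.
Qed.

(** Finiteness is assumed at s only: [regular_lines] carries it to all points in between and makes J
    continuous and nonzero there. *)
Lemma no_sign_change (i0 : 'I_m.+1) (nu : 'rV[R]_m.+1) : nu 0 i0 = 1 ->
  exists N : set 'rV[R]_m, [/\ measurable N, BL m N = 0%E &
    forall z, ~ N z -> forall (x0 : 'rV[R]_m.+1) (rho s t : R),
      0 < rho -> ecball x0 (3 * rho) `<=` Omega -> s <= t ->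
      eball x0 rho (line_map i0 nu (z, s)) -> eball x0 rho (line_map i0 nu (z, t)) ->
      precise_finite Df (line_map i0 nu (z, s)) ->
      0 < J (line_map i0 nu (z, s)) * J (line_map i0 nu (z, t))].
Proof.
move=> nui; have [N [mN N0 hN]] := regular_lines oOmega q1 sob jac a0 alpha_a iJ nui.
exists N; split; [exact: mN|exact: N0|].
move=> z /hN hz x0 rho s t rho0 sub st xs xt fs.
have [_ hfin _] := hz x0 rho s rho0 sub xs fs.
have inb u : s <= u <= t -> eball x0 rho (line_map i0 nu (z, u)).
  by move=> sut; exact: line_map_between sut xs xt.
pose phi u := J (line_map i0 nu (z, u)).
have phi0 u : s <= u <= t -> phi u != 0.
  move=> sut; have [h _ _] := hz x0 rho u rho0 sub (inb u sut) (hfin u (inb u sut)).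
  exact: h.
have cphi : {within `[s, t], continuous phi}.
  apply: continuous_in_subspaceT => u /set_mem; rewrite /= in_itv/= => sut.
  have [_ _ [D [delta [D0 d0 hd]]]] := hz x0 rho u rho0 sub (inb u sut) (hfin u (inb u sut)).
  apply/cvgrPdist_lt => e e0.
  have eD : 0 < e / D by rewrite divr_gt0.
  pose d' := (e / D) `^ alpha^-1.
  have d'0 : 0 < d' by exact: powR_gt0.
  near=> y.
  have yd : `|y - u| < delta.
    by rewrite distrC; near: y; exact: cvgr_dist_lt.
  have yd' : `|y - u| < d'.
    by rewrite distrC; near: y; exact: cvgr_dist_lt.
  rewrite distrC; apply: le_lt_trans (hd y yd) _.
  rewrite mulrC -ltr_pdivlMr//.
  have -> : e / D = d' `^ alpha.
    by rewrite /d' -powRrM mulVf ?gt_eqF// powRr1// ltW.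
  by apply: gt0_ltr_powR; rewrite ?nnegrE// ltW.
exact: (continuous_same_sign st cphi phi0).
Unshelve. all: by end_near. Qed.

Lemma precise_det_measurable (x0 : 'rV[R]_m.+1) (rho : R) : 0 < rho -> ecball x0 (3 * rho) `<=` Omega ->
  measurable [set x | eball x0 rho x /\ precise_finite Df x] /\
  measurable_fun (eball x0 rho) J.
Proof.
move=> rho0 sub.
have mB : measurable (eball x0 rho) by exact: measurable_eball.
have mF i j : measurable_fun (eball x0 rho) (precise (fun y => Df y i j)).
  have [_ hs] := sob i.
  have hv k : exists v, weak_derivative Omega [:: j; k] (fun x => f x ord0 i) v.
    by have [v _ ?] := hs [:: j; k] isT; exists v.
  have [v hv'] := choice hv.
  exact: (measurable_precise (ltn0Sn m) rho0 sub oOmega (jac i j) hv').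
split.
  rewrite (_ : [set _ | _] = eball x0 rho `&` \bigcap_(p in [set: 'I_m.+1 * 'I_m.+1])
      (eball x0 rho `&` [set x | precise (fun y => Df y p.1 p.2) x \is a fin_num])); last first.
    apply/seteqP; split => x [Bx h]; split => //; first by move=> p _; split => //; exact: h.
    by move=> i j; have [] := h (i, j) Logic.I.
  apply: measurableI => //; apply: fin_bigcap_measurable => // p _.
  exact: emeasurable_fin_num.
rewrite /J /precise_det /determinant.
apply: measurable_sum => s; apply: measurable_funM; first exact: measurable_cst.
apply: measurable_prod => i _; under eq_fun do rewrite mxE.
by apply: (measurableT_comp (fine_measurable measurableT)).
Qed.

End sign.

(** * From balls to a connected open set *)

Section local_to_global.
Context {R : realType}.
Variable n : nat.

(** Every point of A lies in a dyadic cube with negligible trace on A, and there are countably many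
    cubes. *)
Lemma negligible_local (A : set 'rV[R]_n) :
  (forall x, A x -> exists2 r, 0 < r & (leb n).-negligible (eball x r `&` A)) ->
  (leb n).-negligible A.
Proof.
move=> hA.
pose S : set (nat * 'rV[int]_n) := [set kv | (leb n).-negligible (@dcube R n kv `&` A)].
have : (leb n).-negligible (\bigcup_j (@dcube_seq R n S j `&` A)).
  apply: negligible_bigcup => j; rewrite /dcube_seq.
  case: pickle_inv => [kv|]; last by rewrite set0I; exact: negligible_set0.
  by case: asboolP => // _; rewrite set0I; exact: negligible_set0.
apply: negligibleS => x Ax; rewrite -setI_bigcupl; split => //.
rewrite bigcup_dcube_seq.
have [r r0 nr] := hA x Ax.
have n1 : 0 < n%:R + 1 :> R by rewrite ltr_wpDl.
have [k hk] : exists k, (2 : R) ^- k < r / (n%:R + 1).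
  by apply: exists_exprVn_lt; rewrite divr_gt0.
exists (k, cell k x); last by [].
apply: negligibleS nr; apply: setSI => y /= yx; rewrite /eball/=.
apply: (@le_lt_trans _ _ (n%:R * 2 ^- k)).
  apply: enorm_le_cube => j; rewrite !mxE; exact: ltW (dcube_dist yx j).
move: hk; rewrite ltr_pdivlMr// mulrDr mulr1 => hk; apply: le_lt_trans hk.
by rewrite mulrC lerDl.
Qed.

Lemma eball_not_negligible (x : 'rV[R]_n) r : (0 < n)%N -> 0 < r ->
  ~ (leb n).-negligible (eball x r).
Proof.
move=> n0 r0 /(measure_negligible (measurable_eball_Rn x r)).
rewrite [LHS]leb_borel; last exact: measurable_eball.
have h := @borel_lebesgue_eball_ge R n x r r0 n0.
move=> e; move: h; rewrite [X in (_ <= X)%E]e lee_fin leNgt => /negP; apply.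
by rewrite exprn_gt0// divr_gt0// ltr0n.
Qed.

(** The points near which P b holds almost everywhere form an open set. The two open sets cover
    Omega, and they are disjoint because no ball is negligible. *)
Lemma connected_ae_sign (Omega : set 'rV[R]_n) (P : bool -> set 'rV[R]_n) : (0 < n)%N ->
  connected Omega -> (forall x, P true x -> P false x -> False) ->
  (forall x, Omega x -> exists2 r, 0 < r & exists b, (leb n).-negligible (eball x r `&` ~` P b)) ->
  exists b, (leb n).-negligible (Omega `&` ~` P b).
Proof.
move=> n0 cO disj loc.
pose Q b := [set x : 'rV[R]_n | exists2 r, 0 < r & (leb n).-negligible (eball x r `&` ~` P b)].
have oQ b : open (Q b).
  rewrite openE => x [r r0 nr].
  apply: (@filterS _ _ _ (eball x r)); last first.
    by apply: open_nbhs_nbhs; split; [exact: eball_open|rewrite /eball/= subrr enorm0].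
  move=> y /(nbhs_eball (@eball_open _ _ x r))[e e0 sub]; exists e => //.
  by apply: negligibleS nr; exact: setSI.
have QQ x : Q true x -> Q false x -> False.
  move=> [r r0 nr] [r' r'0 nr']; have rr : 0 < Num.min r r' by rewrite lt_min r0.
  apply: (@eball_not_negligible x (Num.min r r')) => //.
  apply: negligibleS (negligibleU nr nr') => y; rewrite /eball/= lt_min => /andP[y1 y2].
  by have [Py|nP] := pselect (P true y); [right; split => // Pf; exact: (disj y)|left].
have cov x : Omega x -> Q true x \/ Q false x.
  by move=> /loc[r r0 [[] nr]]; [left|right]; exists r.
have all b : (forall x, Omega x -> Q b x) -> (leb n).-negligible (Omega `&` ~` P b).
  move=> h; apply: negligible_local => x [Ox _]; have [r r0 nr] := h x Ox.
  by exists r => //; apply: negligibleS nr => y [? []].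
have [ne|em] := pselect ((Omega `&` Q true) !=set0); last first.
  exists false; apply: all => x Ox; have [Qx|//] := cov x Ox.
  by exfalso; apply: em; exists x.
exists true; apply: all => x Ox.
have E : Omega `&` Q true = Omega; last by move: Ox; rewrite -{1}E => -[].
apply: cO => //; first by exists (Q true).
exists (~` Q false); first exact: open_closedC.
apply/seteqP; split => y [Oy Qy]; split => //; first by move=> ?; exact: (QQ y).
by have [] := cov y Oy.
Qed.

End local_to_global.

Lemma measurable_sign (R : realType) d (T : measurableType d) (B : set T) (u : T -> R) :
  measurable B -> measurable_fun B u ->
  measurable (B `&` [set x | 0 < u x]) /\ measurable (B `&` [set x | u x < 0]).
Proof.
move=> mB mu.
have m (I : interval R) : measurable (B `&` u @^-1` [set` I]) by apply: mu => //; exact: measurable_itv.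
split.
  rewrite (_ : [set _ | _] = u @^-1` [set` `]0, +oo[]); first exact: m.
  by apply/seteqP; split => x; rewrite /= in_itv/= ?andbT.
rewrite (_ : [set _ | _] = u @^-1` [set` `]-oo, 0[]); first exact: m.
by apply/seteqP; split => x; rewrite /= in_itv.
Qed.

(** * The sign of the Jacobian almost everywhere *)

Section local_sign.
Context {R : realType}.
Variables (m : nat) (Omega : set 'rV[R]_m.+1) (q a : R).
Variables (f : 'rV[R]_m.+1 -> 'rV[R]_m.+1) (Df : 'rV[R]_m.+1 -> 'M[R]_m.+1).
Hypotheses (oOmega : open Omega) (q1 : 1 < q).
Hypotheses (sob : sobolev_map Omega 2 q f) (jac : weak_jacobian Omega f Df).
Hypotheses (a0 : 0 < a) (alpha_a : 1 <= (1 - q^-1) * a).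
Let J := precise_det Df.
Hypothesis iJ : (leb m.+1).-integrable Omega (fun x => neg_power (J x) a).

Let pos : set 'rV[R]_m.+1 := [set x | 0 < J x].
Let neg : set 'rV[R]_m.+1 := [set x | J x < 0].

Section ball.
Variables (x0 : 'rV[R]_m.+1) (rho : R).
Hypotheses (rho0 : 0 < rho) (sub : ecball x0 (3 * rho) `<=` Omega).
Let B := eball x0 rho.
Let fin := [set x | B x /\ precise_finite Df x].

(** The points x and x + h lie on one line of direction h, so opposite signs put that line among
    those excluded by [no_sign_change]; N is the union of the excluded lines. *)
Lemma translate_sign_null (h : 'rV[R]_m.+1) :
  exists N : set 'rV[R]_m.+1, [/\ measurable N, BL m.+1 N = 0%E &
    forall x, fin x -> fin (x + h) -> J x * J (x + h) < 0 -> N x].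
Proof.
(* h = 0 gives no direction, but a square is never negative. *)
have [->|h0] := eqVneq h 0.
  exists set0; split; [exact: measurable0|exact: measure0|].
  move=> x _ _; rewrite addr0 => neg0; have := sqr_ge0 (J x).
  by rewrite expr2 leNgt neg0.
have [i0 hi0] : exists i0, h 0 i0 != 0.
  apply/existsP; apply: contraNT h0; rewrite negb_exists => /forallP k.
  by apply/eqP/rowP => i; rewrite mxE; apply/eqP; move: (k i); rewrite negbK.
pose nu := (h 0 i0)^-1 *: h.
have nui : nu 0 i0 = 1 by rewrite mxE mulVf.
have [N [mN N0 hN]] := no_sign_change oOmega q1 sob jac a0 alpha_a iJ nui.
have [mN' N'0] := line_base_preimage_null nui mN N0.
exists (line_base i0 nu @^-1` N); split; [exact: mN'|exact: N'0|].
move=> x [Bx fx] [Bxh fxh] neg0; apply: contrapT => /hN hz.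
pose L t := line_map i0 nu (line_base i0 nu x, t).
have Lx : L (x 0 i0) = x by exact: line_mapK.
have Lxh : L (x 0 i0 + h 0 i0) = x + h.
  rewrite -[in RHS]Lx /L line_mapE [in RHS]line_mapE scalerDl addrA; congr (_ + _).
  by rewrite /nu scalerA mulfV// scale1r.
(* The sign of h at i0 decides which of x and x + h comes first on the line. *)
have [hp|hn] := leP 0 (h 0 i0).
  have := hz x0 rho (x 0 i0) (x 0 i0 + h 0 i0) rho0 sub; rewrite -/(L _) -/(L _) Lx Lxh lerDl.
  by move=> /(_ hp Bx Bxh fx); rewrite ltNge (ltW neg0).
have := hz x0 rho (x 0 i0 + h 0 i0) (x 0 i0) rho0 sub; rewrite -/(L _) -/(L _) Lx Lxh gerDl.
by move=> /(_ (ltW hn) Bxh Bx fxh); rewrite mulrC ltNge (ltW neg0).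
Qed.

Lemma nonfinite_or_zero_negligible :
  (leb m.+1).-negligible (B `&` [set x | ~ precise_finite Df x \/ J x = 0]).
Proof.
have hN (p : 'I_m.+1 * 'I_m.+1) : exists N : set 'rV[R]_m.+1, (leb m.+1).-negligible N /\
    forall x, B x -> ~ N x -> precise (fun y => Df y p.1 p.2) x \is a fin_num.
  have [_ ig _] := jac p.1 p.2.
  have [N [mN N0 h]] := precise_ae_finite (ltn0Sn m) rho0 sub ig.
  by exists N; split => //; exact: negligible_leb_borel.
have [N hN'] := choice hN.
pose M k := if @unpickle ('I_m.+1 * 'I_m.+1)%type k is Some p then N p else set0.
have nM : (leb m.+1).-negligible (\bigcup_k M k).
  apply: negligible_bigcup => k; rewrite /M; case: unpickle => [p|]; last exact: negligible_set0.
  exact: (hN' p).1.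
have mO : measurable (Omega : set (Rn R m.+1)) by apply: measurable_Rn; exact: open_measurable_rV.
(* [neg_power] is infinite at a zero of J, so its integrability makes the zeros negligible. *)
have := integrable_ae mO iJ => nJ.
apply: negligibleS (negligibleU nM nJ) => x [Bx [nf|Jx]].
  left; apply: contrapT => nMx; apply: nf => i j.
  apply: (hN' (i, j)).2 => // Nx; apply: nMx; exists (pickle (i, j)) => //.
  by rewrite /M pickleK.
right => /= /(_ _); rewrite /neg_power Jx eqxx => h.
suff : (+oo : \bar R)%E \is a fin_num by [].
apply: h; apply: sub; apply: ltW; apply: lt_trans Bx _.
by rewrite ltr_pMl// ltr1n.
Qed.

Lemma local_sign : exists b : bool,
  (leb m.+1).-negligible (B `&` ~` (if b then pos else neg)).
Proof.
have [mfin mJ] := precise_det_measurable oOmega sob jac rho0 sub.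
have mB : measurable B by exact: measurable_eball.
have [mpos mneg] := measurable_sign mB mJ.
pose P := fin `&` (B `&` pos); pose M := fin `&` (B `&` neg).
have mP : measurable P by exact: measurableI.
have mM : measurable M by exact: measurableI.
have mtr (h : 'rV[R]_m.+1) : measurable_fun setT (fun x : 'rV[R]_m.+1 => x + h).
  apply: measurable_into_rV => i; under eq_fun do rewrite mxE.
  by apply: measurable_funD; [exact: measurable_coord_rV|exact: measurable_cst].
have PM (h : 'rV[R]_m.+1) : BL m.+1 [set x | P x /\ M (x + h)] = 0%E.
  have [N [mN N0 hN]] := translate_sign_null h.
  apply: (subset_measure0 _ mN) => //.
  - apply: (measurableI P _ mP).
    by rewrite -[X in measurable X]setTI; apply: mtr.
  - move=> x [[fx [_ Jx]] [fxh [_ Jxh]]].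
    by apply: hN; [exact: fx|exact: fxh|rewrite pmulr_rlt0; [exact: Jxh|exact: Jx]].
have bad := nonfinite_or_zero_negligible.
have split_ (A C : set 'rV[R]_m.+1) : measurable C -> BL m.+1 C = 0%E ->
    (forall x, B x -> ~ A x -> C x \/ (~ precise_finite Df x \/ J x = 0)) ->
    (leb m.+1).-negligible (B `&` ~` A).
  move=> mC C0 h; apply: negligibleS (negligibleU (negligible_leb_borel mC C0) bad) => x [Bx Ax].
  by have [?|?] := h x Bx Ax; [left|right].
have trichotomy x : B x -> [\/ P x, M x | ~ precise_finite Df x \/ J x = 0].
  move=> Bx; have [fx|nf] := pselect (precise_finite Df x); last by apply: Or33; left.
  by have [J0|J0|J0] := ltgtP (J x) 0; [apply: Or32|apply: Or31|apply: Or33; right].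
have [P0|M0] := translate_disjoint_null mP mM PM.
- exists false; apply: (split_ _ P mP P0) => x Bx nJ.
  by have [?|[_ [_ ?]]|?] := trichotomy x Bx; [left|exfalso; exact: nJ|right].
- exists true; apply: (split_ _ M mM M0) => x Bx nJ.
  by have [[_ [_ ?]]|?|?] := trichotomy x Bx; [exfalso; exact: nJ|left|right].
Qed.

End ball.

Lemma ae_sign : connected Omega ->
  (\forall x \ae leb m.+1, Omega x -> 0 < J x) \/ (\forall x \ae leb m.+1, Omega x -> J x < 0).
Proof.
move=> cO.
have [||b nb] := @connected_ae_sign R m.+1 Omega (fun b => if b then pos else neg) (ltn0Sn m) cO.
- by move=> x; rewrite /pos/neg/= => h1 /(lt_trans h1); rewrite ltxx.
- move=> x Ox; have [rho rho0 sub] := inner_ball oOmega Ox.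
  by exists rho => //; exact: local_sign.
by case: b nb => nb; [left|right]; apply: negligibleS nb => x /= /not_implyP.
Qed.

End local_sign.

Theorem theorem1p2 (R : realType) (n : nat) (Omega : set 'rV[R]_n) (q a : R)
    (f : 'rV[R]_n -> 'rV[R]_n) (Df : 'rV[R]_n -> 'M[R]_n) :
  (2 <= n)%N ->
  open Omega -> connected Omega ->
  1 < q -> 0 < a -> 1 <= (1 - 1 / q) * a ->
  sobolev_map Omega 2 q f ->
  weak_jacobian Omega f Df ->
  (leb n).-integrable Omega (fun x => neg_power (precise_det Df x) a) ->
  (forall (nu : 'rV[R]_n) (c : R) (p : 'rV[R]_n -> 'rV[R]_n),
    nu != 0 -> orthogonal_projection (hyperplane nu c) p ->
    hausdorff n.-1 (p @` [set x | [/\ Omega x, precise_finite Df x &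
                                       precise_det Df x = 0]]) = 0%E) /\
  ((\forall x \ae leb n, Omega x -> 0 < precise_det Df x) \/
   (\forall x \ae leb n, Omega x -> precise_det Df x < 0)).
Proof.
case: n Omega f Df => // m Omega f Df m1 oO cO q1 a0; rewrite div1r => qa sob jac iJ; split.
  by move=> nu c p nu0 hp; apply: (zeros_projection_null oO q1 sob jac a0 qa iJ _ nu0 hp).
exact: (ae_sign oO q1 sob jac a0 qa iJ cO).
Qed.
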